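(* Let $B>1$ be a real number and let $\{z_n\}_{n\ge 1}$ be a sequence of real numbers in $[0,1]$. Let $$E_2(\{z_n\}_{n\ge 1},B)=\{x\in[0,1): |T^nx-z_n|\,|T^{n+1}x-Tz_n|<B^{-n}\ \text{for infinitely many } n\},$$ where $T$ is the Gauss map. Then $$\dim_{\mathrm H} E_2(\{z_n\}_{n\ge 1},B)=\limsup_{n\to\infty}s_n,$$ where $\dim_{\mathrm H}$ denotes Hausdorff dimension and $s_n$ is the $n$th pre-dimensional number associated with $z_n$ and $B$ (defined in the context).
   Context: $\mathbb N=\{1,2,3,\dots\}$. The Gauss map $T$ is given by $T(0)=0$ and $T(x)=1/x-\lfloor 1/x\rfloor$ for $x\in(0,1)$; the same formula is used at $x=1$, i.e. $T(1)=0$. For $x\in(0,1]$, $a_1(x)=\lfloor 1/x\rfloor$, and by convention $a_1(0)=+\infty$. For $(a_1,\dots,a_n)\in\mathbb N^n$, $q_n(a_1,\dots,a_n)$ is the denominator of the continued fraction $[a_1,\dots,a_n]$, given by the recursion $q_{-1}=0$, $q_0=1$, $q_{j+1}=a_{j+1}q_j+q_{j-1}$ for $0\le j\le n-1$. For each $n\ge1$ define $$s_{n,1}=\inf\Big\{s\in[0,1]:\sum_{a_1,\dots,a_n\in\mathbb N}\frac{1}{q_n(a_1,\dots,a_n)^{2s}B^{ns^2}}\le 1\Big\},$$ $$s_{n,2}=\inf\Big\{s\in[0,1]:\sum_{a_1,\dots,a_n\in\mathbb N}\frac{a_1(z_n)^{1-s}}{q_n(a_1,\dots,a_n)^{2s}B^{ns}}\le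 1\Big\},$$ $$s_{n,3}=\inf\Big\{s\in[0,1]:\sum_{a_1,\dots,a_n\in\mathbb N}\frac{1}{q_n(a_1,\dots,a_n)^{2s}a_1(z_n)^sB^{ns/2}}\le 1\Big\}.$$ If $z_n=0$ (so $a_1(z_n)=+\infty$), one sets $s_{n,2}=1$ and $s_{n,3}=0$. The $n$th pre-dimensional number is $$s_n=\begin{cases}s_{n,1}&\text{if } s_{n,1}\le s_{n,2},\\ \max\{s_{n,2},s_{n,3}\}&\text{if } s_{n,1}>s_{n,2}.\end{cases}$$ *)

(* Defs.v *)
From HB Require Import structures.
From mathcomp Require Import all_boot all_order all_algebra.
From mathcomp Require Import all_classical all_reals all_analysis.

Set Implicit Arguments.
Unset Strict Implicit.
Unset Printing Implicit Defensive.

Import Order.TTheory GRing.Theory Num.Theory.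
Import numFieldNormedType.Exports.

Local Open Scope classical_set_scope.
Local Open Scope ring_scope.

(* [diam set0 = -oo]; this value is harmless below, where the empty set may
   always be used in a covering and is given cost 0. *)
Definition diam (R : realType) (U : set R) : \bar R :=
  ereal_sup [set (`|p.1 - p.2|)%:E | p in U `*` U].

(* The guard is for [s = 0], where a nonempty set costs 1 (as 0 `^ 0 = 1) and
   the empty set costs 0. *)
Definition hausdorff_cost (R : realType) (s : R) (U : set R) : \bar R :=
  if U == set0 then 0%E else (diam U `^ s)%E.

Definition is_delta_cover (R : realType) (delta : R) (A : set R)
    (U : nat -> set R) : Prop :=
  A `<=` \bigcup_i U i /\ forall i, (diam (U i) <= delta%:E)%E.

Definition hausdorff_content (R : realType) (s delta : R) (A : set R) :
    \bar R :=
  ereal_inf [set (\sum_(0 <= i <oo) hausdorff_cost s (U i))%E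
            | U in is_delta_cover delta A].

Definition hausdorff_measure (R : realType) (s : R) (A : set R) : \bar R :=
  ereal_sup [set hausdorff_content s delta A
            | delta in [set delta : R | 0 < delta]].

Definition hausdorff_dim (R : realType) (A : set R) : \bar R :=
  ereal_inf [set s%:E
            | s in [set s : R | 0 <= s /\ hausdorff_measure s A = 0%E]].

Definition gauss_map (R : realType) (x : R) : R :=
  if x == 0 then 0 else x^-1 - (Num.floor x^-1)%:~R.

Definition first_digit (R : realType) (x : R) : \bar R :=
  if x == 0 then +oo%E else ((Num.floor x^-1)%:~R)%:E.

(* The state of the fold is (q_{j-1}, q_j), starting from (q_{-1}, q_0). *)
Definition cf_denom (a : seq nat) : nat :=
  (foldl (fun q d => (q.2, (d * q.2 + q.1)%N)) (0%N, 1%N) a).2.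

Definition pos_tuples (n : nat) : set (n.-tuple nat) :=
  [set a | forall i, (0 < tnth a i)%N].

Arguments pos_tuples n : clear implicits.

(* With values in \bar R, so that the infimum of the empty set is +oo; this can
   only occur below for finitely many n. *)
Definition critical_exponent (R : realType) (n : nat)
    (w : R -> n.-tuple nat -> R) : \bar R :=
  ereal_inf [set s%:E | s in [set s : R | 0 <= s <= 1 /\
    (\esum_(a in pos_tuples n) (w s a)%:E <= 1)%E]].

Definition predim1 (R : realType) (B : R) (n : nat) : \bar R :=
  critical_exponent (fun (s : R) (a : n.-tuple nat) =>
    1 / ((cf_denom a)%:R `^ (2 * s) * B `^ (n%:R * s ^+ 2))).

Definition predim2 (R : realType) (B : R) (n : nat) (z : R) : \bar R :=
  if first_digit z is d%:E then
    critical_exponent (fun (s : R) (a : n.-tuple nat) =>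
      d `^ (1 - s) / ((cf_denom a)%:R `^ (2 * s) * B `^ (n%:R * s)))
  else 1%E.

Definition predim3 (R : realType) (B : R) (n : nat) (z : R) : \bar R :=
  if first_digit z is d%:E then
    critical_exponent (fun (s : R) (a : n.-tuple nat) =>
      1 / ((cf_denom a)%:R `^ (2 * s) * d `^ s * B `^ (n%:R * s / 2)))
  else 0%E.

Definition predim (R : realType) (B : R) (n : nat) (z : R) : \bar R :=
  if (predim1 B n <= predim2 B n z)%E then predim1 B n
  else maxe (predim2 B n z) (predim3 B n z).

Definition E2 (R : realType) (z : nat -> R) (B : R) : set R :=
  [set x : R | 0 <= x < 1 /\
    infinite_set [set n : nat | (1 <= n)%N /\
      `|iter n (@gauss_map R) x - z n| *
      `|iter n.+1 (@gauss_map R) x - gauss_map (z n)| < B ^- n]].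

(* Main.v *)
Require Import Defs.
From mathcomp Require Import all_boot all_order all_algebra.
From mathcomp Require Import all_classical all_reals all_analysis.
From mathcomp Require Import ring lra zify.

Set Implicit Arguments.
Unset Strict Implicit.
Unset Printing Implicit Defensive.

Import Order.TTheory GRing.Theory Num.Theory.
Import numFieldNormedType.Exports.
Local Open Scope classical_set_scope.
Local Open Scope ring_scope.

(** Let eps = B^-n, let d be the first digit of z_n and t its image under the
    Gauss map T. A word w of n digits, with denominator q, defines an inverse
    branch cf w of the n-th iterate of T; it contracts [0, 1] onto a cylinder
    with bounded distortion, by a factor of about q^-2. Hence the n-th condition,
    seen in the cylinder of w, is a copy at scale q^-2 of the set of the y with
    |y - z_n| |T y - t| < eps. Inside the cylinder of a first digit k this set is
    a strip around the point with T y = t, of length about eps d/(k |k - d|) for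
    k different from d and sqrt(eps)/d for k = d.

    Upper bound. Covering every strip costs eps^s d^(1-s) + eps^(s/2) d^-s to the
    power s, and this gives s_(n,2) and s_(n,3). One may instead cover the strips
    of the digits up to eps^-s and close with the interval [0, eps^s]; this costs
    eps^(s^2), gives s_(n,1), and is legitimate unless d is so small that the
    strip around z_n is too expensive. If s_(n,1) <= s_(n,2), this exception does
    not occur: the partition function, that is the sum of q^(-2s) over words, is
    finite and continuous above 1/2 and infinite at 1/2, and for small d this
    would force s_(n,2) < s_(n,1) (crit2_lt_crit1). Above the upper limit the
    costs decay geometrically, and the easy half of Borel-Cantelli applies
    (covered_predim, E2_null).

    Lower bound. Fix t < s below the upper limit. A cover by sets of sizes r_i,
    with the sum of the r_i^t small, is beaten by nested cylinders. The load of a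
    set S is the sum of the r_i^t over the covering sets that meet S, and every
    step bounds it by a pigeonhole argument. Since s < s_n for infinitely many n,
    the partition functions at s exceed thresholds M_n(s), which have the same
    exponential rate tau for infinitely many of these n. The words of one such
    length l serve as blocks: appending blocks, one reaches any later length n in
    a cylinder w with load at most about B^(-n tau) q^(-2t) (descend). For n of
    the same rate this is much less than q^(-2t) / M_n(t), because M_n(t) is
    exponentially smaller than M_n(s). The number 1 / M_n(t) is, up to a constant,
    the largest cost that a cover of the n-th target set may be required to pay:
    a suitable family of strips, namely a run of about min(d, eps^-t) consecutive
    digits or the digit d alone, is too well spread to be covered more cheaply
    (load_spread, target_exists). So some strip has small load, and inside it
    there is again a cylinder of small load (run_exists, round_step). The process
    repeats with larger n; the common point of the cylinders satisfies the
    condition infinitely often, and it is not covered since the loads tend to 0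
    (cover_cost_ge). *)

(** * Continued fraction words and their inverse branches *)

Definition pos_word : pred (seq nat) := all (leq 1).

Definition cf_prev (w : seq nat) : nat :=
  (foldl (fun q d => (q.2, (d * q.2 + q.1)%N)) (0%N, 1%N) w).1.

Definition cf (R : realType) (w : seq nat) (y : R) : R :=
  foldr (fun a x => (a%:R + x)^-1) y w.

Lemma cf_denom_rcons w a :
  cf_denom (rcons w a) = (a * cf_denom w + cf_prev w)%N.
Proof. by rewrite /cf_denom /cf_prev foldl_rcons. Qed.

Lemma cf_prev_rcons w a : cf_prev (rcons w a) = cf_denom w.
Proof. by rewrite /cf_denom /cf_prev foldl_rcons. Qed.

Lemma pos_word_rcons w a : pos_word (rcons w a) = (0 < a)%N && pos_word w.
Proof. by rewrite /pos_word all_rcons. Qed.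

Lemma pos_word_cat v w : pos_word (v ++ w) = pos_word v && pos_word w.
Proof. by rewrite /pos_word all_cat. Qed.

Lemma cf_denom_prev w :
  pos_word w -> (0 < cf_denom w)%N /\ (cf_prev w <= cf_denom w)%N.
Proof.
elim/last_ind: w => [|w a IH] //.
rewrite pos_word_rcons cf_denom_rcons cf_prev_rcons => /andP[a0 /IH[]].
nia.
Qed.

Lemma cf_denom_gt0 w : pos_word w -> (0 < cf_denom w)%N.
Proof. by case/cf_denom_prev. Qed.

Lemma cf_denom_ge_mul w a : (a * cf_denom w <= cf_denom (rcons w a))%N.
Proof. by rewrite cf_denom_rcons leq_addr. Qed.

Lemma cf_denom_rcons_le w a :
  pos_word w -> (cf_denom (rcons w a) <= a.+1 * cf_denom w)%N.
Proof. by move=> /cf_denom_prev[_]; rewrite cf_denom_rcons; nia. Qed.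

Lemma size_le_cf_denom w : pos_word w -> (size w <= cf_denom w)%N.
Proof.
elim/last_ind: w => [|w a IH] //.
rewrite pos_word_rcons size_rcons cf_denom_rcons => /andP[a0 pw].
have := IH pw.
case: (lastP w) pw => [|v b]; first by rewrite /cf_denom /cf_prev /=; lia.
rewrite pos_word_rcons cf_prev_rcons => /andP[_ pv].
by have := cf_denom_gt0 pv; nia.
Qed.

(** The fold that computes q is monotone in its starting state, and after one
    digit the state left by v is at most 2 q(v) times the initial one. *)
Lemma cf_denom_cat v w :
  pos_word v -> pos_word w ->
  (cf_denom (v ++ w) <= 2 * (cf_denom v * cf_denom w))%N.
Proof.
move=> pv pw.
rewrite {1}/cf_denom foldl_cat.
have [q0 q1] := cf_denom_prev pv.
pose f := fun (q : nat * nat) d => (q.2, (d * q.2 + q.1)%N).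
have mono u c x y x' y' : (x <= c * x')%N -> (y <= c * y')%N ->
    ((foldl f (x, y) u).2 <= c * (foldl f (x', y') u).2)%N.
  elim: u x y x' y' => [|a u IH] x y x' y' hx hy //=.
  by apply: IH => //; rewrite /=; nia.
case: w pw => [|a w] /=; first by rewrite /cf_denom /=; lia.
move=> /andP[a0 pw]; rewrite mulnA {2}/cf_denom /=.
by apply: mono; rewrite -/(cf_prev v) -/(cf_denom v); nia.
Qed.

Section Branches.
Variable R : realType.
Implicit Types (w : seq nat) (x y : R).
Local Notation cf := (@cf R).

Lemma cf_cat v w y : cf (v ++ w) y = cf v (cf w y).
Proof. by rewrite /cf foldr_cat. Qed.

Lemma cf_rcons w a y : cf (rcons w a) y = cf w ((a%:R + y)^-1).
Proof. by rewrite -cats1 cf_cat. Qed.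

Lemma digit_ge1 (a : nat) : (0 < a)%N -> 1 <= a%:R :> R.
Proof. by rewrite ler1n. Qed.

Lemma branch_itv a y : (0 < a)%N -> 0 <= y <= 1 -> 0 <= (a%:R + y)^-1 <= 1.
Proof.
move=> /digit_ge1 a0 /andP[y0 y1]; rewrite invr_ge0 addr_ge0 //=.
by rewrite invf_le1; lra.
Qed.

Lemma branch_itvo a y : (0 < a)%N -> 0 < y < 1 -> 0 < (a%:R + y)^-1 < 1.
Proof.
move=> /digit_ge1 a0 /andP[y0 y1]; rewrite invr_gt0.
by rewrite invf_lt1; lra.
Qed.

Lemma cf_itv w y : pos_word w -> 0 <= y <= 1 -> 0 <= cf w y <= 1.
Proof.
by move=> + hy; elim: w => //= a w IH /andP[a0 /IH]; exact: branch_itv.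
Qed.

Lemma cf_itvo w y : pos_word w -> 0 < y < 1 -> 0 < cf w y < 1.
Proof.
by move=> + hy; elim: w => //= a w IH /andP[a0 /IH]; exact: branch_itvo.
Qed.

(** The branch is the Moebius map with denominator q_n + y q_(n-1), whose
    determinant is 1 up to sign. *)
Lemma cf_dist w x y : pos_word w -> 0 <= x -> 0 <= y ->
  `|cf w x - cf w y| = `|x - y| /
    (((cf_denom w)%:R + x * (cf_prev w)%:R) *
     ((cf_denom w)%:R + y * (cf_prev w)%:R)).
Proof.
elim/last_ind: w x y => [|w a IH] x y.
  by rewrite /cf_denom /cf_prev /= !mulr0 !addr0 mulr1 divr1.
rewrite pos_word_rcons => /andP[/digit_ge1 a0 pw] x0 y0.
rewrite !cf_rcons IH ?invr_ge0 ?addr_ge0 //.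
rewrite cf_denom_rcons cf_prev_rcons natrD natrM.
have [/digit_ge1 q0 _] := cf_denom_prev pw.
set q := (cf_denom w)%:R in q0 *; set p := (cf_prev w)%:R.
have p0 : 0 <= p by rewrite /p.
have ax : 0 < a%:R + x by lra.
have ay : 0 < a%:R + y by lra.
have -> : (a%:R + x)^-1 - (a%:R + y)^-1 =
          (y - x) / ((a%:R + x) * (a%:R + y)).
  by field; rewrite !gt_eqF.
rewrite normrM normfV distrC [`|(_ + _) * _|]ger0_norm ?mulr_ge0 ?ltW //.
have h1 : 0 < q + (a%:R + x)^-1 * p.
  by rewrite ltr_pwDl ?mulr_ge0 ?invr_ge0 //; lra.
have h2 : 0 < q + (a%:R + y)^-1 * p.
  by rewrite ltr_pwDl ?mulr_ge0 ?invr_ge0 //; lra.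
have e1 : a%:R * q + p + x * q = (a%:R + x) * (q + (a%:R + x)^-1 * p).
  by field; rewrite gt_eqF.
have e2 : a%:R * q + p + y * q = (a%:R + y) * (q + (a%:R + y)^-1 * p).
  by field; rewrite gt_eqF.
rewrite e1 e2 -[LHS]mulrA -invfM; congr (_ / _); exact: mulrACA.
Qed.

Lemma cf_dist_le w x y : pos_word w -> 0 <= x -> 0 <= y ->
  `|cf w x - cf w y| <= `|x - y| / (cf_denom w)%:R ^+ 2.
Proof.
move=> pw x0 y0; rewrite cf_dist //.
have [/digit_ge1 q0 _] := cf_denom_prev pw.
have p0 : 0 <= (cf_prev w)%:R :> R by [].
rewrite ler_wpM2l // lef_pV2 ?posrE; last 2 first.
- by rewrite mulr_gt0 // ltr_pwDl ?mulr_ge0 //; lra.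
- by rewrite exprn_gt0 //; lra.
by rewrite expr2 ler_pM ?lerDl ?mulr_ge0 //; lra.
Qed.

Lemma cf_dist_ge w x y : pos_word w -> 0 <= x <= 1 -> 0 <= y <= 1 ->
  `|x - y| / (4 * (cf_denom w)%:R ^+ 2) <= `|cf w x - cf w y|.
Proof.
move=> pw /andP[x0 x1] /andP[y0 y1]; rewrite cf_dist //.
have [/digit_ge1 q0] := cf_denom_prev pw.
rewrite -(ler_nat R) => pq.
have p0 : 0 <= (cf_prev w)%:R :> R by [].
have h z : 0 <= z -> z <= 1 ->
    (cf_denom w)%:R + z * (cf_prev w)%:R <= 2 * (cf_denom w)%:R :> R.
  by move=> z0 z1; nra.
have h' z : 0 <= z -> 0 < (cf_denom w)%:R + z * (cf_prev w)%:R :> R.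
  by move=> z0; rewrite ltr_pwDl ?mulr_ge0 //; lra.
rewrite ler_wpM2l // lef_pV2 ?posrE; last 2 first.
- by rewrite mulr_gt0 // exprn_gt0 //; lra.
- by rewrite mulr_gt0 // h'.
have -> : 4 * (cf_denom w)%:R ^+ 2 =
          2 * (cf_denom w)%:R * (2 * (cf_denom w)%:R) :> R by ring.
by rewrite ler_pM ?h // ltW // h'.
Qed.

(** Branches may be increasing or decreasing, according to the parity of the
   length, hence betweenness rather than monotony. *)
Definition between x y z := (x <= y <= z) || (z <= y <= x).

Lemma betweenP x y z :
  reflect ((x <= y <= z) \/ (z <= y <= x)) (between x y z).
Proof. exact: orP. Qed.

Lemma branch_between a x y z : (0 < a)%N -> 0 <= x -> 0 <= y -> 0 <= z ->
  between (a%:R + x)^-1 (a%:R + y)^-1 (a%:R + z)^-1 = between x y z.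
Proof.
move=> /digit_ge1 a0 x0 y0 z0; rewrite /between.
rewrite !lef_pV2 ?posrE ?ltr_pwDl ?lerD2l //; try lra.
Qed.

Lemma cf_between w x y z : pos_word w ->
  0 <= x <= 1 -> 0 <= y <= 1 -> 0 <= z <= 1 ->
  between (cf w x) (cf w y) (cf w z) = between x y z.
Proof.
move=> + hx hy hz; elim: w => //= a w IH /andP[a0 pw].
have [/andP[? _] /andP[? _] /andP[? _]] :=
  And3 (cf_itv pw hx) (cf_itv pw hy) (cf_itv pw hz).
by rewrite branch_between // IH.
Qed.

Lemma cf_surj w x : pos_word w -> between (cf w 0) x (cf w 1) ->
  exists2 y : R, 0 <= y <= 1 & x = cf w y.
Proof.
elim: w x => [|a w IH] x /=.
  by move=> _ /betweenP[] hx; exists x => //; lra.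
move=> /andP[a0 pw] hx.
have h0 : 0 <= cf w 0 <= 1 by apply: cf_itv; rewrite ?lexx ?ler01.
have h1 : 0 <= cf w 1 <= 1 by apply: cf_itv; rewrite ?lexx ?ler01.
have a1 := digit_ge1 a0.
have x0 : 0 < x.
  have p0 : 0 < (a%:R + cf w 0)^-1 by rewrite invr_gt0; lra.
  have p1 : 0 < (a%:R + cf w 1)^-1 by rewrite invr_gt0; lra.
  by case/betweenP: hx => /andP[+ _]; exact: lt_le_trans.
have xE : x = (a%:R + (x^-1 - a%:R))^-1 by rewrite addrC subrK invrK.
have : 0 <= x^-1 - a%:R.
  rewrite subr_ge0 -[a%:R]invrK lef_pV2 ?posrE ?invr_gt0 //; last lra.
  have i0 : (a%:R + cf w 0)^-1 <= a%:R^-1 by rewrite lef_pV2 ?posrE; lra.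
  have i1 : (a%:R + cf w 1)^-1 <= a%:R^-1 by rewrite lef_pV2 ?posrE; lra.
  by case/betweenP: hx => /andP[_]; move=> h; apply: (le_trans h).
move=> v0; move: hx; rewrite xE branch_between //; try lra.
by move=> /(IH _ pw)[y hy e]; exists y; rewrite // -e.
Qed.

Lemma gauss_branch (a : nat) y : (0 < a)%N -> 0 < y < 1 ->
  gauss_map (a%:R + y)^-1 = y.
Proof.
move=> /digit_ge1 a0 /andP[y0 y1]; rewrite /gauss_map gt_eqF ?invr_gt0; last lra.
rewrite invrK (@floor_def _ _ a%:Z) -?pmulrn; first by rewrite addrC addKr.
by rewrite natrD; apply/andP; split; lra.
Qed.

(** Only interior points: at y = 0 a last digit 1 would be lost, since then
    1/(1 + y) = 1 is an integer. *)
Lemma iter_gauss_cf w y : pos_word w -> 0 < y < 1 ->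
  iter (size w) (@gauss_map R) (cf w y) = y.
Proof.
move=> + hy; elim: w => //= a w IH /andP[a0 pw].
by rewrite -iterS iterSr gauss_branch ?IH // cf_itvo.
Qed.

Lemma cf_lower w : pos_word w ->
  exists2 d : R, 0 < d & forall y, 1/3 <= y <= 1/2 -> d <= cf w y.
Proof.
case: w => [|a w] /= pw; first by exists (1/3) => [|y /andP[]] //; lra.
case/andP: pw => /digit_ge1 a0 pw.
exists (a%:R + 1)^-1 => [|y hy]; first by rewrite invr_gt0; lra.
have /andP[c0 c1] : 0 <= cf w y <= 1 by apply: cf_itv => //; lra.
by rewrite lef_pV2 ?posrE; lra.
Qed.

Lemma branch_sep (k l : nat) x y d : (0 < k < l)%N -> 0 <= x <= 1 ->
  0 < d <= y -> y <= 1 ->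
  d / ((k%:R + 1) * (l%:R + 1)) <= `|(k%:R + x)^-1 - (l%:R + y)^-1|.
Proof.
move=> /andP[/digit_ge1 k0]; rewrite -(ler_nat R) -addn1 natrD => kl.
move=> /andP[x0 x1] /andP[d0 dy] y1.
have kx : 0 < k%:R + x by lra.
have ly : 0 < l%:R + y by lra.
have -> : (k%:R + x)^-1 - (l%:R + y)^-1 =
          (l%:R + y - k%:R - x) / ((k%:R + x) * (l%:R + y)).
  by field; rewrite !gt_eqF.
rewrite ger0_norm; last by rewrite divr_ge0 ?mulr_ge0 //; lra.
apply: ler_pM; rewrite ?invr_ge0 ?mulr_ge0 //; try lra.
by rewrite lef_pV2 ?posrE ?mulr_gt0 ?ler_pM //; lra.
Qed.

(** Evaluating away from 0 and 1 keeps branches of equal length apart, although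
    adjacent cylinders touch. *)
Lemma cf_sep v w : size v = size w -> pos_word v -> pos_word w -> v != w ->
  exists2 g : R, 0 < g & forall x y, 1/3 <= x <= 1/2 -> 1/3 <= y <= 1/2 ->
    g <= `|cf v x - cf w y|.
Proof.
elim: v w => [|k v IH] [|l w] //= [sz] /andP[k0 pv] /andP[l0 pw] ne.
have k1 := digit_ge1 k0.
have l1 := digit_ge1 l0.
have half u z : pos_word u -> 1/3 <= z <= 1/2 -> 0 <= cf u z <= 1.
  by move=> pu hz; apply: cf_itv => //; lra.
have [d d0 hd] := cf_lower pv; have [e e0 he] := cf_lower pw.
case: (ltngtP k l) => kl.
- exists (e / ((k%:R + 1) * (l%:R + 1))).
    by rewrite divr_gt0 ?mulr_gt0 //; lra.
  move=> x y hx hy; apply: branch_sep; rewrite ?k0 ?half ?e0 ?he //.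
  by case/andP: (half _ _ pw hy).
- exists (d / ((l%:R + 1) * (k%:R + 1))).
    by rewrite divr_gt0 ?mulr_gt0 //; lra.
  move=> x y hx hy; rewrite distrC.
  apply: branch_sep; rewrite ?l0 ?half ?d0 ?hd //.
  by case/andP: (half _ _ pv hx).
subst l; have [|g g0 hg] := IH w sz pv pw.
  by apply: contra_neq ne => ->.
exists (g / ((k%:R + 1) * (k%:R + 1))).
  by rewrite divr_gt0 ?mulr_gt0 //; lra.
move=> x y hx hy; have := hg x y hx hy.
have /andP[a0 a1] := half _ _ pv hx; have /andP[b0 b1] := half _ _ pw hy.
move: (cf v x) (cf w y) a0 a1 b0 b1 => a b a0 a1 b0 b1 gab.
have ka : 0 < k%:R + a by lra.
have kb : 0 < k%:R + b by lra.
have -> : (k%:R + a)^-1 - (k%:R + b)^-1 = (b - a) / ((k%:R + a) * (k%:R + b)).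
  by field; rewrite !gt_eqF.
rewrite normrM normfV distrC [`|(_ + _) * _|]ger0_norm; last first.
  by rewrite mulr_ge0 //; lra.
apply: ler_pM; rewrite ?invr_ge0 ?mulr_ge0 //; try lra.
by rewrite lef_pV2 ?posrE ?mulr_gt0 ?ler_pM //; lra.
Qed.

Lemma finite_common_bound (T : eqType) (s : seq T) (P : T -> R -> Prop) :
  (forall (i : T) g h, h <= g -> P i g -> P i h) ->
  (forall i, i \in s -> exists2 g : R, 0 < g & P i g) ->
  exists2 g : R, 0 < g & forall i, i \in s -> P i g.
Proof.
move=> mono; elim: s => [_|a s IH hs]; first by exists 1.
have [|g g0 hg] := IH; first by move=> i si; apply: hs; rewrite inE si orbT.
have [|h h0 hh] := hs a; first exact: mem_head.
exists (Num.min g h); first by rewrite lt_min g0.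
move=> i; rewrite inE => /orP[/eqP->|si].
  by apply: mono hh; rewrite ge_min lexx orbT.
by apply: mono (hg i si); rewrite ge_min lexx.
Qed.

Lemma cf_sep_family (F : seq (seq nat)) (l : nat) :
  (forall v, v \in F -> size v = l /\ pos_word v) ->
  exists2 g : R, 0 < g & forall v w x y, v \in F -> w \in F -> v != w ->
    1/3 <= x <= 1/2 -> 1/3 <= y <= 1/2 -> g <= `|cf v x - cf w y|.
Proof.
move=> hF.
pose P (v w : seq nat) (g : R) := v != w -> forall x y, 1/3 <= x <= 1/2 ->
  1/3 <= y <= 1/2 -> g <= `|cf v x - cf w y|.
have Pm v w g h : h <= g -> P v w g -> P v w h.
  by move=> hg H ne x y hx hy; apply: (le_trans hg); exact: H.
have [|v vF|g g0 hg] :=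
    @finite_common_bound _ F (fun v g => forall w, w \in F -> P v w g).
- by move=> v g h hg H w wF; exact: Pm hg (H w wF).
- have [|w wF|g g0 hg] := @finite_common_bound _ F (P v); first exact: Pm.
    have [-> | ne] := eqVneq v w; first by exists 1 => // /negP; rewrite eqxx.
    have [[sv pv] [sw pw]] := (hF v vF, hF w wF).
    have [g g0 hg] := cf_sep (etrans sv (esym sw)) pv pw ne.
    by exists g => // _.
  by exists g => // w wF; exact: hg.
exists g => // v w x y vF wF ne; exact: hg.
Qed.
End Branches.

(** * Finite sums and powers *)

Lemma ler_sum_uniq (R : numDomainType) (T : eqType) (s s' : seq T)
    (f : T -> R) :
  uniq s -> uniq s' -> {subset s <= s'} -> (forall i, 0 <= f i) ->
  \sum_(i <- s) f i <= \sum_(i <- s') f i.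
Proof.
move=> us us' sub f0.
rewrite (perm_big [seq i <- s' | i \in s]) /=; last first.
  apply: uniq_perm; rewrite ?filter_uniq // => i.
  by rewrite mem_filter; case: (boolP (i \in s)) => // /sub ->.
rewrite big_filter big_mkcond /=; apply: ler_sum => i _.
by case: ifP.
Qed.

Section Powers.
Variable R : realType.
Implicit Types a b c p r s x : R.

Lemma powR_le_base s a b : 0 <= s -> 0 <= a -> a <= b -> a `^ s <= b `^ s.
Proof.
by move=> s0 a0 ab; apply: ge0_ler_powR; rewrite ?nnegrE // (le_trans a0).
Qed.

Lemma powRN_le_base s a b : 0 <= s -> 0 < a -> a <= b -> b `^ (- s) <= a `^ (- s).
Proof.
move=> s0 a0 ab; rewrite !powRN lef_pV2 ?posrE ?powR_gt0 ?(lt_le_trans a0) //.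
by apply: powR_le_base => //; exact: ltW.
Qed.

Lemma powR_inv a s : 0 <= a -> a^-1 `^ s = a `^ (- s).
Proof. by move=> a0; rewrite -powR_inv1 // -powRrM mulN1r. Qed.

Lemma powRDpos a r s : 0 < a -> a `^ (r + s) = a `^ r * a `^ s.
Proof. by move=> a0; apply: powRD; rewrite (gt_eqF a0) implybT. Qed.

Lemma powR_lt_base s a b : 0 < s -> 0 <= a -> a < b -> a `^ s < b `^ s.
Proof.
by move=> s0 a0 ab; apply: gt0_ltr_powR; rewrite ?nnegrE; lra.
Qed.

Lemma powR_cancel s a b : 0 < s -> 0 <= a -> 0 <= b -> a `^ s <= b `^ s -> a <= b.
Proof.
move=> s0 a0 b0; rewrite leNgt => h; rewrite leNgt; apply: contra h.
exact: powR_lt_base.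
Qed.

Lemma powRN_ge1D r x : 0 <= r -> 0 <= x < 1 -> 1 + r * x <= (1 - x) `^ (- r).
Proof.
move=> r0 /andP[x0 x1]; rewrite /powR gt_eqF; last lra.
apply: le_trans (expR_ge1Dx _); rewrite lerD2l mulNr -mulrN ler_wpM2l //.
by rewrite lerNr; apply: le_ln1Dx; lra.
Qed.

(** A weak form of Bernoulli's inequality for exponents below 1, deduced from the
    easy case of negative exponents. *)
Lemma powR_le1B p x : 0 <= p <= 1 -> 0 <= x < 1 ->
  (1 - x) `^ p <= 1 - p / 2 * x.
Proof.
move=> /andP[p0 p1] x01; have /andP[x0 x1] := x01.
have h := powRN_ge1D p0 x01; rewrite powRN in h.
have y0 : 0 < (1 - x) `^ p by rewrite powR_gt0; lra.
have h1 : (1 - x) `^ p * (1 + p * x) <= 1.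
  by rewrite mulrC -ler_pdivlMr // mul1r.
have px : 0 <= p * x <= 1 by nra.
rewrite -(@ler_pM2r _ (1 + p * x)); last nra.
apply: (le_trans h1).
by nra.
Qed.

(** Each term is at most a constant times k^(1-s) - (k-1)^(1-s), so that the sum
    telescopes; sum_powRN_tail uses the same idea with a negative exponent. *)
Lemma sum_powRN_le s (K : nat) : 0 <= s < 1 ->
  \sum_(k < K) (k.+1%:R : R) `^ (- s) <= 2 / (1 - s) * K%:R `^ (1 - s).
Proof.
move=> /andP[s0 s1]; elim: K => [|K IH].
  by rewrite big_ord0 mulr_ge0 ?powR_ge0 // divr_ge0 //; lra.
rewrite big_ord_recr /=.
have k0 : 0 < K.+1%:R :> R by [].
have [K0|K0] := posnP K.
  subst K; rewrite big_ord0 add0r powR1 mulr1.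
  by rewrite ler_pdivlMr; lra.
have kE : K%:R = (1 - K.+1%:R^-1) * K.+1%:R :> R.
  by rewrite mulrBl mulVf ?gt_eqF // mul1r -natr1; lra.
have x1 : 0 <= (K.+1%:R : R)^-1 < 1.
  by apply/andP; split; rewrite ?invr_ge0 ?invf_lt1 ?ltr1n ?ltnS.
have hp : 0 <= 1 - s <= 1 by lra.
have h := powR_le1B hp x1.
have e : K.+1%:R `^ (- s) = K.+1%:R `^ (1 - s) * K.+1%:R^-1 :> R.
  by rewrite powRDpos // powRr1 // mulrAC mulfV ?gt_eqF ?mul1r.
have P0 : 0 <= K.+1%:R `^ (1 - s) :> R by rewrite powR_ge0.
apply: (le_trans (lerD IH (lexx _))).
have y1 : 0 <= 1 - K.+1%:R^-1 :> R by rewrite subr_ge0 ltW //; case/andP: x1.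
rewrite {1}kE (powRM _ y1 (ltW k0)) e.
set Q := K.+1%:R `^ (1 - s) in P0 *; set y := K.+1%:R^-1 in x1 h *.
set Y := (1 - y) `^ (1 - s) in h *.
have h2 : 2 / (1 - s) * Y <= 2 / (1 - s) - y.
  have -> : 2 / (1 - s) - y = 2 / (1 - s) * (1 - (1 - s) / 2 * y).
    by field; lra.
  by rewrite ler_wpM2l // divr_ge0 //; lra.
rewrite mulrA.
suff : Q * (2 / (1 - s) * Y + y) <= Q * (2 / (1 - s)) by lra.
by rewrite ler_wpM2l //; lra.
Qed.

Lemma sum_powRN_tail r (m M : nat) : 0 < r -> (0 < m)%N ->
  \sum_(k < M) ((m + k).+1%:R : R) `^ (- (1 + r)) <= r^-1 * m%:R `^ (- r).
Proof.
move=> r0 m0.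
suff : \sum_(k < M) ((m + k).+1%:R : R) `^ (- (1 + r)) <=
    r^-1 * (m%:R `^ (- r) - (m + M)%:R `^ (- r)).
  move=> h; apply: (le_trans h); rewrite ler_wpM2l ?invr_ge0 ?(ltW r0) //.
  by rewrite gerBl powR_ge0.
elim: M => [|M IH]; first by rewrite big_ord0 addn0 subrr mulr0.
rewrite big_ord_recr /= addnS; apply: (le_trans (lerD IH (lexx _))).
set n := (m + M)%N; have n0 : (0 < n)%N by rewrite /n ltn_addr.
have k0 : 0 < n.+1%:R :> R by [].
have kE : n%:R = (1 - n.+1%:R^-1) * n.+1%:R :> R.
  by rewrite mulrBl mulVf ?gt_eqF // mul1r -natr1; lra.
have x1 : 0 <= (n.+1%:R : R)^-1 < 1.
  by apply/andP; split; rewrite ?invr_ge0 ?invf_lt1 ?ltr1n ?ltnS.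
have h := powRN_ge1D (ltW r0) x1.
have e : n.+1%:R `^ (- (1 + r)) = n.+1%:R^-1 * n.+1%:R `^ (- r) :> R.
  by rewrite opprD powRDpos // powR_inv1.
rewrite e (_ : n%:R `^ (- r) = (1 - n.+1%:R^-1) `^ (- r) * n.+1%:R `^ (- r)); last first.
  by rewrite {1}kE powRM // subr_ge0 ltW //; case/andP: x1.
have Q0 : 0 <= n.+1%:R `^ (- r) :> R by rewrite powR_ge0.
move: h Q0 x1; set Y := (1 - _) `^ (- r); set Q := n.+1%:R `^ (- r).
set y := n.+1%:R^-1 => h Q0 x1.
have -> : r^-1 * (m%:R `^ (- r) - Y * Q) + y * Q =
   r^-1 * (m%:R `^ (- r) - (Y - r * y) * Q) by field; lra.
rewrite ler_wpM2l ?invr_ge0 ?(ltW r0) // lerD2l lerN2 ler_peMl //; lra.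
Qed.

Lemma powR_subadd s a b : 0 < s <= 1 -> 0 <= a -> 0 <= b ->
  (a + b) `^ s <= a `^ s + b `^ s.
Proof.
move=> /andP[s0 s1] a0 b0.
have [->|a0'] := eqVneq a 0; first by rewrite add0r powR0 ?gt_eqF // add0r.
have [->|b0'] := eqVneq b 0; first by rewrite addr0 powR0 ?gt_eqF // addr0.
have {}a0 : 0 < a by rewrite lt_neqAle eq_sym a0'.
have {}b0 : 0 < b by rewrite lt_neqAle eq_sym b0'.
have ab : 0 < a + b by lra.
have h c : 0 < c -> c <= a + b -> c / (a + b) * (a + b) `^ s <= c `^ s.
  move=> c0 cab; rewrite -ler_pdivlMr ?powR_gt0 // -powRN -powR_inv ?(ltW ab) //.
  rewrite -powRM ?(ltW c0) ?invr_ge0 ?(ltW ab) //.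
  apply: ger1_powR s1; rewrite divr_gt0 //= ler_pdivrMr ?mul1r //.
have := lerD (h a a0 _) (h b b0 _).
rewrite -mulrDl -mulrDl mulfV ?gt_eqF // mul1r; apply; lra.
Qed.
End Powers.

(** * Covers of bounded cost *)

Section Covered.
Variable R : realType.
Implicit Types (s v : R) (A B : set R).

(** Costs are bounded through the finite partial sums, so that every estimate
    on covers is an estimate on finite sums of reals. *)
Definition covered s v A :=
  exists U : nat -> set R, exists r : nat -> R,
  [/\ A `<=` \bigcup_i U i,
      forall i, 0 <= r i,
      forall i x y, U i x -> U i y -> `|x - y| <= r i
    & forall n, \sum_(i < n) r i `^ s <= v].

Lemma covered_ge0 s v A : covered s v A -> 0 <= v.
Proof. by case=> U [r [_ _ _ /(_ 0%N)]]; rewrite big_ord0. Qed.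

Lemma covered_sub s v v' A A' :
  A `<=` A' -> v' <= v -> covered s v' A' -> covered s v A.
Proof.
move=> AA vv [U [r [AU r0 Ur sr]]]; exists U, r; split => //.
- by move=> x /AA /AU.
- by move=> n; exact: le_trans (sr n) vv.
Qed.

Lemma covered_small s rho A : 0 < s -> 0 <= rho ->
  (forall x y, A x -> A y -> `|x - y| <= rho) -> covered s (rho `^ s) A.
Proof.
move=> s0 rho0 hA.
exists (fun i => if i is 0%N then A else set0).
exists (fun i => if i is 0%N then rho else 0); split.
- by move=> x Ax; exists 0%N.
- by case.
- by case.
- case=> [|n]; first by rewrite big_ord0 powR_ge0.
  rewrite big_ord_recl big1 ?addr0 // => i _.
  by rewrite /= powR0 ?gt_eqF.
Qed.

Lemma covered0 s v : 0 < s -> 0 <= v -> covered s v set0.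
Proof.
move=> s0 v0; apply: (@covered_sub _ _ (0 `^ s) _ set0) => //.
  by rewrite powR0 ?gt_eqF.
by apply: covered_small.
Qed.

(** Countable subadditivity: the covers of the pieces are listed through an
    encoding of T * nat, and any finite part of the list lies in a finite box. *)
Lemma covered_bigcup (T : countType) s (v : T -> R) (V : R) (A : T -> set R) :
  0 < s -> (forall i, covered s (v i) (A i)) ->
  (forall F : seq T, uniq F -> \sum_(i <- F) v i <= V) ->
  covered s V (\bigcup_i A i).
Proof.
move=> s0 hA hV.
have [U hU] := choice hA; have {hU}[r hU] := choice hU.
pose d (m : nat) : option (T * nat) := pickle_inv m.
exists (fun m => if d m is Some p then U p.1 p.2 else set0).
exists (fun m => if d m is Some p then r p.1 p.2 else 0).
split.
- move=> x [i _ Ai]; have [AU _ _ _] := hU i; have [k _ Uk] := AU _ Ai.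
  by exists (pickle (i, k)) => //; rewrite /d pickleK_inv.
- by move=> m; case: (d m) => // -[i k]; have [] := hU i.
- by move=> m x y; case: (d m) => // -[i k]; have [_ _ h _] := hU i; exact: h.
move=> n.
pose P := pmap d (iota 0 n).
pose f (p : T * nat) := r p.1 p.2 `^ s.
have f0 p : 0 <= f p by exact: powR_ge0.
have -> : \sum_(m < n) (if d m is Some p then r p.1 p.2 else 0) `^ s =
    \sum_(p <- P) f p.
  rewrite /P -(big_mkord xpredT
    (fun m => (if d m is Some p then r p.1 p.2 else 0) `^ s)) /index_iota subn0.
  elim: (iota 0 n) => [|m t IH]; first by rewrite !big_nil.
  rewrite big_cons IH /=; case: (d m) => [p|] /=; first by rewrite big_cons.
  by rewrite powR0 ?add0r ?gt_eqF.
have uP : uniq P by apply: pmap_uniq (iota_uniq 0 n); exact: pickle_invK.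
pose I := undup [seq p.1 | p <- P].
pose N := \max_(p <- P) p.2.+1.
apply: le_trans (_ : _ <= \sum_(p <- [seq (i, k) | i <- I, k <- iota 0 N]) f p) _.
  apply: ler_sum_uniq => //.
    by apply: allpairs_uniq; rewrite ?undup_uniq ?iota_uniq // => -[? ?] [? ?].
  move=> -[i k] Pik; apply/allpairsP; exists (i, k); split => //=.
    by rewrite mem_undup; apply/mapP; exists (i, k).
  by rewrite mem_iota add0n /= (@leq_bigmax_seq _ P xpredT (fun p => p.2.+1) _ Pik).
rewrite big_allpairs_dep; apply: le_trans (hV I (undup_uniq _)).
apply: ler_sum => i _; have [_ _ _ h] := hU i.
by rewrite -{1}[N]subn0 -/(index_iota 0 N) big_mkord; exact: h.
Qed.

Lemma sum_nat_uniq (v : nat -> R) (V : R) (F : seq nat) : (forall i, 0 <= v i) ->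
  (forall n, \sum_(i < n) v i <= V) -> uniq F -> \sum_(i <- F) v i <= V.
Proof.
move=> v0 hV uF; apply: le_trans (hV (\max_(i <- F) i.+1)).
rewrite -(big_mkord xpredT v); apply: ler_sum_uniq => //.
  by rewrite iota_uniq.
by move=> i Fi; rewrite mem_index_iota (@leq_bigmax_seq _ F xpredT (fun i => i.+1) _ Fi).
Qed.

Lemma covered_bigcup_nat s (v : nat -> R) (V : R) (A : nat -> set R) :
  0 < s -> (forall i, covered s (v i) (A i)) ->
  (forall n, \sum_(i < n) v i <= V) -> covered s V (\bigcup_i A i).
Proof.
move=> s0 hA hV; apply: (covered_bigcup s0 hA) => F.
by apply: sum_nat_uniq => // i; exact: covered_ge0 (hA i).
Qed.

Lemma covered_bigcup_lt s (v : nat -> R) (A : nat -> set R) K :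
  0 < s -> (forall i, (i < K)%N -> covered s (v i) (A i)) ->
  covered s (\sum_(i < K) v i) [set x | exists2 i, (i < K)%N & A i x].
Proof.
move=> s0 hA.
pose v' i := if (i < K)%N then v i else 0.
have v0 i : 0 <= v' i.
  by rewrite /v'; case: ifP => // /hA; exact: covered_ge0.
apply: (@covered_sub _ _ (\sum_(i < K) v i) _
  (\bigcup_i (if (i < K)%N then A i else set0))) => //.
  by move=> x [i iK Aix]; exists i => //; rewrite iK.
apply: (@covered_bigcup_nat _ v') => // [i|n].
  by rewrite /v'; case: ifP => [/hA //|_]; exact: covered0.
rewrite -(big_mkord xpredT v') -(big_mkord xpredT v).
rewrite [leRHS](eq_big_nat _ _ (F2 := v')) => [|i /andP[_ iK]]; last first.
  by rewrite /v' iK.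
have [nK|/ltnW Kn] := leqP n K.
  by rewrite [leRHS](@big_cat_nat _ _ _ n) //= lerDl sumr_ge0.
rewrite (@big_cat_nat _ _ _ K) //= [X in _ + X]big_nat_cond [X in _ + X]big1 ?addr0 // => i.
by rewrite andbT /v' => /andP[+ _]; case: ltnP.
Qed.

Lemma covered_setU s v w A B : 0 < s ->
  covered s v A -> covered s w B -> covered s (v + w) (A `|` B).
Proof.
move=> s0 hA hB.
apply: (@covered_sub _ _ (\sum_(i < 2) (if i == 0%N :> nat then v else w)) _
  [set x | exists2 i, (i < 2)%N & (if i == 0%N then A else B) x]).
- by move=> x [Ax|Bx]; [exists 0%N|exists 1%N].
- by rewrite !big_ord_recl big_ord0 /= addr0.
- by apply: (@covered_bigcup_lt _ (fun i => if i == 0%N then v else w)) => // -[].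
Qed.

Lemma covered_image s c v A (f : R -> R) : 0 < s -> 0 <= c ->
  (forall x y, A x -> A y -> `|f x - f y| <= c * `|x - y|) ->
  covered s v A -> covered s (c `^ s * v) (f @` A).
Proof.
move=> s0 c0 hf [U [r [AU r0 Ur sr]]].
exists (fun i => f @` (U i `&` A)), (fun i => c * r i); split.
- by move=> _ [x Ax <-]; have [i _ Ui] := AU x Ax; exists i => //; exists x.
- by move=> i; rewrite mulr_ge0.
- move=> i _ _ [x [Ux Ax] <-] [y [Uy Ay] <-]; apply: le_trans (hf x y Ax Ay) _.
  by rewrite ler_wpM2l // Ur.
- move=> n; under eq_bigr do rewrite powRM //.
  by rewrite -mulr_sumr ler_wpM2l // powR_ge0.
Qed.
End Covered.

(** * Hausdorff measure and dimension through covers *)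

Section Hausdorff.
Variable R : realType.
Implicit Types (s t eta delta rho : R) (A U : set R).

Lemma diam_le U rho : 0 <= rho ->
  (forall x y, U x -> U y -> `|x - y| <= rho) -> (diam U <= rho%:E)%E.
Proof.
move=> rho0 hU; apply: ge_ereal_sup => _ [[x y] [/= Ux Uy] <-].
by rewrite lee_fin hU.
Qed.

Lemma le_diam U x y : U x -> U y -> (`|x - y|%:E <= diam U)%E.
Proof. by move=> Ux Uy; apply: ereal_sup_ubound; exists (x, y). Qed.

Lemma diam_fin U delta : U !=set0 -> (diam U <= delta%:E)%E ->
  exists2 d, diam U = d%:E & 0 <= d <= delta.
Proof.
move=> [x Ux] Ud; have := le_diam Ux Ux; rewrite subrr normr0.
case: (diam U) Ud => [d| |] //; rewrite !lee_fin => h1 h2.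
by exists d; rewrite // h1 h2.
Qed.

(** Bounds on the diameters come for free: a cover of cost at most delta^s has no
    set of size above delta. *)
Lemma covered_null s A : 0 < s ->
  (forall eta, 0 < eta -> covered s eta A) -> hausdorff_measure s A = 0%E.
Proof.
move=> s0 hA; apply/eqP; rewrite eq_le; apply/andP; split; last first.
  apply: (@le_trans _ _ (hausdorff_content s 1 A)).
    apply: le_ereal_inf_tmp => _ [U _ <-]; apply: nneseries_ge0 => n _ _.
    by rewrite /hausdorff_cost; case: ifP => // _; exact: poweR_ge0.
  by apply: ereal_sup_ubound; exists 1 => //=.
apply: ge_ereal_sup => _ [delta /= d0 <-].
apply/lee_addgt0Pr => eta eta0; rewrite add0e.
have e0 : 0 < Num.min eta (delta `^ s) by rewrite lt_min eta0 powR_gt0.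
have [U [r [AU r0 Ur sr]]] := hA _ e0.
have rd i : r i <= delta.
  apply: (@powR_cancel _ s); rewrite ?(ltW d0) //.
  have := sr i.+1; rewrite big_ord_recr /= le_min => /andP[_].
  by apply: le_trans; rewrite lerDr sumr_ge0 // => j _; exact: powR_ge0.
apply: (@le_trans _ _ (\sum_(0 <= i <oo) hausdorff_cost s (U i))%E).
  apply: ereal_inf_lbound; exists U => //; split => // i.
  by apply: (@le_trans _ _ (r i)%:E); [apply: diam_le => //; exact: Ur|rewrite lee_fin].
have c0 i : (0 <= hausdorff_cost s (U i))%E.
  by rewrite /hausdorff_cost; case: ifP => // _; exact: poweR_ge0.
apply: lime_le; first by apply: is_cvg_nneseries => n _ _.
apply: nearW => n; apply: (@le_trans _ _ (\sum_(0 <= i < n) (r i `^ s)%:E)%E).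
  apply: lee_sum => i _; rewrite /hausdorff_cost.
  case: ifPn => [_|/set0P Ui]; first by rewrite lee_fin powR_ge0.
  have [|d -> /andP[d0' dr]] := @diam_fin (U i) (r i) Ui.
    by apply: diam_le => //; exact: Ur.
  by rewrite poweR_EFin lee_fin; apply: powR_le_base; rewrite ?(ltW s0).
rewrite sumEFin lee_fin big_mkord; apply: le_trans (sr n) _.
by rewrite ge_min lexx.
Qed.

Lemma sum_geo_half (e : R) n : 0 <= e -> \sum_(i < n) e / 2 ^+ i.+1 <= e.
Proof.
move=> e0; suff -> : \sum_(i < n) e / 2 ^+ i.+1 = e - e / 2 ^+ n.
  by rewrite gerBl divr_ge0 // exprn_ge0.
elim: n => [|n IH]; first by rewrite big_ord0 expr0 divr1 subrr.
rewrite big_ord_recr /= IH exprS; field.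
by rewrite expf_neq0.
Qed.

(** The covering sets are given strictly positive sizes, so that a set which
    meets small enough intervals is detected by its cost. *)
Lemma null_cover s t A eta : 0 <= s -> s <= t -> 0 < t -> 0 < eta ->
  hausdorff_measure s A = 0%E ->
  exists U : nat -> set R, exists r : nat -> R,
  [/\ A `<=` \bigcup_i U i, forall i, 0 < r i,
      forall i x y, U i x -> U i y -> `|x - y| <= r i
    & forall n, \sum_(i < n) r i `^ t <= eta].
Proof.
move=> s0 st t0 eta0 mA.
have : (hausdorff_content s 1 A < (eta / 2)%:E)%E.
  apply: (@le_lt_trans _ _ 0%E); last by rewrite lte_fin divr_gt0.
  by rewrite -mA; apply: ereal_sup_ubound; exists 1 => //=.
move=> /ereal_inf_lt[_ [U [AU Ud] <-] hU].
pose d i := if U i == set0 then 0 else fine (diam (U i)).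
have dP i : [/\ 0 <= d i <= 1, (forall x y, U i x -> U i y -> `|x - y| <= d i) &
    ((d i `^ t)%:E <= hausdorff_cost s (U i))%E].
  rewrite /d /hausdorff_cost; case: ifPn => [/eqP->|/set0P Ui].
    by rewrite lexx ler01 powR0 ?gt_eqF.
  have [e De /andP[e0 e1]] := diam_fin Ui (Ud i); rewrite De /=.
  split; first by rewrite e0.
  - by move=> x y Ux Uy; have := le_diam Ux Uy; rewrite De lee_fin.
  - rewrite lee_fin; have [->|en] := eqVneq e 0.
      by rewrite powR0 ?gt_eqF // powR_ge0.
    by apply: ger_powR st; rewrite lt_neqAle eq_sym en e0.
pose e i : R := eta / 2 / 2 ^+ i.+1.
have e0 i : 0 < e i by rewrite !divr_gt0 // exprn_gt0.
have de0 i : 0 < d i `^ t + e i by rewrite ltr_wpDl ?powR_ge0.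
exists U, (fun i => (d i `^ t + e i) `^ t^-1); split => //.
- by move=> i; rewrite powR_gt0.
- move=> i x y Ux Uy; have [/andP[d0 _] h _] := dP i.
  apply: le_trans (h x y Ux Uy) _.
  apply: (powR_cancel t0) => //; first exact: powR_ge0.
  by rewrite -powRrM mulVf ?gt_eqF // powRr1 ?(ltW (de0 _)) // lerDl ltW.
- move=> n; under eq_bigr do rewrite -powRrM mulVf ?gt_eqF // powRr1 ?(ltW (de0 _)) //.
  rewrite big_split /= [leRHS](splitr eta); apply: lerD; last first.
    by apply: sum_geo_half; rewrite divr_ge0 // ltW.
  rewrite -lee_fin -sumEFin; apply: le_trans (ltW hU).
  rewrite -(big_mkord xpredT (fun i => (d i `^ t)%:E)).
  apply: le_trans (nneseries_lim_ge n _); last first.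
    move=> i _ _; have [_ _ +] := dP i.
    by apply: le_trans; rewrite lee_fin powR_ge0.
  by apply: lee_sum => i _; have [] := dP i.
Qed.
End Hausdorff.

(** * The pre-dimensional numbers through finite sums *)

Definition word (n : nat) : pred (seq nat) :=
  fun w => (size w == n) && pos_word w.

Section Predim.
Variable R : realType.
Implicit Types (s x M : R).
Local Notation q w := ((cf_denom w)%:R : R).

(** The partition function of order n at s, that is the sum of q^(-2s) over the
    words of length n, is bounded through finite families because it is infinite
    for s <= 1/2. *)
Definition psum_le n s M : Prop := forall F : seq (seq nat), uniq F ->
  all (word n) F -> \sum_(w <- F) q w `^ (- (2 * s)) <= M.

Definition crit n (M : R -> R) : \bar R :=
  ereal_inf [set s%:E | s in [set s : R | 0 <= s <= 1 /\ psum_le n s (M s)]].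

Lemma q_ge1 w : pos_word w -> 1 <= q w.
Proof. by move=> pw; rewrite ler1n cf_denom_gt0. Qed.

Lemma word_pos n w : word n w -> pos_word w.
Proof. by case/andP. Qed.

Lemma esum_pos_tuples n (f : seq nat -> R) : (forall w, 0 <= f w) ->
  (\esum_(a in pos_tuples n) (f a)%:E <= 1)%E <->
  (forall F : seq (seq nat), uniq F -> all (word n) F -> \sum_(w <- F) f w <= 1).
Proof.
move=> f0; split.
- move=> h F uF wF; rewrite -lee_fin; apply: le_trans h.
  pose G : seq (n.-tuple nat) := pmap insub F.
  have GF : map val G = F.
    rewrite /G pmap_filter; last exact: insubK.
    by apply/all_filterP; apply: sub_all wF => w /andP[sw _]; rewrite isSome_insub.
  apply: esum_ge; exists [set` G].
    split; first exact: finite_seq.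
    move=> a /= aG i.
    have : val a \in F by rewrite -GF map_f.
    move=> /(allP wF)/andP[_ /all_nthP h].
    rewrite (tnth_nth 0%N); apply: h; by rewrite size_tuple.
  rewrite -fsbig_seq; last by apply: (@map_uniq _ _ val); rewrite GF.
  by rewrite sumEFin lee_fin -GF big_map.
- move=> h; apply: ge_ereal_sup => _ [X [finX XS] <-].
  rewrite fsbig_finite // sumEFin lee_fin.
  have := h (map val (finmap.enum_fset (fset_set X))); rewrite big_map; apply.
    by rewrite map_inj_uniq ?fset_uniq //; exact: val_inj.
  apply/allP => w /mapP[a]; rewrite in_fset_set // inE => /XS aS ->.
  apply/andP; split; first by rewrite size_tuple.
  apply/(all_nthP 0%N) => i; rewrite size_tuple => i_n.
  by have := aS (Ordinal i_n); rewrite (tnth_nth 0%N).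
Qed.

Lemma critical_exponentE n (w : R -> n.-tuple nat -> R) (M : R -> R) :
  (forall s, 0 < M s) ->
  (forall s (a : n.-tuple nat), w s a = q a `^ (- (2 * s)) / M s) ->
  critical_exponent w = crit n M.
Proof.
move=> M0 wE; rewrite /critical_exponent /crit; congr ereal_inf.
suff -> : [set s : R | 0 <= s <= 1 /\
    (\esum_(a in pos_tuples n) (w s a)%:E <= 1)%E] =
  [set s : R | 0 <= s <= 1 /\ psum_le n s (M s)] by [].
apply/funext => s /=; apply/propext.
have -> : (\esum_(a in pos_tuples n) (w s a)%:E)%E =
    (\esum_(a in pos_tuples n) (q (val a) `^ (- (2 * s)) / M s)%:E)%E.
  by apply: eq_esum => a _; rewrite wE.
have f0 (v : seq nat) : 0 <= q v `^ (- (2 * s)) / M s.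
  by rewrite divr_ge0 ?powR_ge0 // ltW.
have := esum_pos_tuples n f0; cbv beta => e.
split=> -[s01 h]; split => //.
- by move=> F uF wF; have := e.1 h F uF wF; rewrite -mulr_suml ler_pdivrMr // mul1r.
- apply: e.2 => F uF wF; rewrite -mulr_suml ler_pdivrMr // mul1r; exact: h.
Qed.

Lemma predim1E (B : R) n : 0 < B ->
  predim1 B n = crit n (fun s => B `^ (n%:R * s ^+ 2)).
Proof.
move=> B0; apply: critical_exponentE => s; first exact: powR_gt0.
by move=> a; rewrite mul1r invfM powRN.
Qed.

Lemma predim2E (B d z : R) n : 0 < B -> 0 < d -> first_digit z = d%:E ->
  predim2 B n z = crit n (fun s => B `^ (n%:R * s) * d `^ (s - 1)).
Proof.
move=> B0 d0 zd; rewrite /predim2 zd; apply: critical_exponentE => s.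
  by rewrite mulr_gt0 // powR_gt0.
move=> a; rewrite -(opprB s 1) !powRN !invfM.
by rewrite mulrCA mulrA mulrAC -mulrA [_^-1 * (d `^ _)^-1]mulrC.
Qed.

Lemma predim3E (B d z : R) n : 0 < B -> 0 < d -> first_digit z = d%:E ->
  predim3 B n z = crit n (fun s => d `^ s * B `^ (n%:R * s / 2)).
Proof.
move=> B0 d0 zd; rewrite /predim3 zd; apply: critical_exponentE => s.
  by rewrite mulr_gt0 // powR_gt0.
by move=> a; rewrite mul1r !invfM powRN mulrA.
Qed.

Lemma crit_lt n (M : R -> R) x : (crit n M < x%:E)%E ->
  exists s, [/\ 0 <= s <= 1, s < x & psum_le n s (M s)].
Proof. by move=> /ereal_inf_lt[_ [s [s01 h] <-]]; rewrite lte_fin; exists s. Qed.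

Lemma crit_le n (M : R -> R) s : 0 <= s <= 1 -> psum_le n s (M s) -> (crit n M <= s%:E)%E.
Proof. by move=> s01 h; apply: ereal_inf_lbound; exists s. Qed.

Lemma crit_gt n (M : R -> R) s : 0 <= s <= 1 -> (s%:E < crit n M)%E -> ~ psum_le n s (M s).
Proof. by move=> s01 + /(crit_le s01); rewrite ltNge => /negP. Qed.

Lemma crit_ge n (M : R -> R) x : (forall s, 0 <= s <= 1 -> psum_le n s (M s) -> x <= s) ->
  (x%:E <= crit n M)%E.
Proof.
by move=> h; apply: le_ereal_inf_tmp => _ [s [s01 zs] <-]; rewrite lee_fin h.
Qed.

Lemma psum_leN n s M : ~ psum_le n s M -> exists F : seq (seq nat),
  [/\ uniq F, all (word n) F & M < \sum_(w <- F) q w `^ (- (2 * s))].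
Proof.
move=> h; apply: contrapT => h'; apply: h => F uF wF.
by rewrite leNgt; apply/negP => h; apply: h'; exists F.
Qed.

Lemma psum_le_leM n s M M' : M <= M' -> psum_le n s M -> psum_le n s M'.
Proof. by move=> MM h F uF wF; apply: le_trans (h F uF wF) MM. Qed.

Lemma psum_le_anti n s s' M : s <= s' -> psum_le n s M -> psum_le n s' M.
Proof.
move=> ss h F uF wF; apply: le_trans (h F uF wF).
rewrite big_seq [leRHS]big_seq; apply: ler_sum => w /(allP wF)/word_pos/q_ge1 w1.
by apply: ler_powR => //; lra.
Qed.
End Predim.

(** * The partition function near 1/2 and at 1 *)

Fixpoint words (M n : nat) : seq (seq nat) :=
  if n is n'.+1 then [seq rcons w a | w <- words M n', a <- iota 1 M]
  else [:: [::]].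

Lemma words_uniq M n : uniq (words M n).
Proof.
elim: n => //= n IH; apply: allpairs_uniq => //; first exact: iota_uniq.
by move=> [v a] [w b] _ _ /= /rcons_inj.
Qed.

Lemma mem_words M n w :
  (w \in words M n) = word n w && all (fun a => a <= M)%N w.
Proof.
elim: n w => [|n IH] w.
  by rewrite inE /word size_eq0; case: eqP => // ->.
case/lastP: w => [|w a].
  by apply/negbTE/negP => /allpairsP[[v b] /= [_ _]]; case: v.
rewrite /word size_rcons eqSS pos_word_rcons all_rcons.
apply/allpairsP/idP => [[[v b] /= [vn]]|].
  rewrite mem_iota add1n ltnS => /andP[b0 bM] /rcons_inj[-> ->].
  by move: vn; rewrite IH => /andP[/andP[-> ->] ->]; rewrite b0 bM.
move=> /and3P[/andP[sw /andP[a0 pw]] aM wM].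
by exists (w, a); rewrite /= IH /word sw pw wM mem_iota a0 add1n ltnS aM.
Qed.

Lemma sub_words n (F : seq (seq nat)) : all (word n) F ->
  exists M, {subset F <= words M n}.
Proof.
move=> wF; exists (\max_(w <- F) \max_(a <- w) a) => w Fw.
rewrite mem_words (allP wF _ Fw) /=; apply/allP => a aw.
apply: leq_trans (@leq_bigmax_seq _ F xpredT (fun w => \max_(a <- w) a) _ Fw _) => //.
exact: (@leq_bigmax_seq _ w xpredT id).
Qed.

Section Partition.
Variable R : realType.
Implicit Types (s x M : R).
Local Notation q w := ((cf_denom w)%:R : R).
Local Notation psum_le := (@psum_le R).

Lemma psum_le_words n s M :
  (forall K, \sum_(w <- words K n) q w `^ (- (2 * s)) <= M) -> psum_le n s M.
Proof.
move=> h F uF wF; have [K FK] := sub_words wF; apply: le_trans (h K).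
by apply: ler_sum_uniq => //; exact: words_uniq.
Qed.

Lemma words_pos K n w : w \in words K n -> pos_word w.
Proof. by rewrite mem_words => /andP[/word_pos]. Qed.

(** The denominator is at least the product of the digits. *)
Lemma psum_le_finite n s : 1 / 2 < s -> exists M, psum_le n s M.
Proof.
move=> s2; pose r := 2 * s - 1; have r0 : 0 < r by rewrite /r; lra.
pose A := 1 + r^-1.
have hA K : \sum_(a <- iota 1 K) (a%:R : R) `^ (- (2 * s)) <= A.
  have -> : \sum_(a <- iota 1 K) (a%:R : R) `^ (- (2 * s)) =
      \sum_(k < K) (k.+1%:R : R) `^ (- (1 + r)).
    have -> : 2 * s = 1 + r by rewrite /r; ring.
    rewrite -(big_mkord xpredT (fun k => (k.+1%:R : R) `^ (- (1 + r)))).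
    by rewrite (iotaDl 1 0) big_map /index_iota subn0.
  have := sum_powRN_tail K r0 (leqnn 1); rewrite powR1 mulr1 => h.
  apply: le_trans (lerD (lexx 1) h).
  apply: (@le_trans _ _ (\sum_(k < K.+1) (k.+1%:R : R) `^ (- (1 + r)))).
    by rewrite big_ord_recr /= lerDl powR_ge0.
  by rewrite big_ord_recl /= powR1.
exists (A ^+ n); apply: psum_le_words => K.
elim: n => [|n IH]; first by rewrite big_seq1 /cf_denom /= powR1 expr0.
rewrite [words _ _]/= big_allpairs_dep exprSr.
apply: (@le_trans _ _ (\sum_(w <- words K n) q w `^ (- (2 * s)) * A)); last first.
  by rewrite -mulr_suml ler_wpM2r // addr_ge0 // invr_ge0 ltW.
rewrite big_seq [leRHS]big_seq; apply: ler_sum => w /words_pos pw.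
apply: le_trans (ler_wpM2l (powR_ge0 _ _) (hA K)).
rewrite mulr_sumr big_seq [leRHS]big_seq; apply: ler_sum => a.
rewrite mem_iota => /andP[a0 _]; rewrite -powRM //.
have w1 := q_ge1 R pw; have a1 : 1 <= a%:R :> R by rewrite ler1n.
apply: powRN_le_base; [lra|by rewrite mulr_gt0 //; lra|].
by rewrite -natrM ler_nat mulnC cf_denom_ge_mul.
Qed.

(** The lengths 1/(q_n (q_n + q_(n-1))) of the cylinders of order n add up to at
    most 1, because those of the children telescope to that of the parent. *)
Lemma psum_le_one n : psum_le n 1 2.
Proof.
apply: psum_le_words => K.
have h : \sum_(w <- words K n) (q w * (q w + (cf_prev w)%:R))^-1 <= 1.
  elim: n => [|n IH].
    by rewrite big_seq1 /cf_denom /cf_prev /= addr0 mulr1 invr1.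
  rewrite [words _ _]/= big_allpairs_dep; apply: le_trans IH.
  rewrite big_seq [leRHS]big_seq; apply: ler_sum => w /words_pos pw.
  have w1 := q_ge1 R pw; set Q := q w in w1 *.
  set P := (cf_prev w)%:R : R; have P0 : 0 <= P by rewrite /P.
  have e : forall k, \sum_(a <- iota 1 k)
     (q (rcons w a) * (q (rcons w a) + (cf_prev (rcons w a))%:R))^-1 =
     Q^-1 * ((Q + P)^-1 - (k.+1%:R * Q + P)^-1).
    elim=> [|k IHk]; first by rewrite big_nil mul1r subrr mulr0.
    rewrite -(addn1 k) iotaD big_cat big_seq1 IHk /= add1n.
    rewrite cf_denom_rcons cf_prev_rcons natrD natrM -/Q -/P addn1.
    have k0 : 0 <= k%:R * Q by rewrite mulr_ge0 //; lra.
    rewrite -[k.+2%:R]natr1 -[k.+1%:R]natr1.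
    clear IHk; clearbody Q P; field.
    by rewrite !gt_eqF // ?mulrDl ?mul1r; lra.
  have Q0 : 0 <= Q by lra.
  by rewrite e invfM ler_wpM2l ?invr_ge0 // gerBl invr_ge0 addr_ge0 ?mulr_ge0.
apply: le_trans (_ : 2 * 1 <= 2); last lra.
apply: le_trans (ler_wpM2l _ h) => //; rewrite mulr_sumr.
rewrite big_seq [leRHS]big_seq; apply: ler_sum => w /words_pos pw.
have w1 := q_ge1 R pw; have [_] := cf_denom_prev pw; rewrite -(ler_nat R) => pq.
rewrite mulr1 powRN powR_mulrn // -[leLHS]mul1r ler_pdivrMr; last first.
  by rewrite exprn_gt0 //; lra.
rewrite mulrAC ler_pdivlMr ?mul1r; last first.
  by rewrite mulr_gt0 //; [lra|rewrite ltr_pwDl //; lra].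
by rewrite expr2; nra.
Qed.

Lemma harmonic_unbounded x : exists K, x < \sum_(k < K) (k.+2%:R : R)^-1.
Proof.
apply: contrapT => h; apply: (@dvg_harmonic R).
apply: nondecreasing_is_cvgn.
  by apply: nondecreasing_series => n _ _; rewrite /harmonic /= invr_ge0.
exists (1 + x) => _ [n _ <-]; rewrite /series /=.
rewrite big_mkord; case: n => [|n].
  rewrite big_ord0; have := h; rewrite leNgt => {}h; apply/negP => x1.
  by apply: h; exists 0%N; rewrite big_ord0; lra.
rewrite big_ord_recl /harmonic /= invr1 lerD2l leNgt; apply/negP => hx.
by apply: h; exists n.
Qed.

(** Varying the last digit alone already makes the sum diverge at s = 1/2. *)
Lemma psum_le_half n M : (0 < n)%N ->
  exists2 s0, 1 / 2 < s0 & forall s, s <= s0 -> ~ psum_le n s M.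
Proof.
case: n => // n _; pose w := nseq n 1%N.
have pw : pos_word w by rewrite /pos_word all_nseq orbT.
have w1 := q_ge1 R pw; have w0 : 0 < q w by lra.
have [K hK] := harmonic_unbounded (2 * M * q w).
pose F := [seq rcons w k.+1 | k <- iota 0 K].
pose X := (K.+1 * cf_denom w)%N.
have X0 : 0 < X%:R :> R by rewrite ltr0n muln_gt0 /= cf_denom_gt0.
have uF : uniq F.
  rewrite map_inj_uniq ?iota_uniq // => a b /rcons_inj[].
  by [].
have wF : all (word n.+1) F.
  apply/allP => _ /mapP[k _ ->]; rewrite /word size_rcons size_nseq eqxx.
  by rewrite pos_word_rcons.
exists (1 / 2 + (2 * X%:R)^-1) => [|s hs].
  by rewrite ltrDl invr_gt0 mulr_gt0.
move=> /psum_le_anti-/(_ _ hs) /(_ F uF wF); apply/negP; rewrite -ltNge.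
have hX : (X%:R : R) `^ (X%:R^-1) <= 2.
  apply: (@powR_cancel _ X%:R) => //.
  rewrite -powRrM mulVf ?gt_eqF // powRr1 ?(ltW X0) // powR_mulrn //.
  by rewrite -natrX ler_nat ltnW // ltn_expl.
have t k : (k < K)%N -> (2 * q w)^-1 * k.+2%:R^-1 <=
    q (rcons w k.+1) `^ (- (2 * (1 / 2 + (2 * X%:R)^-1))).
  move=> kK; set Y := q (rcons w k.+1).
  have Y1 : 1 <= Y by apply: q_ge1; rewrite pos_word_rcons.
  have Y0 : 0 < Y by lra.
  have -> : - (2 * (1 / 2 + (2 * X%:R)^-1)) = - 1 + - X%:R^-1 :> R.
    by field; rewrite gt_eqF.
  rewrite powRDpos // powR_inv1 ?(ltW Y0) // powRN -invfM -invfM.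
  rewrite lef_pV2 ?posrE ?mulr_gt0 ?powR_gt0 //.
  have YX : Y <= k.+2%:R * q w.
    by rewrite -natrM ler_nat; exact: cf_denom_rcons_le.
  have YX' : Y `^ X%:R^-1 <= 2.
    apply: le_trans hX; apply: powR_le_base; rewrite ?invr_ge0 ?(ltW Y0) //.
    apply: (le_trans YX); rewrite -natrM ler_nat leq_mul2r; apply/orP; right.
    by rewrite ltnS.
  have -> : 2 * q w * k.+2%:R = k.+2%:R * q w * 2 by ring.
  by apply: ler_pM => //; rewrite ?powR_ge0 ?(ltW Y0).
apply: (@lt_le_trans _ _ (\sum_(k <- iota 0 K) (2 * q w)^-1 * k.+2%:R^-1)).
  rewrite -mulr_sumr mulrC ltr_pdivlMr ?mulr_gt0 //.
  by rewrite -{1}[K]subn0 -/(index_iota 0 K) big_mkord mulrA [M * 2]mulrC.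
rewrite /F big_map big_seq [leRHS]big_seq; apply: ler_sum => k.
by rewrite mem_iota add0n => /andP[_ kK]; exact: t.
Qed.

(** For fixed q the weight q^(-2s) is convex in s. This gives continuity of the
    partition function where it is finite. *)
Lemma psum_le_convex n (s s' M M' l : R) : 0 <= l <= 1 ->
  psum_le n s M -> psum_le n s' M' ->
  psum_le n ((1 - l) * s + l * s') ((1 - l) * M + l * M').
Proof.
move=> /andP[l0 l1] h h' F uF wF.
have l1' : 0 <= 1 - l by lra.
apply: le_trans (lerD (ler_wpM2l l1' (h F uF wF)) (ler_wpM2l l0 (h' F uF wF))).
rewrite !mulr_sumr -big_split /= big_seq [leRHS]big_seq.
apply: ler_sum => w /(allP wF)/word_pos/(q_ge1 R) w1.
have w0 : 0 < q w by lra.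
have e a : q w `^ a = expR (a * ln (q w)) by rewrite /powR gt_eqF.
rewrite !e.
set b := ln (q w).
have -> : - (2 * ((1 - l) * s + l * s')) * b =
  (1 - l) * (- (2 * s) * b) + l * (- (2 * s') * b) by ring.
move: (- (2 * s) * b) (- (2 * s') * b) => u v.
have [t0 t1] : expR u >= expR ((1 - l) * u + l * v) * (1 + (u - ((1 - l) * u + l * v))) /\
   expR v >= expR ((1 - l) * u + l * v) * (1 + (v - ((1 - l) * u + l * v))).
  have H a c : expR c * (1 + (a - c)) <= expR a.
    rewrite -{2}(subrK c a) expRD mulrC ler_wpM2r ?expR_ge0 //.
    exact: expR_ge1Dx.
  by split; exact: H.
have := lerD (ler_wpM2l l1' t0) (ler_wpM2l l0 t1).
apply: le_trans; set E := expR _; rewrite le_eqVlt; apply/orP; left.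
by apply/eqP; ring.
Qed.
End Partition.

(** * Bounds on the pre-dimensional numbers *)

Section PredimBounds.
Variable R : realType.
Implicit Types (s x M B z d : R) (n : nat).
Local Notation psum_le := (@psum_le R).

(** The reciprocals of the factors which multiply q^(-2s) in the definitions of
    the three critical exponents. *)
Definition M1 B n : R -> R := fun s => B `^ (n%:R * s ^+ 2).
Definition M2 B d n : R -> R := fun s => B `^ (n%:R * s) * d `^ (s - 1).
Definition M3 B d n : R -> R := fun s => d `^ s * B `^ (n%:R * s / 2).

Lemma first_digitP z : 0 <= z <= 1 ->
  (z = 0 /\ first_digit z = +oo%E) \/
  exists k : nat, [/\ (0 < k)%N, first_digit z = k%:R%:E,
    z = (k%:R + gauss_map z)^-1 & 0 <= gauss_map z < 1].
Proof.
move=> /andP[z0 z1]; rewrite /first_digit /gauss_map.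
have [->|zn] := eqVneq z 0; [by left|right].
have {}z0 : 0 < z by rewrite lt_neqAle eq_sym zn.
have zi : 1 <= z^-1 by rewrite invf_ge1.
have f1 : (1 <= Num.floor z^-1)%R by rewrite floor_ge_int.
exists `|Num.floor z^-1|%N.
have -> : (`|Num.floor z^-1|%N%:R : R) = (Num.floor z^-1)%:~R.
  by rewrite natr_absz ger0_norm // (le_trans _ f1).
split=> //.
- by rewrite absz_gt0 gt_eqF // (lt_le_trans _ f1).
- by rewrite addrC subrK invrK.
- have := floor_itv z^-1; rewrite intrD; lra.
Qed.

Lemma powR_gap B n s : 1 < B -> (0 < n)%N -> 0 < s -> 1 < B `^ (n%:R * s).
Proof.
move=> B1 n0 s0; rewrite -[ltLHS](powRr0 B) /powR gt_eqF; last lra.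
by rewrite ltr_expR ltr_pM2r ?ln_gt0 ?mul0r ?mulr_gt0 ?ltr0n.
Qed.

Lemma crit_half B n (M : R -> R) : 1 < B -> (0 < n)%N ->
  (forall s, 0 <= s <= 1 -> M s <= B `^ n%:R) ->
  exists2 s0, 1 / 2 < s0 & (s0%:E <= crit n M)%E.
Proof.
move=> B1 n0 hM; have [s0 s2 h] := psum_le_half (B `^ n%:R) n0.
exists s0 => //; apply: crit_ge => s s01 zs; rewrite leNgt; apply/negP => /ltW ss.
by apply: h ss _; apply: psum_le_leM zs; exact: hM.
Qed.

Lemma M1_le B n s : 1 < B -> 0 <= s <= 1 -> M1 B n s <= B `^ n%:R.
Proof.
move=> B1 s01; apply: ler_powR; first exact: ltW.
by rewrite ler_piMr //; nra.
Qed.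

Lemma M2_le B d n s : 1 < B -> 1 <= d -> 0 <= s <= 1 -> M2 B d n s <= B `^ n%:R.
Proof.
move=> B1 d1 s01; rewrite -[leRHS]mulr1; apply: ler_pM; rewrite ?powR_ge0 //.
  apply: ler_powR; first exact: ltW.
  by rewrite ler_piMr //; lra.
by rewrite -[leRHS](powRr0 d); apply: ler_powR => //; lra.
Qed.

(** When d is small, M2 exceeds M1 by an exponential factor on a neighbourhood
    of the first critical exponent, while the partition function, being convex
    and finite to the left of that exponent, cannot jump there. *)
Lemma crit2_lt_crit1 B d n s : 1 < B -> (0 < n)%N -> 1 / 2 < s < 1 ->
  0 < d -> d <= B `^ (n%:R * (s - 1 / 2)) ->
  (crit n (M1 B n) < s%:E)%E ->
  (crit n (M2 B d n) < crit n (M1 B n))%E.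
Proof.
move=> B1 n0 s21 d0 dB cs.
have B0 : 0 < B by lra.
have [s0 s02 hs0] := @crit_half B n (M1 B n) B1 n0 (fun s => @M1_le B n s B1).
have [r cr rs] : exists2 r, crit n (M1 B n) = r%:E & s0 <= r < s.
  case: (crit n (M1 B n)) hs0 cs => [r| |] //; rewrite lee_fin lte_fin.
  by move=> h1 h2; exists r => //; rewrite h1 h2.
rewrite cr.
pose G := B `^ (n%:R * (1 - s) ^+ 2).
have G1 : 1 < G by apply: powR_gap => //; nra.
pose m := (1 / 2 + r) / 2.
have m2 : 1 / 2 < m by rewrite /m; lra.
have mr : m < r by rewrite /m; lra.
have [Z hZ] := psum_le_finite n m2.
have Z0 : 0 <= Z by have := hZ [::] isT isT; rewrite big_nil.
have nB : 0 < 2 * n%:R * ln B by rewrite !mulr_gt0 ?ln_gt0 ?ltr0n.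
pose l1 := ln ((1 + G) / 2) / (2 * n%:R * ln B).
have l10 : 0 < l1 by rewrite divr_gt0 // ln_gt0; lra.
pose l2 := (G - 1) / 2 / (Z + 1).
have l20 : 0 < l2 by rewrite !divr_gt0 //; lra.
pose l := Num.min 1 (Num.min l1 l2).
have l0 : 0 < l by rewrite !lt_min ltr01 l10.
have [ll ll1 ll2] : [/\ l <= 1, l <= l1 & l <= l2].
  by split; rewrite /l !ge_min lexx ?orbT.
have hl1 : B `^ (2 * n%:R * l) <= (1 + G) / 2.
  rewrite /powR gt_eqF // -[leRHS]lnK ?posrE; last lra.
  rewrite ler_expR mulrAC -ler_pdivlMl // mulrC; exact: ll1.
have hl2 : l * Z <= (G - 1) / 2.
  apply: (@le_trans _ _ (l2 * (Z + 1))).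
    by apply: ler_pM => //; [exact: ltW|lra].
  by rewrite /l2 divfK // gt_eqF //; lra.
have [x [x01 xr zx]] : exists x, [/\ 0 <= x <= 1, x < r + l * (r - m)
    & psum_le n x (M1 B n x)].
  by apply: crit_lt; rewrite cr lte_fin; nra.
have rx : r <= x by rewrite -lee_fin -cr; exact: crit_le.
pose s' := (1 - l) * x + l * m.
have s'r : s' < r by rewrite /s'; nra.
have s'2 : 1 / 2 < s' by rewrite /s'; nra.
have l01 : 0 <= l <= 1 by lra.
have zs' := psum_le_convex l01 zx hZ.
rewrite -/s' in zs'.
apply: (@le_lt_trans _ _ s'%:E); last by rewrite lte_fin.
apply: crit_le; first lra.
apply: psum_le_leM zs'.
have P1 : 1 <= B `^ (n%:R * s' ^+ 2).
  rewrite -[leLHS](powRr0 B); apply: ler_powR; first exact: ltW.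
  by rewrite mulr_ge0 // sqr_ge0.
have lower : B `^ (n%:R * s' ^+ 2) * G <= M2 B d n s'.
  apply: (@le_trans _ _ (B `^ (n%:R * s') * B `^ (n%:R * (s - 1 / 2) * (s' - 1)))).
    rewrite -!powRDpos //; apply: ler_powR; first exact: ltW.
    by rewrite -mulrA -!mulrDr ler_wpM2l //; nra.
  rewrite /M2 ler_wpM2l ?powR_ge0 // powRrM.
  by rewrite -(opprB 1 s'); apply: powRN_le_base => //; lra.
have upper : (1 - l) * M1 B n x + l * Z <= B `^ (n%:R * s' ^+ 2) * ((1 + G) / 2) + (G - 1) / 2.
  apply: lerD => //; apply: (@le_trans _ _ (M1 B n x)).
    by rewrite ler_piMl ?powR_ge0 //; lra.
  have -> : M1 B n x = B `^ (n%:R * s' ^+ 2) * B `^ (n%:R * (x ^+ 2 - s' ^+ 2)).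
    by rewrite -powRDpos // -mulrDr addrC subrK.
  rewrite ler_wpM2l ?powR_ge0 //; apply: le_trans hl1.
  apply: ler_powR; first exact: ltW.
  rewrite -mulrA mulrCA ler_wpM2l // -/s'.
  have -> : x ^+ 2 - s' ^+ 2 = (x - s') * (x + s') by ring.
  have e : x - s' = l * (x - m) by rewrite /s'; ring.
  have : 0 <= x - s' <= l by rewrite e; apply/andP; split; nra.
  nra.
nra.
Qed.

Lemma predim_lt B n z s : (predim B n z < s%:E)%E ->
  ((predim1 B n <= predim2 B n z)%E /\ (predim1 B n < s%:E)%E) \/
  [/\ (predim2 B n z < predim1 B n)%E, (predim2 B n z < s%:E)%E
    & (predim3 B n z < s%:E)%E].
Proof.
rewrite /predim; case: ifPn => [h|]; first by left.
by rewrite -ltNge gt_max => h /andP[? ?]; right.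
Qed.

Lemma lt_predim B n z s : (s%:E < predim B n z)%E ->
  ((s%:E < predim1 B n)%E /\ (s%:E < predim2 B n z)%E) \/ (s%:E < predim3 B n z)%E.
Proof.
rewrite /predim; case: ifPn => [h|].
  by move=> h1; left; split => //; exact: lt_le_trans h1 h.
rewrite -ltNge lt_max => h /orP[h2|h3]; [left|by right].
by split => //; exact: lt_trans h2 h.
Qed.

Lemma predim_ge_half B n z : 1 < B -> (0 < n)%N -> 0 <= z <= 1 ->
  ((1 / 2)%:E <= predim B n z)%E.
Proof.
move=> B1 n0 z01; have B0 : 0 < B by lra.
have h1 : ((1 / 2)%:E <= predim1 B n)%E.
  have [s0 s2 hs] := @crit_half B n (M1 B n) B1 n0 (fun s => @M1_le B n s B1).
  by rewrite predim1E //; apply: le_trans hs; rewrite lee_fin ltW.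
have h2 : ((1 / 2)%:E <= predim2 B n z)%E.
  case: (first_digitP z01) => [[_ zd]|[k [k0 zd _ _]]].
    by rewrite /predim2 zd lee_fin; lra.
  have k1 : 1 <= k%:R :> R by rewrite ler1n.
  have [s0 s2 hs] := @crit_half B n (M2 B k%:R n) B1 n0
    (fun s => @M2_le B k%:R n s B1 k1).
  rewrite (@predim2E _ _ k%:R) //; last lra.
  by apply: le_trans hs; rewrite lee_fin ltW.
by rewrite /predim; case: ifPn => // _; rewrite le_max h2.
Qed.

Lemma predim_le_one B n z : 1 < B -> 0 <= z <= 1 -> 2 <= B `^ (n%:R / 2) ->
  (predim B n z <= 1)%E.
Proof.
move=> B1 z01 hB; have B0 : 0 < B by lra.
have o1 : 0 <= (1 : R) <= 1 by rewrite ler01 lexx.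
have hB' : 2 <= B `^ n%:R.
  apply: le_trans hB _; apply: ler_powR; first exact: ltW.
  by rewrite ler_pdivrMr // ler_peMr //; lra.
have h1 : (predim1 B n <= 1)%E.
  rewrite predim1E //; apply: crit_le => //. apply: psum_le_leM (@psum_le_one R n).
  by rewrite expr1n mulr1.
have h2 : (predim2 B n z <= 1)%E.
  case: (first_digitP z01) => [[_ zd]|[k [k0 zd _ _]]].
    by rewrite /predim2 zd.
  rewrite (@predim2E _ _ k%:R) ?ltr0n //; apply: crit_le => //.
  apply: psum_le_leM (@psum_le_one R n).
  by rewrite mulr1 subrr powRr0 mulr1.
have h3 : (predim3 B n z <= 1)%E.
  case: (first_digitP z01) => [[_ zd]|[k [k0 zd _ _]]].
    by rewrite /predim3 zd lee_fin.
  rewrite (@predim3E _ _ k%:R) ?ltr0n //; apply: crit_le => //.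
  apply: psum_le_leM (@psum_le_one R n).
  rewrite mulr1 powRr1 //; apply: le_trans hB _.
  by rewrite ler_peMl ?powR_ge0 // ler1n.
by rewrite /predim; case: ifPn => // _; rewrite ge_max h2.
Qed.
End PredimBounds.

(** * Covering the hitting set inside one cylinder *)

Section LocalCover.
Variable R : realType.
Implicit Types (s e t u y z d c : R) (k n N K : nat).

(** Here e^2 is the tolerance B^-n: near z both factors have size about e. *)
Definition hit e z : set R :=
  [set y | 0 < y < 1 /\ `|y - z| * `|gauss_map y - gauss_map z| < e ^+ 2].

Definition strip k t e : set R :=
  [set y | exists2 u, 0 <= u <= 1 & y = (k%:R + u)^-1 /\ `|u - t| <= e].

Lemma branch_dist a u v : 0 < a -> 0 <= u -> 0 <= v ->
  `|(a + u)^-1 - (a + v)^-1| = `|u - v| / ((a + u) * (a + v)) :> R.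
Proof.
move=> a0 u0 v0.
have au : 0 < a + u by lra.
have av : 0 < a + v by lra.
have -> : (a + u)^-1 - (a + v)^-1 = (v - u) / ((a + u) * (a + v)).
  by field; rewrite !gt_eqF.
by rewrite normrM normfV distrC [`|(_ + _) * _|]ger0_norm // mulr_ge0 // ltW.
Qed.

Lemma covered_strip s k t e c : 0 < s -> (0 < k)%N -> 0 <= e ->
  2 * e / k%:R ^+ 2 <= c -> covered s (c `^ s) (strip k t e).
Proof.
move=> s0 k0 e0 hc; have k1 : 1 <= k%:R :> R by rewrite ler1n.
apply: covered_small => //.
  by apply: le_trans hc; rewrite divr_ge0 ?mulr_ge0 ?exprn_ge0.
move=> _ _ [u /andP[u0 u1] [-> hu]] [v /andP[v0 v1] [-> hv]].
rewrite branch_dist //; last lra.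
apply: le_trans hc; apply: ler_pM => //.
- by rewrite invr_ge0 mulr_ge0 //; lra.
- by move: hu hv; rewrite !ler_norml; lra.
- rewrite lef_pV2 ?posrE ?mulr_gt0 ?exprn_gt0 //; try lra.
  by rewrite expr2; apply: ler_pM; lra.
Qed.

(** When the first digits k and d differ by D >= 2, the first factor is at least
    about D/(k d), which confines the second one. *)
Lemma far_digit e (k d : R) u t D : 0 <= u <= 1 -> 0 <= t <= 1 ->
  1 <= k -> 1 <= d -> 2 <= D -> D <= `|k - d| ->
  `|(k + u)^-1 - (d + t)^-1| * `|u - t| < e ^+ 2 ->
  `|u - t| <= 8 * e ^+ 2 * k * d / D.
Proof.
move=> u01 t01 k1 d1 D2 Dkd h.
have ku : 0 < k + u by lra.
have dt : 0 < d + t by lra.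
have kd : `|k + u - d - t| >= D / 2.
  have : `|k - d| <= `|k + u - d - t| + 1.
    rewrite (_ : k - d = (k + u - d - t) + (t - u)); last ring.
    by apply: le_trans (ler_normD _ _) _; rewrite lerD2l ler_norml; lra.
  lra.
have e1 : `|(k + u)^-1 - (d + t)^-1| = `|k + u - d - t| / ((k + u) * (d + t)).
  have -> : (k + u)^-1 - (d + t)^-1 = (d + t - k - u) / ((k + u) * (d + t)).
    by field; rewrite !gt_eqF.
  rewrite normrM normfV [`|(_ + _) * _|]ger0_norm ?mulr_ge0 // 1?ltW //.
  by rewrite -normrN; congr (`|_| / _); ring.
have D0 : 0 < D by lra.
rewrite ler_pdivlMr //.
have h2 : D / 2 / (4 * (k * d)) <= `|(k + u)^-1 - (d + t)^-1|.
  rewrite e1; apply: ler_pM => //; try lra.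
    by rewrite invr_ge0 !mulr_ge0 //; lra.
  rewrite lef_pV2 ?posrE ?mulr_gt0 //; try lra.
  rewrite (_ : 4 * (k * d) = (2 * k) * (2 * d)); last ring.
  by apply: ler_pM; lra.
have h3 : D / 2 / (4 * (k * d)) * `|u - t| < e ^+ 2.
  by apply: le_lt_trans h; rewrite ler_wpM2r.
have kd0 : 0 < 8 * (k * d) by rewrite !mulr_gt0 //; lra.
have := ltW h3; rewrite -(ler_pM2r kd0).
have -> : D / 2 / (4 * (k * d)) * `|u - t| * (8 * (k * d)) = `|u - t| * D.
  by field; rewrite !gt_eqF //; lra.
by have -> : 8 * e ^+ 2 * k * d = e ^+ 2 * (8 * (k * d)) by ring.
Qed.

Lemma hit_digit e z y : hit e z y -> exists k u,
  [/\ (0 < k)%N, 0 <= u <= 1, y = (k%:R + u)^-1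
    & `|y - z| * `|u - gauss_map z| < e ^+ 2].
Proof.
move=> [y01 h]; have y01' : 0 <= y <= 1 by lra.
case: (first_digitP y01') => [[y0 _]|[k [k0 _ yE u01]]]; first by exfalso; lra.
by exists k, (gauss_map y); split => //; lra.
Qed.

Lemma sum_powRN_rev s N : 0 <= s < 1 ->
  \sum_(i < N) ((N - i)%:R : R) `^ (- s) <= 2 / (1 - s) * N%:R `^ (1 - s).
Proof.
move=> s01; apply: le_trans (sum_powRN_le N s01).
rewrite (reindex_inj rev_ord_inj) /=; apply: ler_sum => i _.
by rewrite subKn.
Qed.

Lemma powR_split s a x y : 0 < s <= 1 -> 0 <= a -> 0 < x -> 0 < y ->
  (a * (x^-1 + y^-1)) `^ s <= a `^ s * (x `^ (- s) + y `^ (- s)).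
Proof.
move=> s01 a0 x0 y0; have xi : 0 <= x^-1 by rewrite invr_ge0 ltW.
have yi : 0 <= y^-1 by rewrite invr_ge0 ltW.
rewrite powRM ?addr_ge0 // ler_wpM2l ?powR_ge0 //.
by rewrite -(powR_inv _ (ltW x0)) -(powR_inv _ (ltW y0)); apply: powR_subadd.
Qed.

(** The strip of digit k has length at most 16 e^2 (1/k + 1/(d - k)). *)
Lemma covered_far_left s e t (d N : nat) : 1 / 2 < s < 1 -> 0 <= e -> 0 <= t <= 1 -> (N < d)%N ->
  covered s ((16 * e ^+ 2) `^ s * (2 * (2 / (1 - s) * N%:R `^ (1 - s))))
    [set y | exists k u, [/\ (0 < k <= N)%N, (k.+2 <= d)%N, 0 <= u <= 1,
      y = (k%:R + u)^-1 & `|y - (d%:R + t)^-1| * `|u - t| < e ^+ 2]].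
Proof.
move=> s01 e0 t01 Nd; have s0 : 0 < s by lra.
pose v (i : nat) := (16 * e ^+ 2) `^ s * (i.+1%:R `^ (- s) + (N - i)%:R `^ (- s)).
have e2 : 0 <= e ^+ 2 by rewrite sqr_ge0.
apply: (@covered_sub _ _ _ (\sum_(i < N) v i) _ [set y | exists2 i, (i < N)%N &
  strip i.+1 t (if (i.+3 <= d)%N then 8 * e ^+ 2 * i.+1%:R * d%:R / (d - i.+1)%:R else 0) y]).
- move=> y [[|k] [u []]] // /andP[_ kN] kd u01 -> h.
  exists k => //; exists u => //; split => //; rewrite kd.
  apply: far_digit h => //; rewrite ?ler1n //.
  + by move: kd; clear; lia.
  + by rewrite ler_nat; move: kd; clear; lia.
  + by rewrite distrC natrB ?ler_norm //; move: kd; clear; lia.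
- rewrite -mulr_sumr ler_wpM2l ?powR_ge0 // big_split /= mulr2n mulrDl mul1r.
  by apply: lerD; [apply: sum_powRN_le|apply: sum_powRN_rev]; lra.
apply: covered_bigcup_lt => // i iN.
have Ni : 0 < (N - i)%:R :> R by rewrite ltr0n; move: iN; clear; lia.
apply: (@covered_sub _ _ _ ((16 * e ^+ 2 * (i.+1%:R^-1 + (N - i)%:R^-1)) `^ s) _
  (strip i.+1 t (if (i.+3 <= d)%N then 8 * e ^+ 2 * i.+1%:R * d%:R / (d - i.+1)%:R else 0))) => //.
  by apply: powR_split; rewrite ?mulr_ge0 //; lra.
case: ifPn => id; apply: covered_strip => //; last first.
- by rewrite mulr0 mul0r !mulr_ge0 // addr_ge0 ?invr_ge0.
- have j0 : 0 < (d - i.+1)%:R :> R by rewrite ltr0n; move: id; clear; lia.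
  have k0 : 0 < i.+1%:R :> R by [].
  have dE : d%:R = (d - i.+1)%:R + i.+1%:R :> R by rewrite -natrD; congr _%:R; move: id; clear; lia.
  rewrite dE; set j := (d - i.+1)%:R : R in j0 *.
  have -> : 2 * (8 * e ^+ 2 * i.+1%:R * (j + i.+1%:R) / j) / i.+1%:R ^+ 2 =
     16 * e ^+ 2 * (i.+1%:R^-1 + j^-1).
    by field; rewrite !gt_eqF.
  rewrite ler_wpM2l ?mulr_ge0 // lerD2l lef_pV2 ?posrE //.
  by rewrite /j ler_nat; move: Nd; clear; lia.
- by rewrite !mulr_ge0 // invr_ge0.
Qed.

(** With j = k - d, the strip of digit k has length at most 16 e^2 / j. *)
Lemma covered_far_right s e t (d N : nat) : 1 / 2 < s < 1 -> 0 <= e -> 0 <= t <= 1 -> (0 < d)%N ->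
  covered s ((16 * e ^+ 2) `^ s * (2 / (1 - s) * N%:R `^ (1 - s)))
    [set y | exists k u, [/\ (d.+2 <= k < d + N)%N, 0 <= u <= 1,
      y = (k%:R + u)^-1 & `|y - (d%:R + t)^-1| * `|u - t| < e ^+ 2]].
Proof.
move=> s01 e0 t01 d0; have s0 : 0 < s by lra.
have e2 : 0 <= e ^+ 2 by rewrite sqr_ge0.
pose del (i : nat) := 8 * e ^+ 2 * (d + i.+1)%:R * d%:R / i.+1%:R : R.
apply: (@covered_sub _ _ _ (\sum_(i < N) (16 * e ^+ 2) `^ s * i.+1%:R `^ (- s)) _
  [set y | exists2 i, (i < N)%N & strip (d + i.+1) t (del i) y]).
- move=> y [k [u [/andP[dk kN] u01 -> h]]].
  have kE : (d + (k - d).-1.+1)%N = k by move: dk; clear; lia.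
  exists (k - d).-1; first by move: dk kN; clear; lia.
  rewrite /del kE; exists u => //; split => //.
  have jE : (k - d).-1.+1%:R = k%:R - d%:R :> R by rewrite -kE natrD addrC addKr; congr _%:R; move: dk; clear; lia.
  apply: far_digit h => //; rewrite ?ler1n //.
  + by move: dk; clear; lia.
  + by rewrite ler_nat; move: dk; clear; lia.
  + by rewrite jE ler_norm.
- by rewrite -mulr_sumr ler_wpM2l ?powR_ge0 // sum_powRN_le //; lra.
apply: (@covered_bigcup_lt _ _ (fun i => (16 * e ^+ 2) `^ s * i.+1%:R `^ (- s))
  (fun i => strip (d + i.+1) t (del i))) => // i iN.
apply: (@covered_sub _ _ _ ((16 * e ^+ 2 / i.+1%:R) `^ s) _ (strip (d + i.+1) t (del i))) => //.
  by rewrite powRM ?invr_ge0 ?mulr_ge0 // powR_inv.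
apply: covered_strip => //; first by rewrite addnS.
  by rewrite /del !mulr_ge0 // invr_ge0.
rewrite /del; have k0 : 0 < (d + i.+1)%:R :> R by rewrite ltr0n addnS.
have i0 : 0 < i.+1%:R :> R by [].
have -> : 2 * (8 * e ^+ 2 * (d + i.+1)%:R * d%:R / i.+1%:R) / (d + i.+1)%:R ^+ 2 =
   16 * e ^+ 2 / i.+1%:R * (d%:R / (d + i.+1)%:R).
  by field; rewrite !gt_eqF.
rewrite ler_piMr ?divr_ge0 ?mulr_ge0 //.
by rewrite ler_pdivrMr // mul1r ler_nat leq_addr.
Qed.
End LocalCover.

Section LocalCoverSum.
Variable R : realType.
Implicit Types (s e t u y z : R) (k d n N K : nat).

Definition digit_hit e t d (P : pred nat) : set R :=
  [set y | exists k u, [/\ (0 < k)%N && P k, 0 <= u <= 1,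
      y = (k%:R + u)^-1 & `|y - (d%:R + t)^-1| * `|u - t| < e ^+ 2]].

(** For k >= 2d the strips have length about e^2 d / k^2, which is summable to
    the power s because s > 1/2. *)
Lemma covered_tail s e t d : 1 / 2 < s < 1 -> 0 <= e -> 0 <= t <= 1 ->
  (0 < d)%N ->
  covered s ((32 * e ^+ 2) `^ s * ((2 * s - 1)^-1 * d%:R `^ (1 - s)))
    (digit_hit e t d (fun k => (d.+2 <= k) && (d.*2 <= k))%N).
Proof.
move=> s01 e0 t01 d0; have s0 : 0 < s by lra.
have e2 : 0 <= e ^+ 2 by rewrite sqr_ge0.
have r0 : 0 < 2 * s - 1 by lra.
pose m := d.*2.-1.
have dm : (d <= m)%N by rewrite /m; move: d0; clear; lia.
pose del (i : nat) := if (d < (m + i).+1)%N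
  then 8 * e ^+ 2 * (m + i).+1%:R * d%:R / ((m + i).+1 - d)%:R else 0 : R.
have d0' : 0 < d%:R :> R by rewrite ltr0n.
apply: (@covered_sub _ _ _ ((32 * e ^+ 2 * d%:R) `^ s * ((2 * s - 1)^-1 * m%:R `^ (- (2 * s - 1)))) _
  (\bigcup_i strip (m + i).+1 t (del i))).
- move=> y [k [u [/and3P[k0 dk k2] u01 -> h]]].
  have kE : k = (m + (k - m.+1)).+1.
    by rewrite /m; move: d0 k2; clear; lia.
  exists (k - m.+1)%N => //; rewrite /del -kE.
  exists u => //; split => //; rewrite ifT; last by move: dk; clear; lia.
  apply: far_digit h => //; rewrite ?ler1n //.
    by rewrite ler_nat; move: dk; clear; lia.
  by rewrite natrB ?ler_norm //; move: dk; clear; lia.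
- rewrite powRM ?mulr_ge0 // -mulrA ler_wpM2l ?powR_ge0 //.
  rewrite mulrCA ler_wpM2l ?invr_ge0 ?(ltW r0) //.
  have -> : 1 - s = s + - (2 * s - 1) by ring.
  rewrite powRDpos // ler_wpM2l ?powR_ge0 //.
  by apply: powRN_le_base; rewrite ?(ltW r0) // ler_nat.
apply: (@covered_bigcup_nat _ _
  (fun i => (32 * e ^+ 2 * d%:R) `^ s * (m + i).+1%:R `^ (- (1 + (2 * s - 1))))) => // [i|n].
  have k0 : 0 < (m + i).+1%:R :> R by [].
  have k20 : 0 <= (m + i).+1%:R ^+ 2 :> R by rewrite exprn_ge0.
  apply: (@covered_sub _ _ _ ((32 * e ^+ 2 * d%:R / (m + i).+1%:R ^+ 2) `^ s) _
    (strip (m + i).+1 t (del i))) => //.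
    rewrite powRM ?invr_ge0 ?mulr_ge0 // powR_inv //.
    rewrite -(@powR_mulrn _ (m + i).+1%:R) // -powRrM.
    by have -> : 2 * - s = - (1 + (2 * s - 1)) :> R by ring.
  apply: covered_strip => //.
    by rewrite /del; case: ifP => // _; rewrite !mulr_ge0 // invr_ge0.
  rewrite /del; case: ifP => [kd|_]; last first.
    by rewrite mulr0 mul0r divr_ge0 ?mulr_ge0.
  have j0 : 0 < ((m + i).+1 - d)%:R :> R by rewrite ltr0n; move: kd; clear; lia.
  have kj : (m + i).+1%:R <= 2 * ((m + i).+1 - d)%:R :> R.
    by rewrite -natrM ler_nat /m; move: d0; clear; lia.
  rewrite ler_wpM2r ?invr_ge0 //.
  set k := (m + i).+1%:R : R in k0 kj *; set j := ((m + i).+1 - d)%:R : R in j0 kj *.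
  rewrite mulrA ler_pdivrMr //.
  have : 0 <= e ^+ 2 * d%:R by rewrite mulr_ge0.
  move: kj k0 j0; clearbody k j => kj k0 j0 ed.
  by nra.
by rewrite -mulr_sumr ler_wpM2l ?powR_ge0 // sum_powRN_tail // (leq_trans d0 dm).
Qed.

(** Next to z, either the first factor is at most e/d or the second is below e d;
    both cases leave pieces of length at most 8 e/d. *)
Lemma covered_middle s e t d : 0 < s -> 0 < e -> 0 <= t <= 1 -> (0 < d)%N ->
  covered s (4 * (8 * (e / d%:R)) `^ s)
    (digit_hit e t d (fun k => (d <= k.+1) && (k <= d.+1))%N).
Proof.
move=> s0 e0 t01 d0.
have d0' : 0 < d%:R :> R by rewrite ltr0n.
have ed : 0 < e / d%:R by rewrite divr_gt0.
set c := (8 * (e / d%:R)) `^ s.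
have -> : 4 * c = c + \sum_(i < 3) c by rewrite !big_ord_recl big_ord0; ring.
pose S i := if (0 < d.-1 + i)%N && (d <= (d.-1 + i).*2)%N
  then strip (d.-1 + i) t (e * d%:R) else set0.
apply: (@covered_sub _ _ _ (c + \sum_(i < 3) c) _
  ([set y | `|y - (d%:R + t)^-1| <= e / d%:R] `|`
   [set y | exists2 i, (i < 3)%N & S i y])) => //.
  move=> y [k [u [/and3P[k0 dk kd] u01 yE h]]].
  have [yz|yz] := leP `|y - (d%:R + t)^-1| (e / d%:R); first by left.
  right; exists (k - d.-1)%N; first by move: kd d0; clear; lia.
  have kE : (d.-1 + (k - d.-1) = k)%N by move: dk; clear; lia.
  rewrite /S kE k0 ifT; last by move: dk k0; clear; lia.
  exists u => //; split => //; rewrite leNgt; apply/negP => hu.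
  suff : e ^+ 2 <= `|y - (d%:R + t)^-1| * `|u - t| by rewrite leNgt h.
  have -> : e ^+ 2 = e / d%:R * (e * d%:R) by field; rewrite gt_eqF.
  by apply: ler_pM; rewrite ?(ltW ed) ?mulr_ge0 ?(ltW e0) // ltW.
apply: covered_setU => //.
  apply: covered_small => //; first by rewrite mulr_ge0 // ltW.
  by move=> x y /=; rewrite !ler_norml; lra.
apply: (@covered_bigcup_lt _ _ (fun=> c)) => // i i3; rewrite /S.
case: ifP => [/andP[k0 kd]|_]; last by apply: covered0; rewrite ?powR_ge0.
apply: covered_strip => //; first by rewrite mulr_ge0 // ltW.
have k0' : 0 < (d.-1 + i)%:R :> R by rewrite ltr0n.
rewrite ler_pdivrMr ?exprn_gt0 //.
have : d%:R <= 2 * (d.-1 + i)%:R :> R by rewrite -natrM ler_nat mul2n.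
set k := (d.-1 + i)%:R : R in k0' *; set x := d%:R : R in d0' ed *.
clear S c; move: k0' d0'; clearbody k x => k0' d0' dk.
have -> : 8 * (e / x) * k ^+ 2 = 2 * e * x * ((2 * k) ^+ 2 / x ^+ 2).
  by field; rewrite gt_eqF.
rewrite mulrA ler_peMr ?mulr_ge0 ?(ltW e0) ?(ltW d0') //.
rewrite ler_pdivlMr ?exprn_gt0 // mul1r.
by apply: ler_pM => //; exact: ltW.
Qed.

Lemma covered_far s e t d N N' : 1 / 2 < s < 1 -> 0 <= e -> 0 <= t <= 1 ->
  (0 < d)%N -> (N < d)%N -> (N <= N')%N ->
  covered s ((16 * e ^+ 2) `^ s * (3 * (2 / (1 - s) * N'%:R `^ (1 - s))))
    (digit_hit e t d (fun k => (k <= N) && (k.+2 <= d) ||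
                               (d.+2 <= k) && (k < d + N'))%N).
Proof.
move=> s01 e0 t01 d0 Nd NN; have s0 : 0 < s by lra.
have l := covered_far_left s01 e0 t01 Nd.
have r := covered_far_right N' s01 e0 t01 d0.
apply: covered_sub (covered_setU s0 l r).
  move=> y [k [u [/andP[k0 /orP[/andP[? ?]|/andP[? ?]]] u01 yE h]]].
    by left; exists k, u; rewrite k0.
  by right; exists k, u; split => //; apply/andP.
have C0 : 0 <= 2 / (1 - s) by rewrite divr_ge0 //; lra.
have NP : N%:R `^ (1 - s) <= N'%:R `^ (1 - s) :> R.
  by apply: powR_le_base; rewrite ?ler_nat //; lra.
rewrite -mulrDr ler_wpM2l ?powR_ge0 //.
have := ler_wpM2l C0 NP; lra.
Qed.

(** All strips are covered one by one: this costs the sum of the reciprocals of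
    M2 and M3. *)
Lemma covered_hit2 s : 1 / 2 < s < 1 -> exists2 C : R, 0 < C &
  forall e z d, 0 < e -> (0 < d)%N -> z = (d%:R + gauss_map z)^-1 ->
    0 <= gauss_map z < 1 ->
  covered s (C * ((e ^+ 2) `^ s * d%:R `^ (1 - s) + (e / d%:R) `^ s)) (hit e z).
Proof.
move=> s01; have s0 : 0 < s by lra.
pose C1 := 16 `^ s * (3 * (2 / (1 - s))) : R.
pose C2 := 32 `^ s * (2 * s - 1)^-1 : R.
pose C3 := 4 * 8 `^ s : R.
have C10 : 0 < C1.
  by rewrite /C1 mulr_gt0 ?powR_gt0 // !mulr_gt0 // invr_gt0; lra.
have C20 : 0 < C2 by rewrite mulr_gt0 ?powR_gt0 // invr_gt0; lra.
have C30 : 0 < C3 by rewrite mulr_gt0 ?powR_gt0.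
exists (C1 + C2 + C3) => [|e z d e0 d0 zE t01]; first by lra.
have t01' : 0 <= gauss_map z <= 1 by lra.
have e0' := ltW e0.
have dd : (d.-1 < d)%N by rewrite ltn_predL.
have a := covered_far s01 e0' t01' d0 dd (leq_pred d).
have b := covered_tail s01 e0' t01' d0.
have c := covered_middle s0 e0 t01' d0.
apply: covered_sub (covered_setU s0 a (covered_setU s0 b c)).
  move=> y /hit_digit[k [u [k0 u01 yE h]]]; rewrite {1}zE in h.
  have [dk|dk] := leqP d k.+1.
    have [kd|kd] := leqP k d.+1.
      by right; right; exists k, u; split => //; rewrite k0 dk kd.
    have [k2|k2] := leqP d.*2 k.
      by right; left; exists k, u; split => //; rewrite k0 kd k2.
    left; exists k, u; split => //; by rewrite k0 kd addnn k2 orbT.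
  left; exists k, u; split => //; apply/andP; split => //; apply/orP; left.
  by move: dk; clear; lia.
have e2 : 0 <= e ^+ 2 by rewrite sqr_ge0.
have ed : 0 <= e / d%:R by rewrite divr_ge0.
rewrite !(@powRM _ _ (e ^+ 2)) // (@powRM _ 8) //.
set E := (e ^+ 2) `^ s; set D := d%:R `^ (1 - s); set F := (_ / _) `^ s.
have E0 : 0 <= E by exact: powR_ge0.
have D0 : 0 <= D by exact: powR_ge0.
have F0 : 0 <= F by exact: powR_ge0.
have ED := mulr_ge0 E0 D0.
have -> : 16 `^ s * E * (3 * (2 / (1 - s) * D)) = C1 * (E * D) by rewrite /C1; ring.
have -> : 32 `^ s * E * ((2 * s - 1)^-1 * D) = C2 * (E * D) by rewrite /C2; ring.
have -> : 4 * (8 `^ s * F) = C3 * F by rewrite /C3; ring.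
have := mulr_ge0 (ltW C30) ED; have := mulr_ge0 (ltW C10) F0.
by have := mulr_ge0 (ltW C20) F0; lra.
Qed.

Lemma nat_between x : 1 <= x :> R -> exists K : nat, (0 < K)%N /\ x <= K%:R <= 2 * x.
Proof.
move=> x1; exists (Num.truncn x).+1; split => //.
have x0 : 0 <= x by lra.
have /andP[h1 h2] := truncn_itv x0; rewrite (ltW h2) /= -natr1; lra.
Qed.

(** With K about e^(-2s), the interval [0, 1/K] costs as much as the K strips
    outside it. *)
Lemma cut_digit s e : 1 / 2 < s < 1 -> 0 < e <= 1 -> exists K : nat, [/\ (0 < K)%N,
  K%:R^-1 `^ s <= e `^ (2 * s ^+ 2) &
  (e ^+ 2) `^ s * K%:R `^ (1 - s) <= 2 * e `^ (2 * s ^+ 2)].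
Proof.
move=> /andP[s2 s1] /andP[e0 e1].
have x1 : 1 <= e `^ (- (2 * s)).
  rewrite -[leLHS](powRr0 e); apply: ger_powR; [by rewrite e0|lra].
have [K [K0 /andP[xK Kx]]] := nat_between x1.
exists K; split => //.
  rewrite powR_inv //; apply: (@le_trans _ _ ((e `^ (- (2 * s))) `^ (- s))).
    by apply: powRN_le_base => //; [lra|exact: powR_gt0].
  by rewrite -powRrM; have -> : - (2 * s) * - s = 2 * s ^+ 2 by ring.
apply: (@le_trans _ _ ((e ^+ 2) `^ s * (2 * e `^ (- (2 * s))) `^ (1 - s))).
  by rewrite ler_wpM2l ?powR_ge0 // powR_le_base //; lra.
rewrite powRM ?powR_ge0 // mulrCA -powRrM -powR_mulrn ?(ltW e0) // -powRrM.
rewrite -powRDpos //.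
have -> : 2 * s + - (2 * s) * (1 - s) = 2 * s ^+ 2 by ring.
rewrite ler_wpM2r ?powR_ge0 // -[leRHS]powRr1 //.
by apply: ler_powR; lra.
Qed.

Lemma covered_initial s (K : nat) : 0 < s -> (0 < K)%N ->
  covered s (K%:R^-1 `^ s) [set y : R | 0 <= y <= K%:R^-1].
Proof.
move=> s0 K0; apply: covered_small => [//||x y /= hx hy]; first by rewrite invr_ge0.
by rewrite ler_norml; lra.
Qed.
Lemma branch_le_inv (k K : nat) u : (0 < K)%N -> (K <= k)%N -> 0 <= u ->
  0 <= (k%:R + u)^-1 <= K%:R^-1.
Proof.
move=> K0 Kk u0; have K1 : 1 <= K%:R :> R by rewrite ler1n.
have kK : K%:R <= k%:R :> R by rewrite ler_nat.
apply/andP; split; first by rewrite invr_ge0; lra.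
by rewrite lef_pV2 ?posrE; lra.
Qed.

(** Cutting at the digit e^(-2s) costs the reciprocal of M1; the strip around z
    is affordable only when d is not too small. *)
Lemma covered_hit1 s : 1 / 2 < s < 1 -> exists2 C : R, 0 < C &
  forall e z d, 0 < e <= 1 -> (0 < d)%N -> z = (d%:R + gauss_map z)^-1 ->
    0 <= gauss_map z < 1 -> e `^ (1 - 2 * s) <= d%:R ->
  covered s (C * e `^ (2 * s ^+ 2)) (hit e z).
Proof.
move=> s01; have s0 : 0 < s by lra.
pose C1 := 16 `^ s * (3 * (2 / (1 - s))) : R.
pose C3 := 4 * 8 `^ s : R.
have C10 : 0 < C1.
  by rewrite /C1 mulr_gt0 ?powR_gt0 // !mulr_gt0 // invr_gt0; lra.
have C30 : 0 < C3 by rewrite mulr_gt0 ?powR_gt0.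
exists (1 + 2 * C1 + C3) => [|e z d e01 d0 zE t01 ed]; first by lra.
have /andP[e0 e1] := e01.
have t01' : 0 <= gauss_map z <= 1 by lra.
have e0' := ltW e0.
have [K [K0 hK hK']] := cut_digit s01 e01.
pose N := (minn d K).-1.
have dd : (N < d)%N by rewrite /N; move: d0 K0; clear; lia.
have NK : (N <= K)%N by rewrite /N; clear; lia.
have a := covered_far s01 e0' t01' d0 dd NK.
have c := covered_middle s0 e0 t01' d0.
have i := covered_initial s0 K0.
apply: covered_sub (covered_setU s0 i (covered_setU s0 a c)).
  move=> y /hit_digit[k [u [k0 u01 yE h]]]; rewrite {1}zE in h.
  have [Kk|kK] := leqP K k.
    by left; rewrite /= yE branch_le_inv //; case/andP: u01.
  right; have [dk|dk] := leqP d k.+1.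
    have [kd|kd] := leqP k d.+1.
      by right; exists k, u; split => //; rewrite k0 dk kd.
    left; exists k, u; split => //; rewrite k0 kd /=.
    by rewrite (leq_trans kK) ?orbT // leq_addl.
  left; exists k, u; split => //; apply/andP; split => //; apply/orP; left.
  by rewrite /N; move: dk kK; clear; lia.
have e2 : 0 <= e ^+ 2 by rewrite sqr_ge0.
have d0' : 0 < d%:R :> R by rewrite ltr0n.
have ed' : 0 <= e / d%:R by rewrite divr_ge0.
have F : (e / d%:R) `^ s <= e `^ (2 * s ^+ 2).
  have -> : 2 * s ^+ 2 = 2 * s * s by ring.
  rewrite powRrM; apply: powR_le_base; rewrite ?(ltW s0) //.
  rewrite ler_pdivrMr //; apply: le_trans (ler_wpM2l (powR_ge0 _ _) ed).
  by rewrite -powRDpos // addrC subrK powRr1.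
rewrite !(@powRM _ _ (e ^+ 2)) // (@powRM _ 8) //.
set E := (e ^+ 2) `^ s in hK' *; set D := K%:R `^ (1 - s) in hK' *.
have -> : 16 `^ s * E * (3 * (2 / (1 - s) * D)) = C1 * (E * D) by rewrite /C1; ring.
rewrite (mulrA 4) -/C3.
have := ler_wpM2l (ltW C30) F; have := ler_wpM2l (ltW C10) hK'.
move: hK; clear; move: (_ `^ (2 * s ^+ 2)) ((_ / _) `^ s) (_^-1 `^ s) (E * D).
clearbody C1 C3 => *; lra.
Qed.

Lemma covered_hit0 s : 1 / 2 < s < 1 -> exists2 C : R, 0 < C &
  forall e, 0 < e <= 1 -> covered s (C * e `^ (2 * s ^+ 2)) (hit e 0).
Proof.
move=> s01; have s0 : 0 < s by lra.
pose C1 := 4 `^ s * (2 / (1 - s)) : R.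
have C10 : 0 < C1 by rewrite mulr_gt0 ?powR_gt0 // divr_gt0 //; lra.
exists (1 + 2 * C1) => [|e e01]; first by lra.
have /andP[e0 e1] := e01.
have [K [K0 hK hK']] := cut_digit s01 e01.
have i := covered_initial s0 K0.
have e2 : 0 <= e ^+ 2 by rewrite sqr_ge0.
have g0 : gauss_map (0 : R) = 0 by rewrite /gauss_map eqxx.
have a : covered s ((4 * e ^+ 2) `^ s * (2 / (1 - s) * K%:R `^ (1 - s)))
  [set y : R | exists2 j, (j < K)%N & strip j.+1 0 (2 * e ^+ 2 * j.+1%:R) y].
  apply: (@covered_sub _ _ _ (\sum_(j < K) (4 * e ^+ 2) `^ s * j.+1%:R `^ (- s)) _ _
    (fun x p => p)).
    by rewrite -mulr_sumr ler_wpM2l ?powR_ge0 // sum_powRN_le //; lra.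
  apply: (@covered_bigcup_lt _ _ (fun j => (4 * e ^+ 2) `^ s * j.+1%:R `^ (- s))
   (fun j => strip j.+1 0 (2 * e ^+ 2 * j.+1%:R))) => // j _.
  rewrite -(powR_inv _ (ler0n _ _)) -powRM ?invr_ge0 ?(mulr_ge0 _ e2) //.
  apply: covered_strip => //; first by rewrite mulr_ge0 // mulr_ge0.
  have j0 : 0 < j.+1%:R :> R by [].
  by rewrite le_eqVlt; apply/orP; left; apply/eqP; field; rewrite gt_eqF.
apply: covered_sub (covered_setU s0 i a).
  move=> y /hit_digit[k [u [k0 u01 yE h]]]; rewrite g0 !subr0 in h.
  have [Kk|kK] := leqP K k.
    by left; rewrite /= yE branch_le_inv //; case/andP: u01.
  right; exists k.-1; first by move: kK k0; clear; lia.
  rewrite prednK //; exists u => //; split => //; rewrite subr0.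
  have k1 : 1 <= k%:R :> R by rewrite ler1n.
  have ku : 0 < k%:R + u by lra.
  rewrite yE ger0_norm ?invr_ge0 ?(ltW ku) // mulrC ltr_pdivrMr // in h.
  apply: (le_trans (ltW h)).
  have -> : 2 * e ^+ 2 * k%:R = e ^+ 2 * (2 * k%:R) by ring.
  by rewrite ler_wpM2l //; lra.
rewrite (@powRM _ 4) //.
set E := (e ^+ 2) `^ s in hK' *; set D := K%:R `^ (1 - s) in hK' *.
have -> : 4 `^ s * E * (2 / (1 - s) * D) = C1 * (E * D) by rewrite /C1; ring.
by have := ler_wpM2l (ltW C10) hK'; lra.
Qed.
End LocalCoverSum.

(** * The upper bound *)

Section Upper.
Variable R : realType.
Implicit Types (s e u y z x B : R) (k d n N : nat).
Local Notation q w := ((cf_denom w)%:R : R).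

Definition word_hit n e z : set R :=
  [set x | exists w y, [/\ word n w, hit e z y & x = cf w y]].

Lemma covered_word_hit s n e z v M : 0 < s -> covered s v (hit e z) ->
  psum_le n s M -> covered s (v * M) (word_hit n e z).
Proof.
move=> s0 hv hM; have v0 := covered_ge0 hv.
apply: (@covered_sub _ _ _ (v * M) _
  (\bigcup_w (if word n w then cf w @` hit e z else set0))) => //.
  by move=> x [w [y [nw hy ->]]]; exists w => //; rewrite nw; exists y.
apply: (@covered_bigcup _ _ _
  (fun w => if word n w then q w `^ (- (2 * s)) * v else 0)) => // [w|F uF].
  case: ifP => [nw|_]; last exact: covered0.
  have pw := word_pos nw; have q1 := q_ge1 R pw.
  have q0 : 0 <= q w by [].
  have -> : q w `^ (- (2 * s)) = (q w ^+ 2)^-1 `^ s.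
    by rewrite powR_inv ?exprn_ge0 // -powR_mulrn // -powRrM; congr powR; ring.
  apply: covered_image => //.
  move=> x y [x01 _] [y01 _]; rewrite mulrC; apply: cf_dist_le => //; lra.
rewrite -big_mkcond /= -big_filter -mulr_suml mulrC ler_wpM2l //.
by apply: hM; [exact: filter_uniq|exact: filter_all].
Qed.

(** The words w with x = cf w 0 take care of the rational points. *)
Lemma gauss_expansion n x : 0 <= x < 1 ->
  (exists w, x = cf w 0) \/
  exists w y, [/\ word n w, 0 < y < 1, x = cf w y & iter n (@gauss_map R) x = y].
Proof.
elim: n x => [|n IH] x x01.
  have [->|x0] := eqVneq x 0; first by left; exists [::].
  right; exists [::], x; split => //.
  by rewrite lt_neqAle eq_sym x0.
have x01' : 0 <= x <= 1 by lra.
case: (first_digitP x01') => [[-> _]|[k [k0 _ xE u01]]].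
  by left; exists [::].
case: (IH _ u01) => [[w e]|[w [y [nw y01 e it]]]].
  by left; exists (k :: w); rewrite /= -e.
right; exists (k :: w), y; split => //.
- by case/andP: nw => sw pw; rewrite /word /= eqSS sw k0.
- by rewrite /= -e.
- by rewrite iterSr.
Qed.

Lemma E2_limsup (B : R) (z : nat -> R) x : 1 < B -> E2 z B x ->
  (exists w, x = cf w 0) \/
  forall N, exists2 n, (N <= n)%N & word_hit n (B `^ (- (n%:R / 2))) (z n) x.
Proof.
move=> B1 [x01 inf].
have [h|nh] := pselect (exists w, x = cf w 0); [by left|right => N].
have [n [Nn [n1 hn]]] : exists n, (N <= n)%N /\ ((1 <= n)%N /\
    `|iter n (@gauss_map R) x - z n| *
    `|iter n.+1 (@gauss_map R) x - gauss_map (z n)| < B ^- n).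
  apply: contrapT => h; apply: inf.
  apply: (@sub_finite_set _ _ `I_N); last exact: finite_II.
  move=> n /= hn; rewrite ltnNge; apply/negP => Nn; apply: h.
  by exists n.
exists n => //; case: (gauss_expansion n x01) => [//|[w [y [nw y01 xE it]]]].
exists w, y; split => //; split => //.
have -> : (B `^ (- (n%:R / 2))) ^+ 2 = B ^- n.
  rewrite -powR_mulrn ?powR_ge0 // -powRrM -powR_invn; last lra.
  by congr powR; field.
by rewrite -it.
Qed.

(** The easy half of the Borel-Cantelli argument; the countably many rational
    points are covered at no cost. *)
Lemma covered_limsup s (A : nat -> set R) (rho C : R) N0 E : 0 < s ->
  0 < rho < 1 -> 0 <= C ->
  (forall n, (N0 <= n)%N -> covered s (C * rho ^+ n) (A n)) ->
  (forall x, E x -> (exists w, x = cf w 0) \/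
     forall N, exists2 n, (N <= n)%N & A n x) ->
  forall eta, 0 < eta -> covered s eta E.
Proof.
move=> s0 /andP[r0 r1] C0 hA hE eta eta0.
have r1' : 0 < 1 - rho by lra.
have [N [N0N hN]] : exists N, (N0 <= N)%N /\ C * rho ^+ N / (1 - rho) <= eta.
  have c : (C / (1 - rho) * rho ^+ n) @[n --> \oo] --> C / (1 - rho) * 0.
    by apply: cvgMr; apply: cvg_expr; rewrite ger0_norm // ltW.
  rewrite mulr0 in c.
  have /cvgrPdist_le/(_ _ eta0)[N1 _ hN1] := c.
  exists (maxn N0 N1); split; first exact: leq_maxl.
  have := hN1 (maxn N0 N1) (leq_maxr _ _); rewrite /= sub0r normrN.
  by apply: le_trans; rewrite mulrAC ler_norm.
pose Rat : set R := \bigcup_(w : seq nat) [set cf w 0].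
have cR : covered s 0 Rat.
  apply: (@covered_bigcup _ _ _ (fun=> 0)) => // [w|F _]; last by rewrite big1.
  apply: (@covered_sub _ _ _ (0 `^ s) _ [set cf w 0]) => //.
    by rewrite powR0 // gt_eqF.
  by apply: covered_small => // x y -> ->; rewrite subrr normr0.
have cL : covered s eta (\bigcup_n A (N + n)%N).
  apply: (@covered_bigcup_nat _ _ (fun n => C * rho ^+ (N + n))) => // [i|n].
    by apply: hA; rewrite (leq_trans N0N) // leq_addr.
  apply: le_trans hN; elim: n (N) => [|n IH] M.
    by rewrite big_ord0 divr_ge0 ?mulr_ge0 ?exprn_ge0 // ltW.
  rewrite big_ord_recl /= addn0.
  under eq_bigr do rewrite /bump /= add1n addnS -addSn.
  apply: (le_trans (lerD (lexx _) (IH M.+1))).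
  rewrite exprS le_eqVlt; apply/orP; left; apply/eqP; field.
  by rewrite gt_eqF.
rewrite -[eta]add0r; apply: covered_sub (covered_setU s0 cR cL) => //.
move=> x /hE[[w ->]|/(_ N)[n Nn Ax]]; first by left; exists w.
by right; exists (n - N)%N => //; rewrite subnKC.
Qed.

Section Rate.
Variables (B s r : R).
Hypotheses (B1 : 1 < B) (s01 : 1 / 2 < s < 1) (rs : 0 < r < s).

Let B0 : 0 < B. Proof. move: B1; lra. Qed.
Let dl : R := (s - r) / 2.

Lemma half_power n a : B `^ (- (n%:R / 2)) `^ a = B `^ (- (n%:R / 2 * a)).
Proof. by rewrite -powRrM mulNr. Qed.

Lemma powR_decay n a : dl <= a -> B `^ (- (n%:R * a)) <= B `^ (- (n%:R * dl)).
Proof.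
move=> h; apply: ler_powR; first exact: ltW.
by rewrite lerN2 ler_wpM2l.
Qed.

Lemma psum_le_min n t (M M' : R) : psum_le n t M -> psum_le n t M' -> psum_le n t (Num.min M M').
Proof. by move=> h h' F uF wF; rewrite le_min h ?h'. Qed.

Lemma decay1 n C x : 0 <= x <= 1 -> x < r -> 0 < C ->
  C * (B `^ (- (n%:R / 2))) `^ (2 * s ^+ 2) * M1 B n x <= C * B `^ (- (n%:R * dl)).
Proof.
move=> x01 xr C0; rewrite -mulrA ler_wpM2l ?(ltW C0) // half_power -powRDpos //.
have -> : - (n%:R / 2 * (2 * s ^+ 2)) + n%:R * x ^+ 2 = - (n%:R * (s ^+ 2 - x ^+ 2)).
  by field.
apply: powR_decay; rewrite /dl; have := s01; have := rs.
by move=> /andP[? ?] /andP[? ?]; nra.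
Qed.

(** Each pre-dimensional number below r yields covers at s > r whose total cost
    decays geometrically in n. *)
Lemma covered_predim : exists2 C : R, 0 < C & forall n z, (0 < n)%N ->
  0 <= z <= 1 -> (predim B n z < r%:E)%E ->
  covered s (C * (B `^ (- dl)) ^+ n) (word_hit n (B `^ (- (n%:R / 2))) z).
Proof.
have [s12 s1] := andP s01; have [r0 rs'] := andP rs.
have s0 : 0 < s by lra.
have [C0 C00 h0] := covered_hit0 s01.
have [C1 C10 h1] := covered_hit1 s01.
have [C2 C20 h2] := covered_hit2 s01.
exists (C0 + C1 + 2 * C2) => [|n z n0 z01 hp]; first lra.
have e01 : 0 < B `^ (- (n%:R / 2)) <= 1.
  rewrite powR_gt0 //= -[leRHS](powRr0 B); apply: ler_powR; first exact: ltW.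
  by rewrite lerNl oppr0 divr_ge0.
have eE : (B `^ (- dl)) ^+ n = B `^ (- (n%:R * dl)).
  by rewrite -powR_mulrn ?powR_ge0 // -powRrM; congr powR; ring.
rewrite eE; set e := B `^ (- (n%:R / 2)) in e01 *.
set D := B `^ (- (n%:R * dl)); have D0 : 0 < D by exact: powR_gt0.
have fin (C' : R) A : 0 < C' -> C' <= C0 + C1 + 2 * C2 -> covered s (C' * D) A ->
    covered s ((C0 + C1 + 2 * C2) * D) A.
  by move=> _ CC; apply: covered_sub => //; rewrite ler_wpM2r // ltW.
have type1 (C' : R) : 0 < C' -> C' <= C0 + C1 + 2 * C2 ->
   (predim1 B n < r%:E)%E -> covered s (C' * e `^ (2 * s ^+ 2)) (hit e z) ->
   covered s ((C0 + C1 + 2 * C2) * D) (word_hit n e z).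
  move=> C'0 CC; rewrite predim1E // => /crit_lt[x [x01 xr zx]] hc.
  apply: (fin C') => //.
  have xs : x <= s by lra.
  apply: covered_sub (covered_word_hit s0 hc (psum_le_anti xs zx)) => //.
  exact: decay1.
case: (first_digitP z01) => [[zz zd]|[d [d0 zd zE t01]]].
  case: (predim_lt hp) => [[_ p1]|[_ p2 _]]; last first.
    by move: p2; rewrite /predim2 zd lte_fin => p2; exfalso; lra.
  by apply: (type1 C0) => //; [lra|rewrite zz; exact: h0].
have d1 : 1 <= d%:R :> R by rewrite ler1n.
have d0' : 0 < d%:R :> R by lra.
case: (predim_lt hp) => [[p12 p1]|[_ p2 p3]].
  have [dB|dB] := leP (e `^ (1 - 2 * s)) d%:R.
    by apply: (type1 C1) => //; [lra|exact: h1 dB].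
  exfalso; move: p12; rewrite predim1E // (@predim2E _ _ d%:R) // leNgt.
  apply/negP/negPn; apply: crit2_lt_crit1 s01 _ _ _ => //.
    apply: le_trans (ltW dB) _; rewrite /e half_power; apply: ler_powR.
      exact: ltW.
    by rewrite le_eqVlt; apply/orP; left; apply/eqP; field.
  by move: p1; rewrite predim1E // => /lt_trans; apply; rewrite lte_fin.
move: p2; rewrite (@predim2E _ _ d%:R) // => /crit_lt[x [x01 xr zx]].
move: p3; rewrite (@predim3E _ _ d%:R) // => /crit_lt[x' [x01' xr' zx']].
apply: (fin (2 * C2)); [lra|lra|].
have [e0 _] := andP e01.
have hc := h2 e z d e0 d0 zE t01.
have xs : x <= s by lra.
have xs' : x' <= s by lra.
apply: covered_sub (covered_word_hit s0 hc
  (psum_le_min (psum_le_anti xs zx) (psum_le_anti xs' zx'))) => //.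
have -> : 2 * C2 * D = C2 * (D + D) by ring.
rewrite -mulrA ler_wpM2l ?(ltW C20) // mulrDl.
have dpow a : a <= 0 -> d%:R `^ a <= 1 :> R.
  by move=> a0; rewrite -[leRHS](powRr0 d%:R); apply: ler_powR.
apply: lerD.
- apply: (@le_trans _ _ ((e ^+ 2) `^ s * d%:R `^ (1 - s) * M2 B d%:R n x)).
    by rewrite ler_wpM2l ?mulr_ge0 ?powR_ge0 // ge_min lexx.
  have -> : (e ^+ 2) `^ s * d%:R `^ (1 - s) * M2 B d%:R n x =
     B `^ (- (n%:R * (s - x))) * d%:R `^ (x - s).
    have -> : x - s = (1 - s) + (x - 1) by ring.
    have -> : - (n%:R * (s - x)) = - (n%:R / 2 * (2 * s)) + n%:R * x by field.
    rewrite -powR_mulrn ?(ltW e0) // -powRrM /e half_power.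
    by rewrite (powRDpos _ _ B0) (powRDpos (1 - s) _ d0') /M2; ring.
  rewrite -[leRHS]mulr1; apply: ler_pM; rewrite ?powR_ge0 //.
    by apply: powR_decay; rewrite /dl; lra.
  by apply: dpow; lra.
- apply: (@le_trans _ _ ((e / d%:R) `^ s * M3 B d%:R n x')).
    by rewrite ler_wpM2l ?powR_ge0 // ge_min lexx orbT.
  have -> : (e / d%:R) `^ s * M3 B d%:R n x' =
     B `^ (- (n%:R * ((s - x') / 2))) * d%:R `^ (x' - s).
    have -> : x' - s = (- s) + x' by ring.
    have -> : - (n%:R * ((s - x') / 2)) = - (n%:R / 2 * s) + n%:R * x' / 2 by field.
    rewrite powRM ?invr_ge0 ?(ltW e0) // powR_inv //.
    by rewrite /e half_power (powRDpos _ _ B0) (powRDpos (- s) _ d0') /M3; ring.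
  rewrite -[leRHS]mulr1; apply: ler_pM; rewrite ?powR_ge0 //.
    by apply: powR_decay; rewrite /dl; lra.
  by apply: dpow; lra.
Qed.
End Rate.

Lemma E2_null (B s r : R) (z : nat -> R) N0 : 1 < B -> 1 / 2 < s < 1 ->
  0 < r < s -> (forall n, (1 <= n)%N -> 0 <= z n <= 1) ->
  (forall n, (N0 <= n)%N -> (predim B n (z n) < r%:E)%E) ->
  hausdorff_measure s (E2 z B) = 0%E.
Proof.
move=> B1 s01 rs hz hp.
have s0 : 0 < s by lra.
have B0 : 0 < B by lra.
have [C C0 hC] := covered_predim B1 s01 rs.
apply: covered_null => //.
apply: (@covered_limsup _ (fun n => word_hit n (B `^ (- (n%:R / 2))) (z n))
  (B `^ (- ((s - r) / 2))) C (maxn 1 N0)) => //.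
- rewrite powR_gt0 //= powRN invf_lt1 ?powR_gt0 //.
  have := @powR_gap _ B 1 ((s - r) / 2) B1 isT; rewrite mul1r; apply; lra.
- exact: ltW.
- by move=> n; rewrite geq_max => /andP[n1 nN]; apply: hC; rewrite ?hz ?hp.
- by move=> x; exact: E2_limsup.
Qed.

(** Splitting [0, 1) into K intervals of length 1/K costs K^(1-s). *)
Lemma unit_null s (A : set R) : 1 < s -> A `<=` [set x | 0 <= x < 1] ->
  hausdorff_measure s A = 0%E.
Proof.
move=> s1 hA; have s0 : 0 < s by lra.
apply: covered_null => // eta eta0.
pose X := (1 + eta^-1) `^ (s - 1)^-1.
have sN : 0 < s - 1 by lra.
have [K [K0 hK]] : exists K : nat, (0 < K)%N /\ X <= K%:R.
  exists (Num.truncn X).+1; split => //.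
  by have /andP[_ /ltW] := truncn_itv (powR_ge0 (1 + eta^-1) (s - 1)^-1).
have K0' : 0 < K%:R :> R by rewrite ltr0n.
have ei : 0 < eta^-1 by rewrite invr_gt0.
apply: (@covered_sub _ _ _ (\sum_(i < K) K%:R^-1 `^ s) _ [set x | exists2 i, (i < K)%N &
   [set x : R | i%:R / K%:R <= x <= i.+1%:R / K%:R] x]).
- move=> x /hA/= x01.
  have xK : 0 <= x * K%:R by rewrite mulr_ge0 //; lra.
  have /andP[h1 h2] := truncn_itv xK.
  exists (Num.truncn (x * K%:R)).
    rewrite -(ltr_nat R); apply: le_lt_trans h1 _.
    by rewrite gtr_pMl //; lra.
  by rewrite ler_pdivrMr // h1 ler_pdivlMr // ltW.
- rewrite sumr_const card_ord -(mulr_natr (_ `^ _)) powR_inv // mulrC.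
  have -> : - s = - 1 + - (s - 1) by ring.
  rewrite powRDpos // powR_inv1 // mulrA mulfV ?gt_eqF // mul1r.
  have hX : 0 < X by apply: powR_gt0; lra.
  apply: (@le_trans _ _ (X `^ (- (s - 1)))).
    by apply: powRN_le_base => //; lra.
  rewrite powRN -powRrM mulVf ?gt_eqF // powRr1; last lra.
  by rewrite -[leRHS]invrK lef_pV2 ?posrE; lra.
apply: (@covered_bigcup_lt _ _ (fun=> K%:R^-1 `^ s)) => // i _.
apply: covered_small; rewrite ?invr_ge0 //.
move=> x y /=; rewrite -natr1 mulrDl mul1r ler_norml.
by set a := _ / _; set b := _^-1; lra.
Qed.
End Upper.

(** * Loads of covers *)

Section Load.
Variable R : realType.
Variables (t : R) (U : nat -> set R) (r : nat -> R).
Implicit Types (S : set R) (v c : R).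

Definition meets i S : bool := `[< U i `&` S !=set0 >].

Definition load n S : R := \sum_(i < n | meets i S) r i `^ t.

(** The total cost of the covering sets that meet S is bounded through partial
    sums, so that pigeonhole arguments involve finitely many covering sets. *)
Definition load_le S v : Prop := forall n, load n S <= v.

Lemma meets_setP i S : reflect (exists x, U i x /\ S x) (meets i S).
Proof. by apply: (iffP (asboolP _)) => -[x [? ?]]; exists x. Qed.

Lemma meets_sub i S S' : S `<=` S' -> meets i S -> meets i S'.
Proof. by move=> SS /meets_setP[x [Ux /SS Sx]]; apply/meets_setP; exists x. Qed.

Lemma load_mono m n S : (m <= n)%N -> load m S <= load n S.
Proof.
move=> mn; rewrite /load -!(big_mkord (fun i => meets i S) (fun i => r i `^ t)).
by rewrite [leRHS](@big_cat_nat _ _ _ m) //= lerDl sumr_ge0 // => i _; exact: powR_ge0.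
Qed.

Lemma load_sub n S S' : S `<=` S' -> load n S <= load n S'.
Proof.
move=> SS; rewrite /load big_mkcond [leRHS]big_mkcond; apply: ler_sum => i _.
case: ifPn => [/(meets_sub SS) -> //|_].
by case: ifP => // _; exact: powR_ge0.
Qed.

Lemma load_le_sub S S' v v' : S `<=` S' -> v' <= v -> load_le S' v' -> load_le S v.
Proof. by move=> SS vv h n; apply: le_trans (load_sub n SS) (le_trans (h n) vv). Qed.

Lemma load_le_mem S v i : load_le S v -> meets i S -> r i `^ t <= v.
Proof.
move=> /(_ i.+1) h iS; apply: le_trans h; rewrite /load.
rewrite big_mkcond big_ord_recr /= iS lerDr sumr_ge0 // => j _.
by case: ifP => // _; exact: powR_ge0.
Qed.

(** A pigeonhole over all partial sums at once: the finitely many counterexamples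
    occur below a common order. *)
Lemma load_pigeon (T : eqType) (F : seq T) (L : T -> set R) (g : T -> R) v :
  (forall n, \sum_(b <- F) load n (L b) <= v) -> v < \sum_(b <- F) g b ->
  exists2 b, b \in F & load_le (L b) (g b).
Proof.
move=> hv hg; apply: contrapT => h.
have {}h b : exists n, b \in F -> g b < load n (L b).
  have [bF|bF] := boolP (b \in F); last by exists 0%N.
  apply: contrapT => hn; apply: h; exists b => // n; rewrite leNgt.
  by apply/negP => hb; apply: hn; exists n.
have {h}[n hn] := choice h.
pose N := \max_(b <- F) n b.
have := lt_le_trans hg (_ : \sum_(b <- F) g b <= \sum_(b <- F) load N (L b)).
rewrite ltNge hv => /(_ _)/negP; apply=> //.
rewrite big_seq [leRHS]big_seq; apply: ler_sum => b bF.
apply: le_trans (ltW (hn b bF)) _; apply: load_mono.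
exact: (@leq_bigmax_seq _ F xpredT n).
Qed.

Lemma sum_load_disjoint (T : eqType) (F : seq T) (L : T -> set R) S n :
  uniq F -> (forall b, b \in F -> L b `<=` S) ->
  (forall i b b', b \in F -> b' \in F -> meets i (L b) -> meets i (L b') -> b = b') ->
  \sum_(b <- F) load n (L b) <= load n S.
Proof.
move=> uF LS dis; rewrite /load; under eq_bigr do rewrite big_mkcond.
rewrite exchange_big /= [leRHS]big_mkcond; apply: ler_sum => i _.
have [/hasP[b bF ib]|nb] := boolP (has (fun b => meets i (L b)) F).
  rewrite (bigD1_seq b) //= ib (meets_sub (LS b bF) ib) big_seq_cond big1 ?addr0 //.
  move=> b' /andP[b'F bb']; case: ifP => // ib'.
  by rewrite (dis i b b' bF b'F ib ib') eqxx in bb'.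
rewrite big_seq big1 => [|b bF]; first by case: ifP => // _; exact: powR_ge0.
by rewrite (negbTE (hasPn nb b bF)).
Qed.

Hypothesis t01 : 0 < t < 1.
Hypothesis r0 : forall i, 0 < r i.
Hypothesis Ur : forall i x y, U i x -> U i y -> `|x - y| <= r i.

Let hits (L : nat -> set R) N i := [seq k <- iota 0 N | meets i (L k)].

Let hits_bound L N c i : 0 < c ->
  (forall k l x y, (k < l < N)%N -> L k x -> L l y ->
     (l%:R - k%:R) * c <= `|x - y|) ->
  (1 < size (hits L N i))%N -> (size (hits L N i))%:R * c <= 2 * r i.
Proof.
move=> c0 sep sz.
have [k0 hk0] : exists k, k \in hits L N i.
  by case: (hits L N i) sz => // k s _; exists k; exact: mem_head.
have exk : exists k, k \in hits L N i by exists k0.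
have bk k : k \in hits L N i -> (k <= N)%N.
  by rewrite mem_filter mem_iota add0n => /and3P[_ _ /ltnW].
case: (ex_minnP exk) => a ha mina; case: (ex_maxnP exk bk) => b hb maxb.
have sub : {subset hits L N i <= iota a (b - a).+1}.
  move=> k hk; rewrite mem_iota (mina k hk) /= addnS ltnS subnKC ?(maxb k hk) //.
  exact: leq_trans (mina k hk) (maxb k hk).
have := uniq_leq_size (filter_uniq _ (iota_uniq 0 N)) sub.
rewrite size_iota => szb.
have ab : (a < b)%N by have := leq_trans sz szb; rewrite ltnS subn_gt0.
move: ha hb; rewrite !mem_filter !mem_iota !add0n.
move=> /andP[/meets_setP[x [Ux Lx]] _] /andP[/meets_setP[y [Uy Ly]] /andP[_ bN]].
have abN : (a < b < N)%N by rewrite ab.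
have h := le_trans (sep a b x y abN Lx Ly) (Ur Ux Uy).
apply: le_trans (ler_wpM2l _ h) => //; rewrite mulrA ler_wpM2r ?(ltW c0) //.
rewrite -(natrB _ (ltnW ab)) -natrM ler_nat; apply: leq_trans szb _.
by move: ab; clear; lia.
Qed.

(** Sets large enough to meet several of N separated targets meet at most half
    of the targets; the load of S is shared between the others. *)
Lemma load_spread (L : nat -> set R) S N c v : (0 < N)%N -> 0 < c -> 0 < v ->
  (forall k, (k < N)%N -> L k `<=` S) ->
  (forall k l x y, (k < l < N)%N -> L k x -> L l y ->
     (l%:R - k%:R) * c <= `|x - y|) ->
  load_le S v -> v <= (N%:R * c) `^ t / 4 ->
  exists2 k, (k < N)%N & load_le (L k) (4 * v / N%:R).
Proof.
move=> N0 c0 v0 LS sep Sv hv.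
have [t0 t1] := andP t01.
have N0' : 0 < N%:R :> R by rewrite ltr0n.
pose multi i := (1 < size (hits L N i))%N.
pose bad k : bool := `[< exists i, meets i (L k) && multi i >].
pose F := [seq k <- iota 0 N | ~~ bad k].
have few : (size [seq k <- iota 0 N | bad k])%:R <= N%:R / 2 :> R.
  have wit k : exists i, bad k -> meets i (L k) && multi i.
    have [/asboolP[i hi]|nb] := boolP (bad k); first by exists i.
    by exists 0%N.
  have {wit}[w hw] := choice wit.
  pose n := \max_(k <- iota 0 N) (w k).+1.
  apply: (@le_trans _ _ (\sum_(i < n | multi i) (size (hits L N i))%:R)).
    rewrite size_filter -sum1_count natr_sum.
    apply: (@le_trans _ _ (\sum_(k <- iota 0 N)
        \sum_(i < n | multi i) (meets i (L k))%:R)); last first.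
      rewrite exchange_big; apply: ler_sum => i _.
      rewrite size_filter -sum1_count natr_sum [leRHS]big_mkcond.
      by apply: ler_sum => k _; case: ifP.
    rewrite big_mkcond big_seq [leRHS]big_seq; apply: ler_sum => k kN.
    case: ifP => [bk|_]; last by rewrite sumr_ge0.
    have /andP[mk multk] := hw k bk.
    have wn : (w k < n)%N by exact: (@leq_bigmax_seq _ _ xpredT (fun k => (w k).+1)).
    by rewrite (bigD1 (Ordinal wn)) //= mk lerDl sumr_ge0.
  apply: (@le_trans _ _ (\sum_(i < n | multi i)
      N%:R `^ (1 - t) * (2 / c) `^ t * r i `^ t)).
    apply: ler_sum => i mi; have hi := hits_bound c0 sep mi.
    set s := (size (hits L N i))%:R : R in hi *.
    have s0 : 0 < s by rewrite /s ltr0n (ltn_trans _ mi).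
    have sN : s <= N%:R.
      by rewrite /s ler_nat size_filter -[leqRHS](size_iota 0 N) count_size.
    have -> : s = s `^ (1 - t) * s `^ t.
      by rewrite -powRDpos // subrK powRr1 // ltW.
    rewrite -mulrA; apply: ler_pM; rewrite ?powR_ge0 //.
      by apply: powR_le_base; rewrite ?(ltW s0) //; lra.
    rewrite -powRM ?divr_ge0 ?(ltW c0) ?(ltW (r0 i)) //.
    apply: powR_le_base; rewrite ?(ltW t0) ?(ltW s0) //.
    by rewrite mulrAC ler_pdivlMr.
  rewrite -mulr_sumr.
  have lv : \sum_(i < n | multi i) r i `^ t <= v.
    apply: le_trans (Sv n); rewrite /load big_mkcond [leRHS]big_mkcond.
    apply: ler_sum => i _; case: ifP => [mi|_]; last first.
      by case: ifP => // _; exact: powR_ge0.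
    suff -> : meets i S by [].
    have : (0 < size (hits L N i))%N by exact: ltn_trans mi.
    rewrite -has_predT => /hasP[k]; rewrite mem_filter mem_iota add0n.
    by move=> /andP[mk /andP[_ kN]] _; exact: meets_sub (LS k kN) mk.
  apply: (@le_trans _ _ (N%:R `^ (1 - t) * (2 / c) `^ t * ((N%:R * c) `^ t / 4))).
    by rewrite ler_wpM2l ?mulr_ge0 ?powR_ge0 // (le_trans lv).
  rewrite !powRM ?invr_ge0 ?(ltW c0) ?(ltW N0') // (powR_inv _ (ltW c0)) powRN.
  have -> : N%:R `^ (1 - t) * (2 `^ t / c `^ t) * (N%:R `^ t * c `^ t / 4) =
    N%:R `^ (1 - t) * N%:R `^ t * (2 `^ t / 4).
    by field; rewrite gt_eqF // powR_gt0.
  rewrite -powRDpos // subrK powRr1 ?(ltW N0') // ler_wpM2l ?(ltW N0') //.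
  have : 2 `^ t <= 2 :> R by rewrite -[leRHS]powRr1 //; apply: ler_powR => //; lra.
  lra.
have many : N%:R / 2 <= (size F)%:R :> R.
  have : (size F + size [seq k <- iota 0 N | bad k])%N = N.
    by rewrite /F !size_filter addnC count_predC size_iota.
  move=> /(congr1 (fun n => n%:R : R)); rewrite natrD; lra.
have [k kF hk] : exists2 k, k \in F & load_le (L k) (4 * v / N%:R).
  apply: (@load_pigeon _ F L (fun=> 4 * v / N%:R) v) => [n|].
    apply: le_trans (Sv n); apply: sum_load_disjoint.
    - exact: filter_uniq (iota_uniq _ _).
    - by move=> k; rewrite mem_filter mem_iota add0n => /and3P[_ _ /LS].
    move=> i k l; rewrite !mem_filter !mem_iota !add0n.
    move=> /and3P[nk _ kN] /and3P[nl _ lN] ik il; apply/eqP; apply: contraNT nk => kl.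
    apply/asboolP; exists i; rewrite ik /multi /=.
    have : uniq [:: k; l] by rewrite /= inE kl.
    move=> /uniq_leq_size h; apply: (h (hits L N i)) => j.
    by rewrite !inE mem_filter mem_iota add0n => /orP[]/eqP->; rewrite ?ik ?il.
  rewrite big_const_seq count_predT iter_addr_0 -(mulr_natr (_ / _)).
  apply: (@lt_le_trans _ _ (4 * v / N%:R * (N%:R / 2))).
    have -> : 4 * v / N%:R * (N%:R / 2) = 2 * v by field; rewrite gt_eqF.
    lra.
  by rewrite ler_wpM2l // divr_ge0 ?(ltW N0') //; lra.
by exists k => //; move: kF; rewrite mem_filter mem_iota add0n => /and3P[].
Qed.
End Load.

(** * Runs of cylinders inside an interval *)

Section Runs.
Variable R : realType.
Implicit Types (a b v y alpha beta : R) (k N : nat).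
Local Notation q w := ((cf_denom w)%:R : R).

(** The last clause compares b - a with the total length of the N cylinders u k,
    each of which has length about 1/(k0 q(u))^2. *)
Definition run_inside (C a b : R) (u : seq nat) (k0 N : nat) : Prop :=
  [/\ pos_word u, (0 < N <= k0)%N,
      forall k y, (k0 <= k < k0 + N)%N -> 0 <= y <= 1 ->
        a <= cf (rcons u k) y <= b
    & b - a <= C * (N%:R / (k0%:R ^+ 2 * q u ^+ 2))].

Lemma ceil_inv b : 0 < b <= 1 -> exists k, [/\ (0 < k)%N, k%:R^-1 <= b &
  forall l, (0 < l < k)%N -> b < l%:R^-1].
Proof.
move=> /andP[b0 b1].
have ex : exists k, (0 < k)%N && (k%:R^-1 <= b).
  exists (Num.truncn b^-1).+1 => /=.
  have bi : 0 <= b^-1 by rewrite invr_ge0 ltW.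
  have /andP[_ h] := truncn_itv bi.
  by rewrite -[leRHS]invrK lef_pV2 ?posrE ?invr_gt0 // ltW.
case: (ex_minnP ex) => k /andP[k0 kb] mink; exists k; split => // l /andP[l0 lk].
rewrite ltNge; apply/negP => lb; have := mink l; rewrite l0 lb => /(_ isT).
by rewrite leqNgt lk.
Qed.

(** The cylinders of the digits k >= k0 fill ]0, 1/k0], and 1/k0 is comparable
    to v. *)
Lemma run_near0 v : 0 < v < 1 -> exists k0, [/\ (0 < k0)%N,
  forall k y, (k0 <= k)%N -> 0 <= y -> (k%:R + y)^-1 <= v & v <= 2 / k0%:R].
Proof.
move=> /andP[v0 v1]; have v01 : 0 < v <= 1 by rewrite v0 ltW.
have [k [k0 kv hk]] := ceil_inv v01; exists k; split => //.
  move=> l y kl y0; apply: le_trans kv; have k1 : 1 <= k%:R :> R by rewrite ler1n.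
  have : k%:R <= l%:R :> R by rewrite ler_nat.
  by move=> ?; rewrite lef_pV2 ?posrE; lra.
case: k k0 kv hk => [//|[|k]] _ kv hk; first by rewrite divr1; lra.
have /hk h : (0 < k.+1 < k.+2)%N by rewrite /=.
apply: le_trans (ltW h) _; rewrite ler_pdivlMr // mulrC ler_pdivrMr //.
by rewrite -natrM ler_nat; clear; lia.
Qed.

Lemma branch_dist_le a b (j : nat) : (0 < j)%N -> 0 <= a <= b ->
  (j%:R + a)^-1 - (j%:R + b)^-1 = (b - a) / ((j%:R + a) * (j%:R + b)).
Proof.
move=> j0 /andP[a0 ab]; have j1 : 1 <= j%:R :> R by rewrite ler1n.
by field; rewrite !gt_eqF //; lra.
Qed.

Lemma branch_anti a b (j : nat) : (0 < j)%N -> 0 <= a <= b ->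
  (j%:R + b)^-1 <= (j%:R + a)^-1.
Proof.
move=> j0 /andP[a0 ab]; have j1 : 1 <= j%:R :> R by rewrite ler1n.
by rewrite lef_pV2 ?posrE; lra.
Qed.

Lemma branch_inv a (j : nat) : (0 < j)%N -> 0 < a -> a <= j%:R^-1 ->
  (j.+1%:R)^-1 <= a ->
  exists2 v : R, 0 <= v <= 1 & a = (j%:R + v)^-1.
Proof.
move=> j0 a0 aj ja; exists (a^-1 - j%:R); last by rewrite addrC subrK invrK.
have j0' : 0 < j%:R :> R by rewrite ltr0n.
have h1 : j%:R <= a^-1 by rewrite -[leLHS]invrK lef_pV2 ?posrE ?invr_gt0.
have h2 : a^-1 <= j%:R + 1.
  by rewrite natr1 -[leRHS]invrK lef_pV2 ?posrE ?invr_gt0.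
by apply/andP; split; lra.
Qed.

(** Either all the digits from j to 2j - 1 fit, or the run stops at the last digit
    e with 1/e >= a. *)
Lemma run_wide a b (j : nat) : 0 <= a < b -> b <= 1 -> (0 < j)%N ->
  j%:R^-1 <= b -> (forall l, (0 < l < j)%N -> b < l%:R^-1) ->
  a <= j.+1%:R^-1 -> exists N, run_inside 6 a b [::] j N.
Proof.
move=> /andP[a0 ab] b1 j0 jb hj aj.
have j0' : 0 < j%:R :> R by rewrite ltr0n.
have b2 : b <= 2 / j%:R.
  case: j j0 jb hj aj j0' => [//|[|j]] _ jb hj aj j0'; first by lra.
  have /hj h : (0 < j.+1 < j.+2)%N by rewrite /=.
  apply: le_trans (ltW h) _; rewrite ler_pdivlMr // mulrC ler_pdivrMr //.
  by rewrite -natrM ler_nat; clear; lia.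
have inside e k y : (0 < e)%N -> a <= e%:R^-1 -> (j <= k)%N -> (k < e)%N ->
    0 <= y <= 1 -> a <= (k%:R + y)^-1 <= b.
  move=> e0 ae jk ke /andP[y0 y1]; have e0' : 0 < e%:R :> R by rewrite ltr0n.
  have jk' : j%:R <= k%:R :> R by rewrite ler_nat.
  have ke' : k%:R + 1 <= e%:R :> R by rewrite natr1 ler_nat.
  apply/andP; split.
    by apply: (le_trans ae); rewrite lef_pV2 ?posrE; lra.
  by apply: le_trans jb; rewrite lef_pV2 ?posrE; lra.
have q1 : q [::] = 1 by [].
have [a2|a2] := leP a (2 * j)%:R^-1.
  exists j; split => //; first by rewrite j0 leqnn.
    move=> k y /andP[jk kj] y01 /=; apply: (inside (2 * j)%N) => //.
      by rewrite muln_gt0.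
    by rewrite mul2n -addnn.
  rewrite q1 expr1n mulr1.
  have -> : 6 * (j%:R / j%:R ^+ 2) = 6 / j%:R :> R by field; rewrite gt_eqF.
  have : 2 / j%:R <= 6 / j%:R :> R by rewrite ler_wpM2r ?invr_ge0 ?(ltW j0') //; lra.
  lra.
have a0' : 0 < a by apply: le_lt_trans a2; rewrite invr_ge0.
have ai0 : 0 <= a^-1 by rewrite invr_ge0.
have /andP[e1 e2] := truncn_itv ai0.
set e := Num.truncn a^-1 in e1 e2.
have je : (j.+1 <= e)%N.
  rewrite -ltnS -(ltr_nat R); apply: le_lt_trans e2.
  by rewrite -[leLHS]invrK lef_pV2 ?posrE ?invr_gt0.
have e2j : (e < 2 * j)%N.
  rewrite -(ltr_nat R); apply: (le_lt_trans e1).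
  by rewrite -[ltRHS]invrK ltf_pV2 ?posrE ?invr_gt0 // ltr0n muln_gt0.
exists (e - j)%N; split => //.
- by move: je e2j; clear; lia.
- move=> k y /andP[jk kj] y01 /=; apply: (inside e) => //.
  + by rewrite (leq_trans _ je).
  + by rewrite -[leLHS]invrK lef_pV2 ?posrE ?invr_gt0 // ltr0n (leq_trans _ je).
  + by move: kj je; clear; lia.
rewrite q1 expr1n mulr1.
have j2 : (1 < j)%N by move: je e2j; clear; lia.
have /hj h : (0 < j.-1 < j)%N by move: j2; clear; lia.
have ea : e.+1%:R^-1 <= a by rewrite -[leRHS]invrK lef_pV2 ?posrE ?invr_gt0 // ltW.
have jP : j.-1%:R = j%:R - 1 :> R by rewrite -subn1 natrB.
rewrite jP in h; rewrite -natr1 in ea; rewrite natrB; last by rewrite ltnW.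
have je' : j%:R + 1 <= e%:R :> R by rewrite natr1 ler_nat.
have j2' : 2 <= j%:R :> R by rewrite ler_nat.
move: h ea je' j2'; move: (e%:R : R) (j%:R : R) => {e1 e2 je e2j inside a2 hj jb aj b2 j0' jP} E J h ea EJ J2.
apply: (@le_trans _ _ ((J - 1)^-1 - (E + 1)^-1)); first lra.
have -> : (J - 1)^-1 - (E + 1)^-1 = (E - J + 2) / ((J - 1) * (E + 1)).
  by field; apply/andP; split; rewrite gt_eqF //; lra.
have -> : 6 * ((E - J) / J ^+ 2) = 3 * (E - J) * (2 / J ^+ 2) by ring.
apply: ler_pM; try lra.
  by rewrite invr_ge0 mulr_ge0 //; lra.
have J20 : 0 < J ^+ 2 by rewrite exprn_gt0 //; lra.
rewrite ler_pdivlMr // mulrC ler_pdivrMr; last by rewrite mulr_gt0 //; lra.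
by rewrite expr2; nra.
Qed.

(** The interval straddles 1/j and extends more to its left. In the coordinate of
    the digit j the left part starts at 0. *)
Lemma run_left a b (j : nat) : 1 / 2 * (b - a) <= j%:R^-1 - a -> (0 < j)%N ->
  j.+1%:R^-1 < a -> a < j%:R^-1 -> j%:R^-1 <= b ->
  exists u k0 N, run_inside 12 a b u k0 N.
Proof.
move=> half j0 ja aj jb.
have j0' : 0 < j%:R :> R by rewrite ltr0n.
have a0 : 0 < a by apply: lt_trans ja; rewrite invr_gt0.
have [v v01 aE] := branch_inv j0 a0 (ltW aj) (ltW ja).
have v0 : v != 0 by apply: contraTneq aj => v0; rewrite aE v0 addr0 ltxx.
have v1 : v != 1.
  by apply: contraTneq ja => v1; rewrite aE v1 natr1 ltxx.
have v01' : 0 < v < 1.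
  by case/andP: v01 => h1 h2; rewrite !lt_neqAle h1 h2 v1 eq_sym v0.
have [k0 [k00 run vk]] := run_near0 v01'.
have qj : q [:: j] = j%:R by rewrite /cf_denom /= muln1 addn0.
exists [:: j], k0, k0; split.
- by rewrite /pos_word /= j0.
- by rewrite k00 leqnn.
- move=> k y /andP[kk _] /andP[y0 y1] /=.
  have k1 : 0 < k%:R :> R by rewrite ltr0n (leq_trans k00).
  have w0 : 0 <= (k%:R + y)^-1 by rewrite invr_ge0; lra.
  have wv := run k y kk y0.
  rewrite aE; apply/andP; split; first by apply: branch_anti => //; rewrite w0.
  apply: le_trans jb; rewrite -[j%:R in leRHS]addr0.
  by apply: branch_anti => //; rewrite lexx.
rewrite qj.
have e : j%:R^-1 - a = v / (j%:R * (j%:R + v)).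
  by rewrite aE -{1}[j%:R]addr0 branch_dist_le ?lexx ?subr0 ?addr0 //; lra.
have k0' : 0 < k0%:R :> R by rewrite ltr0n.
have -> : 12 * (k0%:R / (k0%:R ^+ 2 * j%:R ^+ 2)) = 12 / k0%:R / j%:R ^+ 2 :> R.
  by field; rewrite !gt_eqF.
have h : v / (j%:R * (j%:R + v)) <= 2 / k0%:R / j%:R ^+ 2.
  apply: ler_pM => //; try lra.
    by rewrite invr_ge0 mulr_ge0 //; lra.
  rewrite lef_pV2 ?posrE ?mulr_gt0 ?exprn_gt0 //; try lra.
  by rewrite expr2 ler_wpM2l //; lra.
have P0 : 0 <= k0%:R^-1 / j%:R ^+ 2 :> R.
  by rewrite mulr_ge0 ?invr_ge0 ?exprn_ge0.
rewrite e in half; move: (le_trans half h) P0; rewrite -!mulrA.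
by move: (k0%:R^-1 * _) => I; lra.
Qed.

(** In the coordinate of the digit j the right part ends at 1; it contains the
    cylinder of the digit 1, or becomes an interval [0, x] after that digit. *)
Lemma run_right a b (j : nat) : 1 / 2 * (b - a) <= b - j.+1%:R^-1 -> (0 < j)%N ->
  j.+1%:R^-1 < b -> b < j%:R^-1 -> a <= j.+1%:R^-1 ->
  exists u k0 N, run_inside 12 a b u k0 N.
Proof.
move=> half j0 jb bj ja.
have j0' : 0 < j%:R :> R by rewrite ltr0n.
have j1' : 1 <= j%:R :> R by rewrite ler1n.
have b0 : 0 < b by apply: lt_trans jb; rewrite invr_gt0.
have [v v01 bE] := branch_inv j0 b0 (ltW bj) (ltW jb).
have v0 : v != 0 by apply: contraTneq bj => v0; rewrite bE v0 addr0 ltxx.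
have v1 : v != 1.
  by apply: contraTneq jb => v1; rewrite bE v1 natr1 ltxx.
have v01' : 0 < v < 1.
  by case/andP: v01 => h1 h2; rewrite !lt_neqAle h1 h2 v1 eq_sym v0.
have jE : j.+1%:R = j%:R + 1 :> R by rewrite natr1.
have e : b - j.+1%:R^-1 = (1 - v) / ((j%:R + v) * (j%:R + 1)).
  by rewrite bE jE branch_dist_le //; lra.
have inside (w : R) : v <= w <= 1 -> a <= (j%:R + w)^-1 <= b.
  move=> /andP[vw w1]; rewrite bE; apply/andP; split.
    by apply: (le_trans ja); rewrite jE; apply: branch_anti => //; lra.
  by apply: branch_anti => //; lra.
have [v2|v2] := leP v (1 / 2).
  exists [:: j], 1%N, 1%N; split => //.
  - by rewrite /pos_word /= j0.
  - move=> k y /andP[k1 k2] /andP[y0 y1] /=; apply: inside.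
    have -> : k = 1%N by move: k1 k2; clear; lia.
    apply/andP; split.
      by apply: (le_trans v2); rewrite div1r lef_pV2 ?posrE; lra.
    by rewrite invf_le1; lra.
  have -> : q [:: j] = j%:R by rewrite /cf_denom /= muln1 addn0.
  rewrite expr1n mul1r div1r.
  have h : (1 - v) / ((j%:R + v) * (j%:R + 1)) <= 1 * (j%:R ^+ 2)^-1.
    apply: ler_pM => //; try lra.
      by rewrite invr_ge0 mulr_ge0 //; lra.
    rewrite lef_pV2 ?posrE ?mulr_gt0 ?exprn_gt0 //; try lra.
    by rewrite expr2 ler_pM //; lra.
  have P0 : 0 <= (j%:R ^+ 2)^-1 :> R by rewrite invr_ge0 exprn_ge0.
  rewrite e in half; move: (le_trans half h) P0.
  by move: ((j%:R ^+ 2)^-1) => I; lra.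
have vE : v = (1%:R + (v^-1 - 1))^-1 by rewrite addrC subrK invrK.
set x := v^-1 - 1 in vE.
have x01 : 0 < x < 1.
  apply/andP; split; rewrite /x.
    by rewrite subr_gt0 invf_gt1; lra.
  have v0' : 0 < v by case/andP: v01'.
  by rewrite ltrBlDr -(ltr_pM2r v0') mulVf //; lra.
have [k0 [k00 run xk]] := run_near0 x01.
have x0 : 0 < x by case/andP: x01.
exists [:: j; 1%N], k0, k0; split.
- by rewrite /pos_word /= j0.
- by rewrite k00 leqnn.
- move=> k y /andP[kk _] /andP[y0 y1] /=.
  have k1 : 0 < k%:R :> R by rewrite ltr0n (leq_trans k00).
  have w0 : 0 <= (k%:R + y)^-1 by rewrite invr_ge0; lra.
  have wx := run k y kk y0.
  apply: inside; apply/andP; split.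
    by rewrite vE; apply: branch_anti => //; rewrite w0.
  by rewrite invf_le1; lra.
have -> : q [:: j; 1%N] = j%:R + 1.
  by rewrite /cf_denom /= muln1 addn0 mul1n natrD.
have k0' : 0 < k0%:R :> R by rewrite ltr0n.
have -> : 12 * (k0%:R / (k0%:R ^+ 2 * (j%:R + 1) ^+ 2)) = 12 / k0%:R / (j%:R + 1) ^+ 2 :> R.
  by field; rewrite !gt_eqF //; lra.
have vx : 1 - v <= x.
  have -> : 1 - v = x * v by rewrite /x mulrBl mulVf // mul1r.
  by rewrite ler_piMr; lra.
have h : (1 - v) / ((j%:R + v) * (j%:R + 1)) <= 2 / k0%:R * (2 / (j%:R + 1) ^+ 2).
  apply: ler_pM; try lra.
    by rewrite invr_ge0 mulr_ge0 //; lra.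
  have J2 : 0 < (j%:R + 1) ^+ 2 :> R by rewrite exprn_gt0 //; lra.
  rewrite (ler_pdivlMr _ _ J2) mulrC ler_pdivrMr; last by rewrite mulr_gt0; lra.
  by rewrite expr2 mulrA ler_wpM2r //; lra.
have P0 : 0 <= k0%:R^-1 / (j%:R + 1) ^+ 2 :> R.
  by rewrite mulr_ge0 ?invr_ge0 ?exprn_ge0 //; lra.
have -> : 12 / k0%:R / (j%:R + 1) ^+ 2 = 12 * (k0%:R^-1 / (j%:R + 1) ^+ 2) :> R.
  by rewrite !mulrA.
have h' : 2 / k0%:R * (2 / (j%:R + 1) ^+ 2) = 4 * (k0%:R^-1 / (j%:R + 1) ^+ 2) :> R.
  by ring.
rewrite e in half; rewrite h' in h; move: (le_trans half h) P0.
by move: (k0%:R^-1 / _) => I; lra.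
Qed.

(** An interval which no digit cylinder contains. *)
Lemma run_local a b : 0 <= a < b -> b <= 1 ->
  (forall j, (0 < j)%N -> ~ (j.+1%:R^-1 <= a /\ b <= j%:R^-1)) ->
  exists u k0 N, run_inside 12 a b u k0 N.
Proof.
move=> /andP[a0 ab] b1 nc.
have b01 : 0 < b <= 1 by apply/andP; split; lra.
have [j [j0 jb hj]] := ceil_inv b01.
have aj : a < j%:R^-1.
  rewrite ltNge; apply/negP => ja.
  case: j j0 jb hj ja => [//|[|j]] _ jb hj ja; first by rewrite invr1 in ja; lra.
  have /hj h : (0 < j.+1 < j.+2)%N by rewrite /=.
  by apply: (nc j.+1) => //; split => //; exact: ltW.
have [aj1|ja1] := leP a j.+1%:R^-1.
  have ab' : 0 <= a < b by rewrite a0.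
  have [N [h1 h2 h3 h4]] := run_wide ab' b1 j0 jb hj aj1.
  exists [::], j, N; split => //; apply: (le_trans h4).
  by rewrite ler_wpM2r ?divr_ge0 ?mulr_ge0 ?exprn_ge0 //; lra.
have [half|half] := leP (1 / 2 * (b - a)) (j%:R^-1 - a).
  exact: run_left half j0 ja1 aj jb.
case: j j0 jb hj aj ja1 half => [//|[|j]] _ jb hj aj ja1 half.
  rewrite invr1 in jb half; lra.
have bj : b < j.+1%:R^-1 by apply: hj; rewrite /=.
apply: (@run_right a b j.+1) => //; last exact: ltW.
  by move: half; move: (j.+2%:R^-1 : R) => p; lra.
rewrite lt_neqAle jb andbT; apply: contraTneq half => <-; rewrite -leNgt.
by move: (j.+2%:R^-1 : R) aj => p; lra.
Qed.

(** Descending along the cylinders that contain the interval until no further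
    digit is determined. *)
Lemma run_exists alpha beta : 0 <= alpha < beta -> beta <= 1 ->
  exists u k0 N, run_inside 48 alpha beta u k0 N.
Proof.
move=> /andP[al0 ab] b1.
pose P n := exists u a b, [/\ word n u, 0 <= a < b, b <= 1 &
  (cf u a = alpha /\ cf u b = beta) \/ (cf u a = beta /\ cf u b = alpha)].
have bound n : P n -> (n <= Num.truncn (beta - alpha)^-1)%N.
  move=> [u [a [b [/andP[/eqP su pu] /andP[a0 a1] b1' e]]]].
  have q1 := q_ge1 R pu.
  have d : beta - alpha <= (q u)^-1.
    have : beta - alpha = `|cf u a - cf u b|.
      by case: e => -[-> ->]; [rewrite ler0_norm|rewrite ger0_norm]; lra.
    move=> ->; apply: le_trans (cf_dist_le pu _ _) _ => //; first lra.
    rewrite -[leRHS]mul1r; apply: ler_pM; rewrite ?invr_ge0 ?exprn_ge0 //.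
      by rewrite ler_norml; lra.
    rewrite lef_pV2 ?posrE ?exprn_gt0; try lra.
    by rewrite expr2 ler_peMl //; lra.
  have ba : 0 < beta - alpha by lra.
  have bi : 0 <= (beta - alpha)^-1 by rewrite invr_ge0 ltW.
  rewrite -su truncn_ge_nat //.
  apply: (@le_trans _ _ (q u)); first by rewrite ler_nat size_le_cf_denom.
  by rewrite -[leLHS]invrK lef_pV2 ?posrE ?invr_gt0 //; lra.
have exP : exists n, `[< P n >].
  exists 0%N; apply/asboolP; exists [::], alpha, beta; split => //; last by left.
  by rewrite al0.
have boundP n : `[< P n >] -> (n <= Num.truncn (beta - alpha)^-1)%N.
  by move=> /asboolP/bound.
case: (ex_maxnP exP boundP) => n /asboolP[u [a [b [nu a01 b1' e]]]] maxn.
have pu := word_pos nu; have q1 := q_ge1 R pu.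
have /andP[a0 aLb] := a01.
have nc j : (0 < j)%N -> ~ (j.+1%:R^-1 <= a /\ b <= j%:R^-1).
  move=> j0 [ja bj].
  have i0 : 0 < j.+1%:R^-1 :> R by rewrite invr_gt0.
  have a0' : 0 < a := lt_le_trans i0 ja.
  have b0' : 0 < b := lt_trans a0' aLb.
  have [va va01 aE] := branch_inv j0 a0' (le_trans (ltW aLb) bj) ja.
  have [vb vb01 bE] := branch_inv j0 b0' bj (le_trans ja (ltW aLb)).
  have : P n.+1.
    exists (rcons u j), vb, va; split.
    - case/andP: nu => /eqP su _; rewrite /word size_rcons su eqxx.
      by rewrite pos_word_rcons j0.
    - apply/andP; split; first by case/andP: vb01.
      rewrite ltNge; apply/negP => vab.
      have : b <= a.
        by rewrite aE bE; apply: branch_anti => //; rewrite vab; case/andP: va01 => ->.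
      lra.
    - by case/andP: va01.
    by rewrite !cf_rcons -aE -bE; case: e => -[-> ->]; [right|left].
  by move=> /asboolP/maxn; rewrite ltnn.
have [u0 [k0 [N [pu0 Nk0 inside wide]]]] := run_local a01 b1' nc.
exists (u ++ u0), k0, N; split => //.
- by rewrite pos_word_cat pu.
- move=> k y kN y01; rewrite -cats1 -catA cats1 cf_cat.
  have h := inside k y kN y01.
  have a01' : 0 <= a <= 1 by lra.
  have b01' : 0 <= b <= 1 by lra.
  have h01 : 0 <= cf (rcons u0 k) y <= 1 by lra.
  have : between (cf u a) (cf u (cf (rcons u0 k) y)) (cf u b).
    by rewrite cf_between // /between h.
  by case: e => -[-> ->] /betweenP[] //; lra.
have q01 := q_ge1 R pu0.
have d : beta - alpha <= (b - a) / q u ^+ 2.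
  have -> : beta - alpha = `|cf u a - cf u b|.
    by case: e => -[-> ->]; [rewrite ler0_norm|rewrite ger0_norm]; lra.
  apply: le_trans (cf_dist_le pu _ _) _ => //; first lra.
  by rewrite ler0_norm ?opprB //; lra.
apply: (le_trans d); rewrite ler_pdivrMr ?exprn_gt0 //; last lra.
apply: (le_trans wide).
have qq : q (u ++ u0) <= 2 * (q u * q u0).
  by rewrite -natrM -natrM ler_nat cf_denom_cat.
have k00 : 0 < k0%:R :> R.
  by rewrite ltr0n; move: Nk0; clear; lia.
have qu0 : 0 < q (u ++ u0).
  by rewrite ltr0n cf_denom_gt0 // pos_word_cat pu.
have -> : 12 * (N%:R / (k0%:R ^+ 2 * q u0 ^+ 2)) =
   48 * (N%:R / k0%:R ^+ 2) * (q u ^+ 2 * ((2 * (q u * q u0)) ^+ 2)^-1).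
  by field; rewrite !gt_eqF //; lra.
have -> : 48 * (N%:R / (k0%:R ^+ 2 * q (u ++ u0) ^+ 2)) * q u ^+ 2 =
   48 * (N%:R / k0%:R ^+ 2) * (q u ^+ 2 * (q (u ++ u0) ^+ 2)^-1).
  by field; rewrite !gt_eqF //; lra.
rewrite ler_wpM2l ?mulr_ge0 ?invr_ge0 ?exprn_ge0 //.
rewrite ler_wpM2l ?exprn_ge0 // lef_pV2 ?posrE ?exprn_gt0 //.
  by rewrite ler_pXn2r ?nnegrE ?(ltW qu0) // (le_trans (ltW qu0)).
by rewrite !mulr_gt0 //; lra.
Qed.
End Runs.

(** * Descending through cylinders of small load *)

Section Descent.
Variable R : realType.
Implicit Types (y kappa V : R).
Local Notation q w := ((cf_denom w)%:R : R).

Definition cyl (w : seq nat) : set R := cf w @` [set y : R | 0 <= y <= 1].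

Lemma cyl_cat w v : pos_word v -> cyl (w ++ v) `<=` cyl w.
Proof.
move=> pv _ [y y01 <-]; rewrite cf_cat; exists (cf v y) => //.
exact: cf_itv.
Qed.

(** A trailing digit 2 keeps away from the end points of the cylinder. *)
Lemma digit2_itv y : 0 <= y <= 1 -> 1 / 3 <= (2%:R + y)^-1 <= 1 / 2.
Proof.
move=> /andP[y0 y1]; by rewrite !div1r !lef_pV2 ?posrE //; lra.
Qed.

Variables (t : R) (U : nat -> set R) (r : nat -> R).
Hypotheses (t01 : 0 < t < 1) (r0 : forall i, 0 < r i)
  (Ur : forall i x y, U i x -> U i y -> `|x - y| <= r i).
Local Notation load_le := (load_le t U r).
Local Notation Q w := (q w `^ (- (2 * t))).

Let t0 : 0 < t. Proof. by case/andP: t01. Qed.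
Let t1 : t < 1. Proof. by case/andP: t01. Qed.

Lemma Q_gt0 w : pos_word w -> 0 < Q w.
Proof. by move=> pw; rewrite powR_gt0 // ltr0n cf_denom_gt0. Qed.

Lemma Q_lower w (a c : R) : pos_word w -> 0 < a -> 1 <= c -> q w <= c * a ->
  a `^ (- (2 * t)) / c ^+ 2 <= Q w.
Proof.
move=> pw a0 c1 h; have c0 : 0 < c by lra.
apply: (@le_trans _ _ ((c * a) `^ (- (2 * t)))); last first.
  by apply: powRN_le_base => //; rewrite ?ltr0n ?cf_denom_gt0 // mulr_ge0 // ltW.
rewrite powRM ?(ltW c0) ?(ltW a0) // mulrC ler_wpM2r ?powR_ge0 //.
rewrite powRN lef_pV2 ?posrE ?powR_gt0 ?exprn_gt0 //.
by rewrite -powR_mulrn ?(ltW c0) //; apply: ler_powR => //; move: t1; lra.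
Qed.

Lemma Q_rcons w a : pos_word w -> (0 < a)%N -> Q w / a.+1%:R ^+ 2 <= Q (rcons w a).
Proof.
move=> pw a0; apply: Q_lower; rewrite ?pos_word_rcons ?a0 //.
- by rewrite ltr0n cf_denom_gt0.
- by rewrite ler1n.
- by rewrite -natrM ler_nat cf_denom_rcons_le.
Qed.

Section Blocks.
Variables (F : seq (seq nat)) (l : nat) (g d : R).
Hypotheses (uF : uniq F) (wF : forall b, b \in F -> size b = l /\ pos_word b).
Hypotheses (g0 : 0 < g)
  (sepF : forall v w x y, v \in F -> w \in F -> v != w ->
    1/3 <= x <= 1/2 -> 1/3 <= y <= 1/2 -> g <= `|cf v x - cf w y|).
Hypotheses (d01 : 0 < d <= 1)
  (FZ : 72 <= d ^+ l.+1 * \sum_(b <- F) q b `^ (- (2 * t))).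

(** One block: covering sets of small cost cannot meet two of the separated
    subcylinders, so the load is shared between them in proportion to Q. *)
Lemma block_step w kappa : pos_word w -> 0 < kappa < (g / 4) `^ t ->
  load_le (cyl w) (kappa * Q w) ->
  exists2 b, b \in F & load_le (cyl (w ++ rcons b 2))
    (kappa * d ^+ l.+1 * Q (w ++ rcons b 2)).
Proof.
move=> pw /andP[k0 kg] Lw.
have [d0 d1] := andP d01.
have qw1 := q_ge1 R pw; have Qw0 := Q_gt0 pw.
have dl : 0 < d ^+ l.+1 by rewrite exprn_gt0.
have two := digit2_itv.
apply: (@load_pigeon _ t U r _ F (fun b => cyl (w ++ rcons b 2))
  (fun b => kappa * d ^+ l.+1 * Q (w ++ rcons b 2)) (kappa * Q w)) => [n|].
  apply: le_trans (Lw n); apply: sum_load_disjoint => // [b bF|i b b' bF b'F].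
    by apply: cyl_cat; have [_ pb] := wF bF; rewrite pos_word_rcons.
  have [sb pb] := wF bF; have [sb' pb'] := wF b'F.
  move=> mb; have mw : meets U i (cyl w).
    by apply: meets_sub mb; apply: cyl_cat; rewrite pos_word_rcons.
  move=> mb'; move: mb mb'.
  move=> /meets_setP[x [Ux [y y01 xE]]] /meets_setP[x' [Uy [y' y'01 x'E]]].
  rewrite -xE in Ux; rewrite -x'E in Uy.
  apply/eqP; apply: contraT => bb.
  have ri : r i < g / (4 * q w ^+ 2).
    have gq : 0 <= g / (4 * q w ^+ 2) by rewrite divr_ge0 ?mulr_ge0 ?exprn_ge0 ?(ltW g0).
    rewrite ltNge; apply/negP => /(powR_le_base (ltW t0) gq).
    rewrite leNgt => /negP; apply; apply: le_lt_trans (load_le_mem Lw mw) _.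
    have -> : g / (4 * q w ^+ 2) = g / 4 * (q w ^+ 2)^-1.
      by field; rewrite gt_eqF //; lra.
    rewrite powRM ?divr_ge0 ?(ltW g0) ?invr_ge0 ?exprn_ge0 //.
    rewrite powR_inv ?exprn_ge0 // -(@powR_mulrn _ (q w)) // -powRrM.
    have -> : 2 * - t = - (2 * t) by ring.
    by rewrite ltr_pM2r.
  have := Ur Ux Uy; rewrite leNgt => /negP; case; apply: (lt_le_trans ri).
  rewrite !cf_cat !cf_rcons.
  apply: le_trans (cf_dist_ge pw (cf_itv pb _) (cf_itv pb' _)).
  - rewrite ler_wpM2r ?invr_ge0 ?mulr_ge0 ?exprn_ge0 //.
    by apply: sepF; rewrite ?two.
  - by have := two _ y01; lra.
  - by have := two _ y'01; lra.
(* 36 = 6^2 is the loss from comparing q (w b 2) with q w * q b; the remaining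
   factor 2 of 72 makes the pigeonhole strict. *)
apply: (@lt_le_trans _ _ (kappa * d ^+ l.+1 * (Q w / 36 * \sum_(b <- F) Q b))).
  have -> : kappa * d ^+ l.+1 * (Q w / 36 * \sum_(b <- F) Q b) =
    kappa * Q w * (d ^+ l.+1 * (\sum_(b <- F) Q b) / 36) by ring.
  by rewrite ltr_pMr ?mulr_gt0 //; move: FZ; lra.
rewrite -mulr_sumr ler_wpM2l ?mulr_ge0 ?(ltW k0) ?(ltW dl) //.
rewrite mulr_sumr big_seq [leRHS]big_seq; apply: ler_sum => b bF.
have [sb pb] := wF bF; have qb1 := q_ge1 R pb.
rewrite mulrAC -powRM //.
have -> : 36 = 6 ^+ 2 :> R by ring.
apply: Q_lower; rewrite ?mulr_gt0 ?ltr0n ?cf_denom_gt0 //.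
- by rewrite pos_word_cat pw pos_word_rcons.
- by lra.
- rewrite -!natrM ler_nat.
  have := cf_denom_cat pw (_ : pos_word (rcons b 2)).
  rewrite pos_word_rcons => /(_ pb) h; apply: (leq_trans h).
  apply: (@leq_trans (2 * (cf_denom w * (3 * cf_denom b)))).
    by rewrite !leq_mul2l cf_denom_rcons_le ?orbT.
  by rewrite (mulnCA (cf_denom w) 3) mulnA.
Qed.

Lemma blocks J w kappa : pos_word w -> 0 < kappa < (g / 4) `^ t ->
  load_le (cyl w) (kappa * Q w) ->
  exists v, [/\ pos_word v, size v = (J * l.+1)%N
    & load_le (cyl (w ++ v)) (kappa * d ^+ (J * l.+1) * Q (w ++ v))].
Proof.
have [d0 d1] := andP d01.
move=> pw kg Lw; elim: J => [|J [v [pv sv Lv]]].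
  by exists [::]; rewrite cats0 mul0n expr0 mulr1.
have [k0 kg'] := andP kg.
have [||b bF Lb] := @block_step (w ++ v) (kappa * d ^+ (J * l.+1)) _ _ Lv.
- by rewrite pos_word_cat pw.
- rewrite mulr_gt0 ?exprn_gt0 //=; apply: le_lt_trans kg'.
  by rewrite ler_piMr ?(ltW k0) // exprn_ile1 // ltW.
have [sb pb] := wF bF.
exists (v ++ rcons b 2); split.
- by rewrite pos_word_cat pv pos_word_rcons.
- by rewrite size_cat size_rcons sv sb mulSn addnC.
- by rewrite catA mulSn addnC exprD mulrA.
Qed.

Lemma filler m w kappa : pos_word w -> 0 <= kappa ->
  load_le (cyl w) (kappa * Q w) ->
  load_le (cyl (w ++ nseq m 1%N)) (kappa * 4 ^+ m * Q (w ++ nseq m 1%N)).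
Proof.
move=> pw k0 Lw; elim: m => [|m IH]; first by rewrite cats0 expr0 mulr1.
have pm : pos_word (w ++ nseq m 1%N).
  by rewrite pos_word_cat pw /pos_word all_nseq orbT.
have -> : w ++ nseq m.+1 1%N = rcons (w ++ nseq m 1%N) 1.
  by rewrite -cats1 -catA; congr (_ ++ _); rewrite cats1 -addn1 nseqD cats1.
apply: load_le_sub IH; first by rewrite -cats1; exact: cyl_cat.
rewrite exprSr -!mulrA ler_wpM2l // ler_wpM2l ?exprn_ge0 //.
have := Q_rcons pm (leqnn 1); set a := Q _; set b := Q _.
by rewrite ler_pdivrMr ?exprn_gt0 // => h; apply: (le_trans h); rewrite mulrC; lra.
Qed.

(** Blocks fill the length up to a remainder of at most l digits 1, which cost a
    bounded factor. *)
Lemma descend w kappa : pos_word w -> 0 < kappa < (g / 4) `^ t ->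
  load_le (cyl w) (kappa * Q w) ->
  exists2 C : R, 0 < C & forall n, (size w <= n)%N ->
    exists v, [/\ pos_word v, size (w ++ v) = n
      & load_le (cyl (w ++ v)) (C * d ^+ n * Q (w ++ v))].
Proof.
move=> pw kg Lw; have [d0 d1] := andP d01; have [k0 kg'] := andP kg.
exists (kappa * 4 ^+ l.+1 / d ^+ (size w + l.+1)) => [|n wn].
  by rewrite divr_gt0 ?mulr_gt0 ?exprn_gt0.
pose J := ((n - size w) %/ l.+1)%N; pose m := ((n - size w) %% l.+1)%N.
have [v [pv sv Lv]] := blocks J pw kg Lw.
have pwv : pos_word (w ++ v) by rewrite pos_word_cat pw.
have kJ : 0 <= kappa * d ^+ (J * l.+1) by rewrite mulr_ge0 ?exprn_ge0 // ltW.
have L := filler m pwv kJ Lv.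
have nE : (size w + (J * l.+1 + m) = n)%N by rewrite -divn_eq subnKC.
exists (v ++ nseq m 1%N); split.
- by rewrite pos_word_cat pv /pos_word all_nseq orbT.
- by rewrite !size_cat size_nseq sv.
rewrite catA; apply: load_le_sub L => //.
rewrite ler_wpM2r ?powR_ge0 //.
have ml : (m <= l.+1)%N by rewrite ltnW // ltn_pmod.
have h4 : 4 ^+ m <= 4 ^+ l.+1 :> R by rewrite ler_weXn2l //; lra.
have hd : d ^+ (J * l.+1) <= d ^+ n / d ^+ (size w + l.+1).
  rewrite ler_pdivlMr ?exprn_gt0 // -exprD.
  by rewrite ler_wiXn2l ?(ltW d0) // -nE; move: ml; clear; lia.
have -> : kappa * 4 ^+ l.+1 / d ^+ (size w + l.+1) * d ^+ n =
  kappa * (d ^+ n / d ^+ (size w + l.+1)) * 4 ^+ l.+1 by ring.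
by apply: ler_pM; rewrite ?exprn_ge0 // ler_wpM2l // ltW.
Qed.
End Blocks.

(** The targets in the cylinders of the digits k0, .., k0 + N - 1 below w are
    separated by about 1/(k0 q(w))^2. *)
Lemma spread_digits w (al be : R) k0 N S V : pos_word w ->
  0 <= al <= be -> be <= 1 -> be - al <= 1 / 2 -> (0 < N <= k0)%N ->
  (forall k, (k0 <= k < k0 + N)%N ->
     cf (rcons w k) @` [set y : R | al <= y <= be] `<=` S) ->
  0 < V -> V <= (N%:R / (32 * k0%:R ^+ 2 * q w ^+ 2)) `^ t / 4 ->
  load_le S V ->
  exists2 k, (k0 <= k < k0 + N)%N &
    load_le (cf (rcons w k) @` [set y : R | al <= y <= be]) (4 * V / N%:R).
Proof.
move=> pw /andP[al0 ab] b1 short /andP[N0 Nk] sub V0 hV SV.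
have k00 : 0 < k0%:R :> R by rewrite ltr0n (leq_trans N0).
have qw1 := q_ge1 R pw.
pose c : R := (32 * k0%:R ^+ 2 * q w ^+ 2)^-1.
have c0 : 0 < c by rewrite invr_gt0 !mulr_gt0 ?exprn_gt0 //; lra.
have [|||k kN Lk] := @load_spread _ t U r t01 r0 Ur
    (fun i => cf (rcons w (k0 + i)) @` [set y : R | al <= y <= be]) S N c V N0 c0 V0 _ _ SV _.
- by move=> i iN; apply: sub; rewrite leq_addr ltn_add2l.
- move=> i j x x' /andP[ij jN] [y /andP[y0 y1] <-] [y' /andP[y'0 y'1] <-].
  have p (u : R) : al <= u -> u <= be -> 0 <= u <= 1 by move=> ? ?; apply/andP; split; lra.
  have py := p _ y0 y1; have py' := p _ y'0 y'1.
  have ki : (0 < k0 + i)%N by rewrite addn_gt0 (leq_trans N0).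
  have kj : (0 < k0 + j)%N by rewrite addn_gt0 (leq_trans N0).
  rewrite !cf_rcons; apply: le_trans (cf_dist_ge pw (branch_itv ki py) (branch_itv kj py')).
  have i1 : 1 <= (k0 + i)%:R :> R by rewrite ler1n.
  have j1 : 1 <= (k0 + j)%:R :> R by rewrite ler1n.
  have ij' : i%:R + 1 <= j%:R :> R by rewrite natr1 ler_nat.
  have jk : (k0 + j)%:R + 1 <= 2 * k0%:R :> R.
    by rewrite natr1 -natrM ler_nat; move: jN Nk; clear; lia.
  have iE : (k0 + i)%:R = k0%:R + i%:R :> R by rewrite natrD.
  have jE : (k0 + j)%:R = k0%:R + j%:R :> R by rewrite natrD.
  have h : (j%:R - i%:R) / (8 * k0%:R ^+ 2) <= `|((k0 + i)%:R + y)^-1 - ((k0 + j)%:R + y')^-1|.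
    have -> : ((k0 + i)%:R + y)^-1 - ((k0 + j)%:R + y')^-1 =
       (j%:R - i%:R + y' - y) / (((k0 + i)%:R + y) * ((k0 + j)%:R + y')).
      rewrite iE jE in i1 j1 *.
      by field; rewrite !gt_eqF //; lra.
    rewrite ger0_norm; last first.
      by rewrite divr_ge0 ?mulr_ge0 //; lra.
    have -> : (j%:R - i%:R) / (8 * k0%:R ^+ 2) =
       (j%:R - i%:R) / 2 * (2 * k0%:R * (2 * k0%:R))^-1 :> R.
      by field; rewrite gt_eqF.
    apply: ler_pM; try lra.
      by rewrite invr_ge0 !mulr_ge0 // ltW.
    rewrite lef_pV2 ?posrE ?mulr_gt0 //; try lra.
    by apply: ler_pM; lra.
  have -> : (j%:R - i%:R) * c = (j%:R - i%:R) / (8 * k0%:R ^+ 2) / (4 * q w ^+ 2).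
    by rewrite /c; field; rewrite !gt_eqF //; lra.
  by rewrite ler_wpM2r ?invr_ge0 ?mulr_ge0 ?exprn_ge0.
- exact: hV.
by exists (k0 + k)%N; rewrite ?leq_addr ?ltn_add2l.
Qed.

Lemma powR_div_le (x c : R) : 0 <= x -> 1 <= c -> x `^ t / c <= (x / c) `^ t.
Proof.
move=> x0 c1; have ci : 0 < c^-1 by rewrite invr_gt0; move: c1; clear -t01 r0 Ur t0 t1; lra.
rewrite powRM ?(ltW ci) // ler_wpM2l ?powR_ge0 //.
apply: ger1_powR (ltW t1); rewrite ci invf_le1 //.
by move: c1; clear -t01 r0 Ur t0 t1; lra.
Qed.

Lemma inv_sqr_powR (a : R) : 0 <= a -> (a ^+ 2)^-1 `^ t = a `^ (- (2 * t)).
Proof.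
move=> a0; rewrite powR_inv ?exprn_ge0 // -(@powR_mulrn _ a) // -powRrM.
by congr powR; ring.
Qed.

(** From a target inside a cylinder to a new cylinder inside the target. An
    arbitrary interval may contain no single cylinder of comparable length, hence
    the run. Of the constant, 48 is the proportion lost by the run and
    24^2 = 4 * 12^2 is lost by spreading the load and appending three digits. *)
Lemma run_step w (al be : R) V (kappa0 : R) : pos_word w ->
  0 <= al < be -> be <= 1 -> 0 < kappa0 <= 1 -> 0 < V ->
  load_le (cf w @` [set y : R | al <= y <= be]) V ->
  V <= kappa0 / (24 * 24 * 48) * ((be - al) / q w ^+ 2) `^ t ->
  exists v, [/\ pos_word v, load_le (cyl (w ++ v)) (kappa0 * Q (w ++ v))
    & forall y, 0 <= y <= 1 -> exists y', [/\ al <= y' <= be, 0 < y' < 1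
        & cf (w ++ v) y = cf w y']].
Proof.
move=> pw alb b1 /andP[kz0 kz1] V0 LV hV.
have [al0 ab] := andP alb.
have qw0 : 0 < q w by rewrite ltr0n cf_denom_gt0.
have [u [k1 [N2 [pu Nk1 inside wide]]]] := run_exists alb b1.
have [N20 Nk2] := andP Nk1.
have k10 : 0 < k1%:R :> R by rewrite ltr0n (leq_trans N20).
have N0 : 0 < N2%:R :> R by rewrite ltr0n.
have N1 : 1 <= N2%:R :> R by rewrite ler1n.
have qu0 : 0 < q u by rewrite ltr0n cf_denom_gt0.
pose v := w ++ u.
have pv : pos_word v by rewrite pos_word_cat pw.
have qv0 : 0 < q v by rewrite ltr0n cf_denom_gt0.
have qv : q v <= 2 * (q w * q u) by rewrite -!natrM ler_nat cf_denom_cat.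
pose X := (be - al) / q w ^+ 2.
pose Y := N2%:R / (k1%:R * q u * q w) ^+ 2.
have ku0 : 0 < k1%:R * q u * q w by rewrite !mulr_gt0.
have X0 : 0 <= X by rewrite divr_ge0 ?exprn_ge0 ?(ltW qw0) // subr_ge0 ltW.
have Y0 : 0 <= Y by rewrite divr_ge0 ?exprn_ge0 ?(ltW N0) ?(ltW ku0).
have XY : X / 48 <= Y.
  have -> : Y = N2%:R / (k1%:R ^+ 2 * q u ^+ 2) / q w ^+ 2.
    by rewrite /Y; field; rewrite !gt_eqF.
  rewrite /X mulrAC ler_wpM2r ?invr_ge0 ?exprn_ge0 ?(ltW qw0) //.
  by rewrite ler_pdivrMr // mulrC.
have XYt : X `^ t <= 48 * Y `^ t.
  rewrite mulrC -ler_pdivrMr //.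
  apply: le_trans (powR_div_le X0 _) _; first by rewrite ler1n.
  by apply: powR_le_base; rewrite ?(ltW t0) // divr_ge0.
have Yt0 : 0 <= Y `^ t by exact: powR_ge0.
have VY : V <= kappa0 / (24 * 24) * Y `^ t.
  apply: (le_trans hV).
  have -> : kappa0 / (24 * 24) * Y `^ t = kappa0 / (24 * 24 * 48) * (48 * Y `^ t).
    by field.
  by rewrite ler_wpM2l // divr_ge0 ?(ltW kz0).
have sub l : (k1 <= l < k1 + N2)%N ->
    cf (rcons v l) @` [set y : R | 1/3 <= y <= 1/2] `<=`
    cf w @` [set y : R | al <= y <= be].
  move=> lN _ [y y01 <-]; rewrite /v rcons_cat cf_cat.
  exists (cf (rcons u l) y) => //=; apply: inside => //.
  by move: y01 => /=; clear -t01 r0 Ur t0 t1; lra.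
have third : 0 <= (1 / 3 : R) <= 1 / 2 by clear -t01 r0 Ur t0 t1; lra.
have s1 : 1 / 2 <= 1 :> R by clear -t01 r0 Ur t0 t1; lra.
have s2 : 1 / 2 - 1 / 3 <= 1 / 2 :> R by clear -t01 r0 Ur t0 t1; lra.
have [|k kN Lk] := spread_digits pv third s1 s2 Nk1 sub V0 _ LV.
  have a : Y / 128 <= N2%:R / (32 * k1%:R ^+ 2 * q v ^+ 2).
    have -> : Y / 128 = N2%:R / (32 * k1%:R ^+ 2 * (2 * (q w * q u)) ^+ 2).
      by rewrite /Y; field; rewrite !gt_eqF.
    rewrite ler_wpM2l ?(ltW N0) // lef_pV2 ?posrE ?mulr_gt0 ?exprn_gt0 ?mulr_gt0 //.
    rewrite ler_wpM2l ?mulr_ge0 ?exprn_ge0 ?(ltW k10) //.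
    by rewrite ler_pXn2r ?nnegrE ?(ltW qv0) // (le_trans (ltW qv0)).
  have Y128 : 0 <= Y / 128 by rewrite divr_ge0.
  have b := powR_le_base (ltW t0) Y128 a.
  have c : Y `^ t / 128 <= (Y / 128) `^ t.
    by apply: powR_div_le => //; rewrite ler1n.
  have d := ler_wpM2r Yt0 kz1.
  move: Yt0 VY b c d; clear -t01 r0 Ur t0 t1; move: (Y `^ t) ((Y / 128) `^ t) (_ `^ t) => *; lra.
have k0 : (0 < k)%N by case/andP: kN => h _; rewrite (leq_trans _ h) // (leq_trans N20).
have pvk : pos_word (rcons v k) by rewrite pos_word_rcons k0.
exists (u ++ [:: k; 2%N]).
have wE : w ++ u ++ [:: k; 2%N] = rcons (rcons v k) 2.
  by rewrite /v -!cats1 -!catA.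
split => //.
- by rewrite pos_word_cat pu /pos_word /= k0.
- rewrite wE; apply: load_le_sub Lk.
    move=> _ [y y01 <-]; rewrite cf_rcons.
    by exists ((2%:R + y)^-1) => //; exact: digit2_itv.
  have q2 : q (rcons (rcons v k) 2) <= 12 * (k1%:R * q u * q w).
    have a : q (rcons (rcons v k) 2) <= 3 * q (rcons v k).
      by rewrite -natrM ler_nat; exact: cf_denom_rcons_le.
    have b : q (rcons v k) <= 2 * (k1%:R * q v).
      rewrite -!natrM ler_nat; apply: leq_trans (cf_denom_rcons_le k pv) _.
      rewrite mulnA leq_mul2r; apply/orP; right.
      by move: kN Nk2; clear -t01 r0 Ur t0 t1; lia.
    have c := ler_wpM2l (ltW k10) qv.
    by move: a b c; clear -t01 r0 Ur t0 t1; move: (k1%:R * q v) => *; lra.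
  have pz : pos_word (rcons (rcons v k) 2) by rewrite pos_word_rcons.
  have c12 : 1 <= 12 :> R by rewrite ler1n.
  have := ler_wpM2l (ltW kz0) (Q_lower pz ku0 c12 q2).
  apply: le_trans.
  have e : Y `^ t / N2%:R <= (k1%:R * q u * q w) `^ (- (2 * t)).
    rewrite -(inv_sqr_powR (ltW ku0)).
    have -> : ((k1%:R * q u * q w) ^+ 2)^-1 = Y / N2%:R.
      by rewrite /Y; field; rewrite !gt_eqF.
    exact: powR_div_le.
  apply: (@le_trans _ _ (kappa0 * (Y `^ t / N2%:R / 12 ^+ 2))); last first.
    by rewrite ler_wpM2l ?(ltW kz0) // ler_wpM2r // invr_ge0.
  have -> : kappa0 * (Y `^ t / N2%:R / 12 ^+ 2) =
    4 * (kappa0 / (24 * 24) * Y `^ t) / N2%:R by field; rewrite gt_eqF.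
  by rewrite ler_wpM2r ?invr_ge0 ?(ltW N0) // ler_wpM2l.
move=> y y01; have y2 := digit2_itv y01.
exists (cf (rcons u k) (2%:R + y)^-1); split => //.
- by apply: inside => //; move: y2; clear -t01 r0 Ur t0 t1; lra.
- apply: cf_itvo; first by rewrite pos_word_rcons k0.
  by move: y2; clear -t01 r0 Ur t0 t1; lra.
- by rewrite wE cf_rcons /v rcons_cat cf_cat.
Qed.

(** The two upper bounds on kappa are the two ways in which the targets can be
    too small to be found: sets meeting many digits, and sets meeting one. *)
Lemma round_step w kappa (kappa0 : R) k0 N (al be : R) : pos_word w ->
  0 < kappa -> 0 < kappa0 <= 1 -> (0 < N <= k0)%N ->
  0 <= al < be -> be <= 1 -> be - al <= 1 / 2 ->
  load_le (cyl w) (kappa * Q w) ->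
  kappa <= (N%:R / k0%:R ^+ 2) `^ t / 128 ->
  kappa <= kappa0 / (96 * 96 * 48) * (N%:R * ((be - al) / k0%:R ^+ 2) `^ t) ->
  exists v, [/\ pos_word v, (0 < size v)%N,
    load_le (cyl (w ++ v)) (kappa0 * Q (w ++ v))
    & forall y, 0 <= y <= 1 -> exists k y', [/\ (k0 <= k < k0 + N)%N,
        al <= y' <= be, 0 < y' < 1 & cf (w ++ v) y = cf w ((k%:R + y')^-1)]].
Proof.
move=> pw ka0 kz01 Nk0 alb b1 short Lw h1 h2.
have [al0 ab] := andP alb; have [N0 Nk] := andP Nk0; have [kz0 kz1] := andP kz01.
have N0' : 0 < N%:R :> R by rewrite ltr0n.
have k00 : 0 < k0%:R :> R by rewrite ltr0n (leq_trans N0).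
have qw0 : 0 < q w by rewrite ltr0n cf_denom_gt0.
have Qw0 := Q_gt0 pw.
have al01 : 0 <= al <= be by rewrite al0 ltW.
have V0 : 0 < kappa * Q w by rewrite mulr_gt0.
have sub k : (k0 <= k < k0 + N)%N ->
    cf (rcons w k) @` [set y : R | al <= y <= be] `<=` cyl w.
  move=> /andP[kk _] _ [y /andP[y0 y1] <-]; rewrite -cats1 cf_cat.
  exists (cf [:: k] y) => //; apply: cf_itv.
    by rewrite /pos_word /= (leq_trans _ kk) // (leq_trans N0).
  by rewrite (le_trans al0 y0) (le_trans y1 b1).
have [|k kN Lk] := spread_digits pw al01 b1 short Nk0 sub V0 _ Lw.
  have -> : N%:R / (32 * k0%:R ^+ 2 * q w ^+ 2) =
      N%:R / k0%:R ^+ 2 * (q w ^+ 2)^-1 / 32.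
    by field; rewrite !gt_eqF.
  set X := N%:R / k0%:R ^+ 2 in h1 *.
  have X0 : 0 <= X by rewrite divr_ge0 ?exprn_ge0 ?(ltW N0') ?(ltW k00).
  have Z0 : 0 <= (q w ^+ 2)^-1 by rewrite invr_ge0 exprn_ge0 ?(ltW qw0).
  have a : (X * (q w ^+ 2)^-1) `^ t / 32 <= (X * (q w ^+ 2)^-1 / 32) `^ t.
    by apply: powR_div_le; rewrite ?mulr_ge0 ?ler1n.
  rewrite powRM // inv_sqr_powR ?(ltW qw0) // in a.
  have b := ler_wpM2r (ltW Qw0) h1.
  move: a b; clear -t01 r0 Ur t0 t1; move: (_ `^ t) (X `^ t) => *; lra.
have kk : (k0 <= k)%N by case/andP: kN.
have kpos : (0 < k)%N by rewrite (leq_trans _ kk) // (leq_trans N0).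
have pwk : pos_word (rcons w k) by rewrite pos_word_rcons kpos.
have qwk0 : 0 < q (rcons w k) by rewrite ltr0n cf_denom_gt0.
have qwk : q (rcons w k) <= 2 * k0%:R * q w.
  rewrite -!natrM ler_nat; apply: leq_trans (cf_denom_rcons_le k pw) _.
  rewrite leq_mul2r; apply/orP; right.
  by move: kN Nk; clear -t01 r0 Ur t0 t1; lia.
have V20 : 0 < 4 * (kappa * Q w) / N%:R by rewrite divr_gt0 ?mulr_gt0.
have [|v [pv Lv hv]] := run_step pwk alb b1 kz01 V20 Lk.
  set H := (be - al) / k0%:R ^+ 2 in h2.
  have H0 : 0 <= H by rewrite divr_ge0 ?exprn_ge0 ?(ltW k00) // subr_ge0 ltW.
  have Z0 : 0 <= (q w ^+ 2)^-1 by rewrite invr_ge0 exprn_ge0 ?(ltW qw0).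
  have a : H * (q w ^+ 2)^-1 / 4 <= (be - al) / q (rcons w k) ^+ 2.
    have -> : H * (q w ^+ 2)^-1 / 4 = (be - al) / (2 * k0%:R * q w) ^+ 2.
      by rewrite /H; field; rewrite !gt_eqF.
    have kq0 : 0 < 2 * k0%:R * q w by rewrite !mulr_gt0.
    rewrite ler_wpM2l ?subr_ge0 ?(ltW ab) // lef_pV2 ?posrE ?exprn_gt0 //.
    by rewrite ler_pXn2r ?nnegrE ?(ltW qwk0) ?(ltW kq0).
  have HZ := mulr_ge0 H0 Z0.
  have HZ4 : 0 <= H * (q w ^+ 2)^-1 / 4 by rewrite divr_ge0.
  have b := powR_le_base (ltW t0) HZ4 a.
  have c : (H * (q w ^+ 2)^-1) `^ t / 4 <= (H * (q w ^+ 2)^-1 / 4) `^ t.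
    by apply: powR_div_le; rewrite ?ler1n.
  rewrite powRM // inv_sqr_powR ?(ltW qw0) // in c.
  have d := le_trans c b.
  have e : 0 <= kappa0 / (24 * 24 * 48) by rewrite divr_ge0 ?(ltW kz0).
  apply: le_trans (ler_wpM2l e d).
  rewrite ler_pdivrMr //.
  have f := ler_wpM2r (ltW Qw0) h2.
  have g := ler_wpM2l (ler0n R 4) f; apply: (le_trans g).
  rewrite le_eqVlt; apply/orP; left; apply/eqP.
  by clear -t01 r0 Ur t0 t1; move: (H `^ t) (Q w) => A D; field.
exists (k :: v); split => //.
- by rewrite /pos_word /= kpos.
- by rewrite -cat_rcons.
move=> y /hv[y' [h h' e]]; exists k, y'; split => //.
by rewrite -cat_rcons e cf_rcons.
Qed.
End Descent.

(** * Targets and exponential rates *)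

Section Targets.
Variable R : realType.
Implicit Types (B s t z e u y : R) (n d k N : nat).

(** The threshold below which the partition function of order n cannot stay
    when s is below the n-th pre-dimensional number; its inverse is, up to a
    constant, the s-dimensional content of the hitting set in the unit
    interval. *)
Definition threshold B n z s : R :=
  if first_digit z is d%:E
  then Num.min (Num.max (M1 B n s) (M2 B d n s)) (M3 B d n s) else M1 B n s.

Lemma lt_predim_psum B n z s : 1 < B -> 0 <= z <= 1 -> 0 <= s <= 1 ->
  (s%:E < predim B n z)%E -> ~ psum_le n s (threshold B n z s).
Proof.
move=> B1 z01 s01 sp; have B0 : 0 < B by lra.
case: (first_digitP z01) => [[_ zd]|[d [d0 zd _ _]]]; rewrite /threshold zd.
  case: (lt_predim sp) => [[s1 _]|]; first by apply: crit_gt; rewrite -?predim1E.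
  by rewrite /predim3 zd lte_fin; case/andP: s01 => s0 _; rewrite ltNge s0.
have d0' : 0 < d%:R :> R by rewrite ltr0n.
case: (lt_predim sp) => [[s1 s2]|s3].
  rewrite predim1E // in s1; rewrite (predim2E n B0 d0' zd) in s2.
  move=> h; have {h} : psum_le n s (Num.max (M1 B n s) (M2 B d%:R n s)).
    by apply: psum_le_leM h; rewrite ge_min lexx.
  by case: leP => _; apply: crit_gt.
rewrite (predim3E n B0 d0' zd) in s3.
move=> h; apply: (crit_gt s01 s3); apply: psum_le_leM h.
by rewrite ge_min lexx orbT.
Qed.

Lemma powR_B1 B a b : 1 < B -> a <= b -> B `^ a <= B `^ b.
Proof. by move=> B1 ab; apply: ler_powR => //; exact: ltW. Qed.

Lemma threshold_ge B n z s : 1 < B -> 0 <= z <= 1 -> 0 <= s <= 1 ->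
  B `^ (n%:R * (s ^+ 2 / 2)) <= threshold B n z s.
Proof.
move=> B1 z01 /andP[s0 s1].
have s2 : 0 <= s ^+ 2 by rewrite sqr_ge0.
have h1 : B `^ (n%:R * (s ^+ 2 / 2)) <= M1 B n s.
  by apply: powR_B1 => //; rewrite ler_wpM2l //; move: s2; clear; lra.
rewrite /threshold; case: (first_digitP z01) => [[_ ->] //|[d [d0 -> _ _]]].
rewrite le_min le_max h1 /= /M3.
have d1 : 1 <= d%:R `^ s :> R.
  by rewrite -[leLHS](powRr0 d%:R); apply: ler_powR => //; rewrite ler1n.
apply: le_trans (ler_peMl (powR_ge0 _ _) d1); apply: powR_B1 => //.
rewrite -mulrA ler_wpM2l // ler_wpM2r // expr2 ler_piMr //.
Qed.

Lemma threshold_le B n z s : 1 < B -> 0 <= z <= 1 -> 0 <= s <= 1 ->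
  threshold B n z s <= B `^ n%:R.
Proof.
move=> B1 z01 s01; have h1 := @M1_le R B n s B1 s01.
rewrite /threshold; case: (first_digitP z01) => [[_ ->] //|[d [d0 -> _ _]]].
have d1 : 1 <= d%:R :> R by rewrite ler1n.
by rewrite ge_min ge_max h1 (M2_le n B1 d1 s01).
Qed.

Lemma threshold_decay B n z s t : 1 < B -> 0 <= z <= 1 -> 0 < t -> t < s -> s < 1 ->
  threshold B n z t <= B `^ (- (n%:R * ((s - t) * t / 2))) * threshold B n z s.
Proof.
move=> B1 z01 t0 ts s1; have B0 : 0 < B by lra.
set D := (s - t) * t / 2.
have D1 : D <= s ^+ 2 - t ^+ 2 by rewrite /D; nra.
have D2 : D <= (s - t) / 2 by rewrite /D; nra.
have D3 : D <= s - t by rewrite /D; nra.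
have h1 : M1 B n t <= B `^ (- (n%:R * D)) * M1 B n s.
  rewrite -powRDpos //; apply: powR_B1 => //.
  by rewrite -mulrN -mulrDr ler_wpM2l //; move: D1; clear; lra.
rewrite /threshold; case: (first_digitP z01) => [[_ ->] //|[d [d0 -> _ _]]].
have d1 : 1 <= d%:R :> R by rewrite ler1n.
have P : 0 < B `^ (- (n%:R * D)) by exact: powR_gt0.
have h2 : M2 B d%:R n t <= B `^ (- (n%:R * D)) * M2 B d%:R n s.
  rewrite /M2 mulrA -powRDpos //; apply: ler_pM; rewrite ?powR_ge0 //.
    apply: powR_B1 => //.
    by rewrite -mulrN -mulrDr ler_wpM2l //; move: D3; clear; lra.
  by apply: ler_powR => //; move: ts; clear; lra.
have h3 : M3 B d%:R n t <= B `^ (- (n%:R * D)) * M3 B d%:R n s.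
  rewrite /M3 mulrCA -powRDpos //; apply: ler_pM; rewrite ?powR_ge0 //.
    by apply: ler_powR => //; exact: ltW.
  apply: powR_B1 => //.
  by rewrite -mulrN -!mulrA -mulrDr ler_wpM2l //; move: D2; clear; lra.
rewrite minr_pMr ?(ltW P) // maxr_pMr ?(ltW P) //.
rewrite le_min !ge_min h3 orbT andbT; apply/orP; left.
by rewrite ge_max !le_max h1 h2 orbT.
Qed.

Lemma short_itv (z h : R) : 0 <= z < 1 -> 0 < h <= 1 / 2 ->
  exists al be, [/\ 0 <= al < be, be <= 1, be - al = h &
    forall u, al <= u <= be -> `|u - z| <= h].
Proof.
move=> z01 h01; have [z2|z2] := leP z (1 / 2).
  exists z, (z + h); split; try lra.
  by move=> u hu; rewrite ler_norml; lra.
exists (z - h), z; split; try lra.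
by move=> u hu; rewrite ler_norml; lra.
Qed.

Lemma hit_branch e z k u : (0 < k)%N -> 0 < u < 1 ->
  `|(k%:R + u)^-1 - z| * `|u - gauss_map z| < e ^+ 2 ->
  hit e z (k%:R + u)^-1.
Proof.
move=> k0 u01 h; split; first exact: branch_itvo.
by rewrite gauss_branch.
Qed.

Definition target e z k0 N (al be : R) : Prop :=
  [/\ (0 < N <= k0)%N, 0 <= al < be, be <= 1, be - al <= 1 / 2 &
    forall k u, (k0 <= k < k0 + N)%N -> al <= u <= be -> 0 < u < 1 ->
      hit e z (k%:R + u)^-1].

(** For digits k >= K, where K is at most the digit of z, the first factor is at
    most 1/K. *)
Lemma target_run e z K : 0 < e -> 0 <= z <= K%:R^-1 -> 0 <= gauss_map z < 1 ->
  (0 < K)%N -> e ^+ 2 * K%:R <= 1 ->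
  exists al be, target e z K K al be /\ be - al = e ^+ 2 * K%:R / 2.
Proof.
move=> e0 zK t01 K0 eK.
have K0' : 0 < K%:R :> R by rewrite ltr0n.
have h0 : 0 < e ^+ 2 * K%:R / 2 by rewrite !divr_gt0 ?mulr_gt0 ?exprn_gt0.
have h01 : 0 < e ^+ 2 * K%:R / 2 <= 1 / 2 by rewrite h0 ler_wpM2r.
have [al [be [alb b1 len near]]] := short_itv t01 h01.
exists al, be; split => //; split; rewrite ?K0 ?leqnn ?len //.
  by case/andP: h01.
move=> k u /andP[Kk _] hu u01; apply: hit_branch => //.
  exact: leq_trans Kk.
have u0 : 0 <= u by case/andP: u01 => /ltW.
have /andP[y0 y1] := branch_le_inv K0 Kk u0.
apply: (@le_lt_trans _ _ (K%:R^-1 * (e ^+ 2 * K%:R / 2))).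
  apply: ler_pM => //; last exact: near.
  by rewrite ler_norml; move: y0 y1 zK; move: (K%:R^-1) => I; clear; lra.
have -> : K%:R^-1 * (e ^+ 2 * K%:R / 2) = e ^+ 2 / 2 by field; rewrite gt_eqF.
by have := exprn_gt0 2 e0; lra.
Qed.

(** In the digit of z itself the two factors are proportional, hence the scale e
    instead of e^2. *)
Lemma target_single e z d : 0 < e -> z = (d%:R + gauss_map z)^-1 ->
  0 <= gauss_map z < 1 -> (0 < d)%N -> e * d%:R <= 1 ->
  exists al be, target e z d 1 al be /\ be - al = e * d%:R / 2.
Proof.
move=> e0 zE t01 d0 ed.
have d0' : 0 < d%:R :> R by rewrite ltr0n.
have h0 : 0 < e * d%:R / 2 by rewrite !divr_gt0 ?mulr_gt0.
have h01 : 0 < e * d%:R / 2 <= 1 / 2 by rewrite h0 ler_wpM2r.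
have [al [be [alb b1 len near]]] := short_itv t01 h01.
exists al, be; split => //; split; rewrite ?d0 ?len //.
  by case/andP: h01.
move=> k u kd hu u01.
have -> : k = d by move: kd; clear; lia.
apply: hit_branch => //.
have u0 : 0 <= u by case/andP: u01 => /ltW.
have g0 : 0 <= gauss_map z by case/andP: t01.
have hn := near u hu.
rewrite {1}zE branch_dist //.
apply: (@le_lt_trans _ _ ((e * d%:R / 2) / (d%:R * d%:R) * (e * d%:R / 2))).
  apply: ler_pM => //.
    by rewrite divr_ge0 ?mulr_ge0 ?addr_ge0 // ltW.
  apply: ler_pM => //; first by rewrite invr_ge0 mulr_ge0 ?addr_ge0 // ltW.
  rewrite lef_pV2 ?posrE ?mulr_gt0 ?ltr_pwDl //.
  by apply: ler_pM; rewrite ?(ltW d0') ?lerDl.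
have -> : e * d%:R / 2 / (d%:R * d%:R) * (e * d%:R / 2) = e ^+ 2 / 4.
  by field; rewrite gt_eqF.
by have := exprn_gt0 2 e0; lra.
Qed.

Section Sizes.
Variables (B t e : R) (n : nat).
Hypotheses (t01 : 0 < t < 1) (e01 : 0 < e <= 1)
  (eE : forall a : R, B `^ (n%:R * a) = e `^ (- (2 * a))).

Let t0 : 0 < t. Proof. by case/andP: t01. Qed.
Let t1 : t < 1. Proof. by case/andP: t01. Qed.
Let e0 : 0 < e. Proof. by case/andP: e01. Qed.
Let e1 : e <= 1. Proof. by case/andP: e01. Qed.

Lemma M1E : M1 B n t = e `^ (- (2 * t ^+ 2)). Proof. by rewrite /M1 eE. Qed.

Lemma M2E d : M2 B d%:R n t = e `^ (- (2 * t)) * d%:R `^ (t - 1).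
Proof. by rewrite /M2 eE. Qed.

Lemma M3E d : M3 B d%:R n t = d%:R `^ t * e `^ (- t).
Proof.
rewrite /M3 -(mulrA n%:R) eE.
by have -> : - (2 * (t / 2)) = - t by field.
Qed.

Lemma powR_e_anti (a b : R) : a <= b -> e `^ b <= e `^ a.
Proof. by move=> ab; apply: ger_powR ab. Qed.

Lemma half_powR (x : R) : 0 <= x -> x `^ t / 2 <= (x / 2) `^ t.
Proof. by move=> x0; apply: powR_div_le => //; rewrite ler1n. Qed.

Lemma sizes_large (M : R) K : (0 < K)%N -> K%:R <= e `^ (- (2 * t)) <= 2 * K%:R ->
  M1 B n t <= M ->
  M^-1 / 4 <= (K%:R / K%:R ^+ 2) `^ t /\
  M^-1 / 4 <= K%:R * (e ^+ 2 * K%:R / 2 / K%:R ^+ 2) `^ t.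
Proof.
move=> K0 /andP[Kx xK] hM.
have K0' : 0 < K%:R :> R by rewrite ltr0n.
rewrite M1E in hM.
have P0 : 0 < e `^ (- (2 * t ^+ 2)) by exact: powR_gt0.
have Mi : M^-1 <= e `^ (2 * t ^+ 2).
  rewrite -[leRHS]invrK -powRN lef_pV2 ?posrE //; exact: lt_le_trans hM.
have E0 : 0 <= e `^ (2 * t ^+ 2) by exact: powR_ge0.
have Mi4 : M^-1 / 4 <= e `^ (2 * t ^+ 2) / 4 by rewrite ler_wpM2r.
split.
  have -> : K%:R / K%:R ^+ 2 = K%:R^-1 :> R by field; rewrite gt_eqF.
  rewrite powR_inv //; apply: (le_trans Mi4).
  apply: (@le_trans _ _ (e `^ (2 * t ^+ 2))).
    by rewrite ler_pdivrMr // ler_peMr // ler1n.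
  have -> : 2 * t ^+ 2 = - (2 * t) * - t by ring.
  by rewrite powRrM; apply: powRN_le_base; rewrite ?(ltW t0).
have -> : e ^+ 2 * K%:R / 2 / K%:R ^+ 2 = e ^+ 2 / K%:R / 2 by field; rewrite gt_eqF.
apply: (le_trans Mi4).
have X0 : 0 <= e ^+ 2 / K%:R by rewrite divr_ge0 ?exprn_ge0 ?(ltW e0).
apply: le_trans (ler_wpM2l (ltW K0') (half_powR X0)).
rewrite powRM ?exprn_ge0 ?invr_ge0 ?(ltW e0) // powR_inv //.
rewrite -(@powR_mulrn _ e) ?(ltW e0) // -powRrM.
have -> : K%:R * (e `^ (2 * t) * K%:R `^ (- t) / 2) =
    K%:R `^ (1 - t) * e `^ (2 * t) / 2.
  by rewrite powRDpos // powRr1 //; ring.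
have -> : 2 * t ^+ 2 = - (2 * t) * (1 - t) + 2 * t by ring.
rewrite powRDpos // (powRrM e (- (2 * t))).
have h : (e `^ (- (2 * t))) `^ (1 - t) <= 2 * K%:R `^ (1 - t).
  apply: (@le_trans _ _ ((2 * K%:R) `^ (1 - t))).
    by apply: powR_le_base; rewrite ?powR_ge0 // subr_ge0 ltW.
  rewrite powRM // ler_wpM2r ?powR_ge0 // -[leRHS]powRr1 //.
  by apply: ler_powR; rewrite ?ler1n // gerBl ltW.
have := ler_wpM2r (powR_ge0 e (2 * t)) h; rewrite -(mulrA 2).
move: (K%:R `^ (1 - t) * e `^ (2 * t)) ((e `^ _) `^ (1 - t) * e `^ (2 * t)).
by clear -t01 e01 eE t0 t1 e0 e1 => *; lra.
Qed.

Lemma sizes_middle (M : R) d : (0 < d)%N -> d%:R <= e `^ (- (2 * t)) ->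
  M2 B d%:R n t <= M ->
  M^-1 / 4 <= (d%:R / d%:R ^+ 2) `^ t /\
  M^-1 / 4 <= d%:R * (e ^+ 2 * d%:R / 2 / d%:R ^+ 2) `^ t.
Proof.
move=> d0 dx hM.
have d0' : 0 < d%:R :> R by rewrite ltr0n.
rewrite M2E in hM.
have P0 : 0 < e `^ (- (2 * t)) * d%:R `^ (t - 1) by rewrite mulr_gt0 ?powR_gt0.
have E0 : 0 <= e `^ (2 * t) * d%:R `^ (1 - t) by rewrite mulr_ge0 ?powR_ge0.
have Mi : M^-1 <= e `^ (2 * t) * d%:R `^ (1 - t).
  have -> : e `^ (2 * t) * d%:R `^ (1 - t) = (e `^ (- (2 * t)) * d%:R `^ (t - 1))^-1.
    by rewrite invfM -!powRN opprK opprB.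
  by rewrite lef_pV2 ?posrE // (lt_le_trans P0).
have Mi4 : M^-1 / 4 <= e `^ (2 * t) * d%:R `^ (1 - t) / 4 by rewrite ler_wpM2r.
split.
  have -> : d%:R / d%:R ^+ 2 = d%:R^-1 :> R by field; rewrite gt_eqF.
  rewrite powR_inv //; apply: (le_trans Mi4).
  apply: (@le_trans _ _ (e `^ (2 * t) * d%:R `^ (1 - t))).
    by rewrite ler_pdivrMr // ler_peMr // ler1n.
  rewrite powRDpos // powRr1 // mulrA ler_piMl ?powR_ge0 //.
  apply: (@le_trans _ _ (e `^ (2 * t) * e `^ (- (2 * t)))).
    by rewrite ler_wpM2l ?powR_ge0.
  by rewrite -powRDpos // subrr powRr0.
have -> : e ^+ 2 * d%:R / 2 / d%:R ^+ 2 = e ^+ 2 / d%:R / 2 by field; rewrite gt_eqF.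
apply: (le_trans Mi4).
have X0 : 0 <= e ^+ 2 / d%:R by rewrite divr_ge0 ?exprn_ge0 ?(ltW e0).
apply: le_trans (ler_wpM2l (ltW d0') (half_powR X0)).
rewrite powRM ?exprn_ge0 ?invr_ge0 ?(ltW e0) // powR_inv //.
rewrite -(@powR_mulrn _ e) ?(ltW e0) // -powRrM.
have -> : d%:R * (e `^ (2 * t) * d%:R `^ (- t) / 2) =
    e `^ (2 * t) * d%:R `^ (1 - t) / 2.
  by rewrite (powRDpos 1) // powRr1 //; ring.
by rewrite ler_wpM2l // lef_pV2 ?posrE // ler_nat.
Qed.

Lemma sizes_small (M : R) d : (0 < d)%N -> d%:R <= e `^ (- t) ->
  M3 B d%:R n t <= M ->
  M^-1 / 4 <= (1%:R / d%:R ^+ 2) `^ t /\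
  M^-1 / 4 <= 1%:R * (e * d%:R / 2 / d%:R ^+ 2) `^ t.
Proof.
move=> d0 dx hM.
have d0' : 0 < d%:R :> R by rewrite ltr0n.
rewrite M3E in hM.
have P0 : 0 < d%:R `^ t * e `^ (- t) by rewrite mulr_gt0 ?powR_gt0.
have E0 : 0 <= e `^ t * d%:R `^ (- t) by rewrite mulr_ge0 ?powR_ge0.
have Mi : M^-1 <= e `^ t * d%:R `^ (- t).
  have -> : e `^ t * d%:R `^ (- t) = (d%:R `^ t * e `^ (- t))^-1.
    by rewrite invfM -!powRN opprK mulrC.
  by rewrite lef_pV2 ?posrE // (lt_le_trans P0).
have Mi4 : M^-1 / 4 <= e `^ t * d%:R `^ (- t) / 4 by rewrite ler_wpM2r.
split.
  rewrite div1r powR_inv ?exprn_ge0 // -powR_mulrn // -powRrM.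
  apply: (le_trans Mi4).
  apply: (@le_trans _ _ (e `^ t * d%:R `^ (- t))).
    by rewrite ler_pdivrMr // ler_peMr // ler1n.
  have -> : 2 * - t = - t + - t by ring.
  rewrite powRDpos // ler_wpM2r ?powR_ge0 //.
  have -> : e `^ t = (e `^ (-1)) `^ (- t) by rewrite -powRrM mulN1r opprK.
  apply: powRN_le_base; rewrite ?(ltW t0) //.
  by apply: (le_trans dx); apply: powR_e_anti; rewrite lerN2 ltW.
rewrite mul1r.
have -> : e * d%:R / 2 / d%:R ^+ 2 = e / d%:R / 2 by field; rewrite gt_eqF.
apply: (le_trans Mi4).
have X0 : 0 <= e / d%:R by rewrite divr_ge0 // ltW.
apply: le_trans (half_powR X0).
rewrite powRM ?invr_ge0 ?(ltW e0) // powR_inv //.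
by rewrite ler_wpM2l // lef_pV2 ?posrE // ler_nat.
Qed.

(** The most economical targets for the exponent t: a single digit when d is
    small, a run of digits of the order of min(d, e^(-2t)) otherwise. *)
Lemma target_exists z : 0 <= z <= 1 ->
  exists k0 N al be, [/\ target e z k0 N al be,
    (threshold B n z t)^-1 / 4 <= (N%:R / k0%:R ^+ 2) `^ t &
    (threshold B n z t)^-1 / 4 <= N%:R * ((be - al) / k0%:R ^+ 2) `^ t].
Proof.
move=> z01.
have tt : 0 <= t by exact: ltW.
have x1 : 1 <= e `^ (- (2 * t)).
  rewrite -[leLHS](powRr0 e); apply: powR_e_anti.
  by rewrite oppr_le0 mulr_ge0.
have ex : e ^+ 2 * e `^ (- (2 * t)) <= 1.
  rewrite -(@powR_mulrn _ e) ?(ltW e0) // -powRDpos //.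
  rewrite -[leRHS](powRr0 e); apply: powR_e_anti.
  by move: t1; clear -t01 e01 eE t0 t1 e0 e1; lra.
have large : (forall K, (0 < K)%N -> K%:R <= e `^ (- (2 * t)) -> z <= K%:R^-1) ->
    0 <= gauss_map z < 1 -> M1 B n t <= threshold B n z t ->
    exists k0 N al be, [/\ target e z k0 N al be,
      (threshold B n z t)^-1 / 4 <= (N%:R / k0%:R ^+ 2) `^ t &
      (threshold B n z t)^-1 / 4 <= N%:R * ((be - al) / k0%:R ^+ 2) `^ t].
  move=> zK g01 hM.
  have [K [K0 [Kx xK]]] : exists K : nat, (0 < K)%N /\
      K%:R <= e `^ (- (2 * t)) /\ e `^ (- (2 * t)) <= 2 * K%:R.
    have x0 : 0 <= e `^ (- (2 * t)) by exact: powR_ge0.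
    exists (Num.truncn (e `^ (- (2 * t)))).
    have /andP[h1 h2] := truncn_itv x0.
    have K0 : (0 < Num.truncn (e `^ (- (2 * t))))%N by rewrite truncn_gt0.
    split => //; split => //; apply: (le_trans (ltW h2)).
    by rewrite -natrM ler_nat; move: K0; clear; lia.
  have zK' : 0 <= z <= K%:R^-1 by rewrite zK // andbT; case/andP: z01.
  have eK : e ^+ 2 * K%:R <= 1.
    by apply: le_trans ex; rewrite ler_wpM2l ?exprn_ge0 ?(ltW e0).
  have [al [be [T len]]] := target_run e0 zK' g01 K0 eK.
  exists K, K, al, be; rewrite len.
  have xx : K%:R <= e `^ (- (2 * t)) <= 2 * K%:R by rewrite Kx.
  by have [? ?] := sizes_large K0 xx hM.
case: (first_digitP z01) => [[z0 zd]|[d [d0 zd zE g01]]].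
  apply: large => [K _ _||].
  - by rewrite z0 invr_ge0.
  - by rewrite z0 /gauss_map eqxx lexx ltr01.
  - by rewrite /threshold zd.
have d0' : 0 < d%:R :> R by rewrite ltr0n.
have dd1 : d%:R `^ (t - 1) = d%:R `^ t * d%:R^-1 :> R.
  by rewrite powRDpos // powR_inv1.
have zd1 : 0 <= z <= d%:R^-1.
  by rewrite zE branch_le_inv //; case/andP: g01.
have [xd|dx] := leP (e `^ (- (2 * t))) d%:R.
  apply: large => //.
    move=> K K0 Kx; case/andP: zd1 => _ h; apply: (le_trans h).
    by rewrite lef_pV2 ?posrE ?ltr0n // (le_trans Kx).
  rewrite /threshold zd le_min le_max lexx /= M1E M3E.
  apply: (@le_trans _ _ ((e `^ (- (2 * t))) `^ t * e `^ (- t))).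
    rewrite -powRrM -powRDpos //; apply: powR_e_anti.
    by move: t0; clear -t01 e01 eE t0 t1 e0 e1; nra.
  by rewrite ler_wpM2r ?powR_ge0 // powR_le_base // powR_ge0.
have [td|dt] := leP (e `^ (- t)) d%:R.
  have ed : e ^+ 2 * d%:R <= 1.
    by apply: le_trans ex; rewrite ler_wpM2l ?exprn_ge0 ?(ltW e0) // ltW.
  have [al [be [T len]]] := target_run e0 zd1 g01 d0 ed.
  exists d, d, al, be; rewrite len.
  have hM : M2 B d%:R n t <= threshold B n z t.
    rewrite /threshold zd le_min le_max lexx orbT /= M2E M3E dd1.
    rewrite mulrCA ler_wpM2l ?powR_ge0 //.
    rewrite ler_pdivrMr // (_ : - (2 * t) = - t + - t); last ring.
    by rewrite powRDpos // ler_wpM2l ?powR_ge0.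
  by have [? ?] := sizes_middle d0 (ltW dx) hM.
have ed : e * d%:R <= 1.
  apply: (@le_trans _ _ (e * e `^ (- t))); first by rewrite ler_wpM2l ?(ltW e0) // ltW.
  rewrite -{1}(powRr1 (ltW e0)) -powRDpos // -[leRHS](powRr0 e).
  by apply: powR_e_anti; rewrite subr_ge0 ltW.
have [al [be [T len]]] := target_single e0 zE g01 d0 ed.
exists d, 1%N, al, be; rewrite len.
have hM : M3 B d%:R n t <= threshold B n z t.
  rewrite /threshold zd le_min lexx andbT le_max; apply/orP; right.
  rewrite M2E M3E dd1 [leRHS]mulrCA ler_wpM2l ?powR_ge0 //.
  rewrite ler_pdivlMr // (_ : - (2 * t) = - t + - t); last ring.
  by rewrite powRDpos // ler_wpM2l ?powR_ge0 // ltW.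
by have [? ?] := sizes_small d0 (ltW dt) hM.
Qed.
End Sizes.
End Targets.

(** * The lower bound *)

Section Lower.
Variable R : realType.
Implicit Types (B s t x y X : R).
Local Notation q w := ((cf_denom w)%:R : R).

Lemma between_minmax (a x b : R) :
  between a x b = (Num.min a b <= x <= Num.max a b).
Proof.
rewrite /between; case: (leP a b) => ab.
  by case: (leP a x) => ax; case: (leP x b) => xb //=; apply/negbTE/negP => /andP[]; lra.
by case: (leP b x) => bx; case: (leP x a) => xa; rewrite ?orbT ?orbF //=;
   apply/negbTE/negP => /andP[]; lra.
Qed.

Lemma cyl_minmax w x : pos_word w ->
  cyl w x <-> Num.min (cf w 0) (cf w 1) <= x <= Num.max (cf w 0) (cf w 1).
Proof.
move=> pw; rewrite -between_minmax; split.
  move=> [y /= y01 <-]; rewrite cf_between ?lexx ?ler01 //.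
  by rewrite /between y01.
by move=> /(cf_surj pw)[y y01 ->]; exists y.
Qed.

(** The supremum of the left end points. *)
Lemma nested_cyl (W : nat -> seq nat) : (forall j, pos_word (W j)) ->
  (forall j, exists2 v, pos_word v & W j.+1 = W j ++ v) ->
  exists x : R, forall j, cyl (W j) x.
Proof.
move=> pW ext.
have nest i j : (i <= j)%N -> @cyl R (W j) `<=` cyl (W i).
  move=> /subnKC <-; elim: (j - i)%N => [|k IH]; first by rewrite addn0.
  have [v pv e] := ext (i + k)%N.
  by rewrite addnS e; apply: subset_trans IH; exact: cyl_cat.
pose lo j : R := Num.min (cf (W j) 0) (cf (W j) 1).
pose hi j : R := Num.max (cf (W j) 0) (cf (W j) 1).
have lohi i j : lo i <= hi j.
  have h : cyl (W (maxn i j)) (cf (W (maxn i j)) (0 : R)).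
    by exists 0 => //=; rewrite lexx ler01.
  have /(cyl_minmax _ (pW i))/andP[a _] := nest _ _ (leq_maxl i j) _ h.
  have /(cyl_minmax _ (pW j))/andP[_ b] := nest _ _ (leq_maxr i j) _ h.
  exact: le_trans a b.
exists (sup (range lo)) => j; apply/cyl_minmax => //; apply/andP; split.
  apply: ub_le_sup; last by exists j.
  by exists (hi 0%N) => _ [i _ <-]; exact: lohi.
apply: ge_sup; first by exists (lo 0%N); exists 0%N.
by move=> _ [i _ <-]; exact: lohi.
Qed.

Lemma powR_unbounded B (a : R) X : 1 < B -> 0 < a ->
  exists N, forall n, (N <= n)%N -> X <= B `^ (n%:R * a).
Proof.
move=> B1 a0; have B0 : 0 < B by lra.
have h : 0 < B `^ a - 1.
  have := @powR_gap R B 1 a B1 isT a0; rewrite mul1r; move: (B `^ a) => b; lra.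
have bern n : 1 + n%:R * (B `^ a - 1) <= (B `^ a) ^+ n.
  move: h; move: (B `^ a) => b h; elim: n => [|n IH]; first by rewrite mul0r addr0.
  rewrite exprS; have b0 : 0 <= b by lra.
  apply: le_trans (ler_wpM2l b0 IH).
  have n0 : 0 <= n%:R :> R by [].
  have := mulr_ge0 n0 (sqr_ge0 (b - 1)); rewrite -natr1 expr2.
  by move: n0; move: (n%:R : R) => m; lra.
exists (Num.truncn `|X / (B `^ a - 1)|).+1 => n Nn.
have /andP[_ h1] := truncn_itv (normr_ge0 (X / (B `^ a - 1))).
have h2 : X / (B `^ a - 1) <= n%:R.
  apply: le_trans (ler_norm _) _; apply: le_trans (ltW h1) _.
  by rewrite ler_nat.
rewrite mulrC powRrM powR_mulrn ?powR_ge0 //; apply: le_trans (bern n).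
by move: h2; rewrite ler_pdivrMr //; lra.
Qed.

(** Exponential rates in a bounded range fall infinitely often into a cell of
    length eta. *)
Lemma rate_cell B (eta : R) (P : nat -> Prop) (M : nat -> R) : 1 < B -> 0 < eta ->
  (forall N, exists2 n, (N <= n)%N & P n) ->
  (forall n, P n -> 1 <= M n <= B `^ n%:R) ->
  exists j : nat, forall N, exists2 n, (N <= n)%N &
    P n /\ B `^ (n%:R * (j%:R * eta)) <= M n <= B `^ (n%:R * (j.+1%:R * eta)).
Proof.
move=> B1 e0 inf hM.
pose A (j : nat) := forall N, exists2 n, (N <= n)%N &
  P n /\ M n <= B `^ (n%:R * (j.+1%:R * eta)).
have exA : exists j, `[< A j >].
  exists (Num.truncn eta^-1); apply/asboolP => N.
  have [n Nn Pn] := inf N; exists n => //; split => //.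
  have /andP[_ h] := hM n Pn; apply: (le_trans h); apply: powR_B1 => //.
  rewrite ler_peMr //.
  have ei : 0 <= eta^-1 by rewrite invr_ge0 ltW.
  have /andP[_ h1] := truncn_itv ei.
  by rewrite -[leLHS](mulVf (lt0r_neq0 e0)) ler_wpM2r ?(ltW e0) // ltW.
case: (ex_minnP exA) => j /asboolP Aj minj; exists j.
case: j Aj minj => [|j] Aj minj.
  move=> N; have [n Nn [Pn hn]] := Aj N; exists n => //; split => //.
  by rewrite hn andbT mul0r mulr0 powRr0; case/andP: (hM n Pn).
have /asboolPn/existsNP[N0 hN0] : ~~ `[< A j >].
  by apply/negP => /minj; rewrite ltnn.
move=> N; have [n Nn [Pn hn]] := Aj (maxn N N0).
exists n; first exact: leq_trans (leq_maxl _ _) Nn.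
split => //; rewrite hn andbT leNgt; apply/negP => h.
apply: hN0; exists n; first exact: leq_trans (leq_maxr _ _) Nn.
by split => //; exact: ltW.
Qed.

Lemma word_hit_E2 B n (zn : R) x : 1 < B -> word_hit n (B `^ (- (n%:R / 2))) zn x ->
  0 <= x < 1 /\ `|iter n (@gauss_map R) x - zn| *
    `|iter n.+1 (@gauss_map R) x - gauss_map zn| < B ^- n.
Proof.
move=> B1 [w [y [nw [y01 hy] ->]]].
have pw := word_pos nw.
have /andP[c0 c1] := cf_itvo pw y01.
rewrite (ltW c0) c1; split => //.
have <- : (B `^ (- (n%:R / 2))) ^+ 2 = B ^- n.
  rewrite -powR_mulrn ?powR_ge0 // -powRrM -powR_invn; last lra.
  by congr powR; field.
have it : iter n (@gauss_map R) (cf w y) = y.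
  by case/andP: nw => /eqP <- _; exact: iter_gauss_cf.
by rewrite iterS it.
Qed.

Lemma rate_margin t s (tau : R) : 0 < t -> t < s -> s < 1 ->
  s ^+ 2 / 2 <= tau + (s - t) * t / 8 -> 0 <= tau - 2 * ((s - t) * t / 8).
Proof. by move=> t0 ts s1 h; nra. Qed.

Section Cantor.
Variables (B t s : R) (z : nat -> R).
Hypotheses (B1 : 1 < B) (hz : forall n, (1 <= n)%N -> 0 <= z n <= 1).
Hypotheses (t0 : 0 < t) (ts : t < s) (s1 : s < 1).
Hypothesis inf : forall N, exists2 n, (N <= n)%N & (s%:E < predim B n (z n))%E.

Let B0 : 0 < B. Proof. exact: lt_trans ltr01 B1. Qed.
Let s01 : 0 <= s <= 1.
Proof. by rewrite (ltW (lt_trans t0 ts)) ltW. Qed.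
Let t1 : t < 1. Proof. exact: lt_trans s1. Qed.
Let t01 : 0 < t < 1. Proof. by rewrite t0 t1. Qed.
(* A quarter of the gain of threshold_decay: one quarter is lost in the cell of the
   rate, two quarters in the blocks, and one remains. *)
Let eta := (s - t) * t / 8.
Let eta0 : 0 < eta.
Proof. by rewrite divr_gt0 ?mulr_gt0 ?subr_gt0. Qed.
Let e n := B `^ (- (n%:R / 2)).

Let inf1 : forall N, exists2 n, (N <= n)%N &
  (1 <= n)%N /\ ~ psum_le n s (threshold B n (z n) s).
Proof.
move=> N; have [n Nn hn] := inf (maxn 1 N).
have n1 : (1 <= n)%N by exact: leq_trans (leq_maxl _ _) Nn.
exists n; first exact: leq_trans (leq_maxr _ _) Nn.
by split => //; apply: lt_predim_psum => //; exact: hz.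
Qed.

(** Words whose partition function at s reaches the threshold, at one order l,
    serve as blocks; at other orders n of the same rate the blocks then descend
    to cylinders of load much smaller than the inverse threshold at t. *)
Let blocks_exist : exists sigma : R, [/\ 0 <= sigma,
  exists F l, [/\ uniq F, (forall b, b \in F -> size b = l /\ pos_word b)
    & 72 <= (B `^ (- sigma)) ^+ l.+1 * \sum_(b <- F) q b `^ (- (2 * t))]
  & forall c C : R, 0 < c -> 0 < C -> forall N, exists n, [/\ (N <= n)%N, (1 <= n)%N
      & C * (B `^ (- sigma)) ^+ n <= c * (threshold B n (z n) t)^-1]].
Proof.
have hM n : (1 <= n)%N /\ ~ psum_le n s (threshold B n (z n) s) ->
    1 <= threshold B n (z n) s <= B `^ n%:R.
  move=> [/hz zn _]; rewrite threshold_le // andbT; apply: le_trans (threshold_ge n B1 zn s01).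
  rewrite -[leLHS](powRr0 B); apply: powR_B1 => //.
  by rewrite mulr_ge0 // divr_ge0 // sqr_ge0.
have [j hj] := rate_cell B1 eta0 inf1 hM.
pose tau := j%:R * eta.
have jE : j.+1%:R * eta = tau + eta by rewrite -natr1 mulrDl mul1r.
have tau_ge : s ^+ 2 / 2 <= tau + eta.
  have [n _ [[n1 _] /andP[_ hn]]] := hj 0%N.
  have := le_trans (threshold_ge n B1 (hz n1) s01) hn; rewrite jE.
  rewrite leNgt => /negP h; rewrite leNgt; apply/negP => h'; apply: h.
  rewrite /powR gt_eqF // ltr_expR ltr_pM2r ?ln_gt0 //.
  by rewrite ltr_pM2l // ltr0n.
exists (tau - 2 * eta).
have s2t : 0 <= tau - 2 * eta.
  by move: tau_ge; exact: rate_margin.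
split => //.
- have e20 : 0 < 2 * eta by rewrite mulr_gt0.
  have [l0 hl0] := powR_unbounded (72 * B `^ (tau - 2 * eta)) B1 e20.
  have [l ll [[l1 nz] /andP[hl _]]] := hj l0.
  have [F [uF wF hF]] := psum_leN nz.
  exists F, l; split => //.
    by move=> b /(allP wF)/andP[/eqP sb pb].
  apply: (@le_trans _ _ ((B `^ (- (tau - 2 * eta))) ^+ l.+1 * B `^ (l%:R * tau))).
    rewrite -powR_mulrn ?powR_ge0 // -powRrM -powRDpos //.
    have -> : - (tau - 2 * eta) * l.+1%:R + l%:R * tau =
       l%:R * (2 * eta) - (tau - 2 * eta) by rewrite -natr1; ring.
    rewrite powRDpos // powRN ler_pdivlMr ?powR_gt0 //.
    exact: hl0.
  rewrite ler_wpM2l ?exprn_ge0 ?powR_ge0 //.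
  apply: (le_trans hl); apply: (le_trans (ltW hF)).
  rewrite big_seq [leRHS]big_seq; apply: ler_sum => b /(allP wF)/word_pos/(q_ge1 R) b1.
  apply: ler_powR => //; rewrite lerN2 ler_wpM2l //; exact: ltW.
- move=> c C c0 C0 N.
  have [n0 hn0] := @powR_unbounded B eta (C / c) B1 eta0.
  have [n nN [[n1 _] /andP[_ hn]]] := hj (maxn N n0).
  have Nn := leq_trans (leq_maxl _ _) nN; have n0n := leq_trans (leq_maxr _ _) nN.
  exists n; split => //.
  have Mt := threshold_decay n B1 (hz n1) t0 ts s1.
  have Mt0 : 0 < threshold B n (z n) t.
    have tt : 0 <= t <= 1 by rewrite !ltW.
    by apply: lt_le_trans (threshold_ge n B1 (hz n1) tt); rewrite powR_gt0.
  rewrite ler_pdivlMr //.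
  have P0 : 0 <= C * (B `^ (- (tau - 2 * eta))) ^+ n.
    by rewrite mulr_ge0 ?exprn_ge0 ?powR_ge0 // ltW.
  apply: le_trans (ler_wpM2l P0 Mt) _.
  have Q0 : 0 <= B `^ (- (n%:R * ((s - t) * t / 2))) by exact: powR_ge0.
  apply: le_trans (ler_wpM2l P0 (ler_wpM2l Q0 hn)) _.
  rewrite jE -powR_mulrn ?powR_ge0 // -powRrM -!mulrA -!powRDpos //.
  have -> : - (tau - 2 * eta) * n%:R +
     (- (n%:R * ((s - t) * (t / 2))) + n%:R * (tau + eta)) = - (n%:R * eta).
    by rewrite /eta; field.
  rewrite powRN ler_pdivrMr ?powR_gt0 // mulrC -ler_pdivrMr //.
  exact: hn0.
Qed.

(** A cover of cost below kappa is beaten by a sequence of nested cylinders, each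
    made inside a target of some order n: their loads are at most kappa q^(-2t)
    and tend to 0, so that no covering set contains their common point. *)
Lemma cover_cost_ge : exists2 kappa : R, 0 < kappa &
  forall (U : nat -> set R) (r : nat -> R), (forall i, 0 < r i) ->
    (forall i x y, U i x -> U i y -> `|x - y| <= r i) ->
    (forall n, \sum_(i < n) r i `^ t <= kappa) ->
    ~ (E2 z B `<=` \bigcup_i U i).
Proof.
have [sigma [sg0 [F [l [uF wF FZ]]] rate]] := blocks_exist.
have [g g0 sepF] := @cf_sep_family R F l wF.
pose d := B `^ (- sigma).
have d01 : 0 < d <= 1.
  rewrite powR_gt0 //= -[leRHS](powRr0 B); apply: powR_B1 => //.
  by rewrite oppr_le0.
have G0 : 0 < (g / 4) `^ t by rewrite powR_gt0 // divr_gt0.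
pose kappa := Num.min 1 ((g / 4) `^ t) / 2.
have m0 : 0 < Num.min 1 ((g / 4) `^ t) by rewrite lt_min ltr01.
have k0 : 0 < kappa by rewrite divr_gt0.
have km : kappa < Num.min 1 ((g / 4) `^ t).
  by rewrite /kappa ltr_pdivrMr // ltr_pMr // ltr1n.
have k1 : 0 < kappa <= 1.
  by rewrite k0 ltW // (lt_le_trans km) // ge_min lexx.
have kg : 0 < kappa < (g / 4) `^ t.
  by rewrite k0 (lt_le_trans km) // ge_min lexx orbT.
exists kappa => // U r r0 Ur cost cover.
pose Qw w := q w `^ (- (2 * t)).
pose good w := pos_word w /\ load_le t U r (cyl w) (kappa * Qw w).
have step w (N : nat) : exists w', good w -> [/\ good w',
    exists2 v, pos_word v & w' = w ++ v, (size w < size w')%N &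
    exists n, [/\ (N <= n)%N, (1 <= n)%N &
      forall y, 0 <= y <= 1 -> word_hit n (e n) (z n) (cf w' y)]].
  have [[pw Lw]|ng] := pselect (good w); last by exists w => /ng.
  have [C C0 hC] := descend t01 Ur uF wF g0 sepF d01 FZ pw kg Lw.
  pose c : R := kappa / (96 * 96 * 48) / 4.
  have c0 : 0 < c by rewrite !divr_gt0.
  have [n [nN n1 hn]] := rate c C c0 C0 (maxn N (size w)).
  have Nn := leq_trans (leq_maxl _ _) nN; have wn := leq_trans (leq_maxr _ _) nN.
  have [v [pv sv Lv]] := hC n wn.
  have pwv : pos_word (w ++ v) by rewrite pos_word_cat pw.
  have e01 : 0 < e n <= 1.
    by rewrite /e powR_gt0 //= -[leRHS](powRr0 B); apply: powR_B1.
  have eE (a : R) : B `^ (n%:R * a) = e n `^ (- (2 * a)).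
    by rewrite /e -powRrM; congr powR; field.
  have [a0 [N' [al [be [[Na alb b1 short tg] T1 T2]]]]] :=
    target_exists t01 e01 eE (hz n1).
  set M := threshold B n (z n) t in hn T1 T2.
  have M0 : 0 <= M^-1.
    have tt : 0 <= t <= 1 by rewrite !ltW.
    rewrite invr_ge0; apply: le_trans (threshold_ge n B1 (hz n1) tt).
    exact: powR_ge0.
  have K0 : 0 < C * d ^+ n by rewrite mulr_gt0 ?exprn_gt0 //; case/andP: d01.
  have [||v' [pv' sv' Lv' hv']] := round_step t01 r0 Ur pwv K0 k1 Na alb b1 short Lv.
  - apply: (le_trans hn).
    have cc : c <= 128^-1 / 4.
      rewrite /c ler_wpM2r // ler_pdivrMr //; case/andP: k1 => _.
      have h : 1 <= 128^-1 * (96 * 96 * 48) :> R by lra.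
      by move=> kl; exact: le_trans kl h.
    apply: le_trans (ler_wpM2r M0 cc) _.
    have -> : 128^-1 / 4 * M^-1 = M^-1 / 4 / 128 by ring.
    by rewrite ler_wpM2r.
  - apply: (le_trans hn); rewrite /c.
    have -> : kappa / (96 * 96 * 48) / 4 * M^-1 = kappa / (96 * 96 * 48) * (M^-1 / 4).
      by ring.
    by rewrite ler_wpM2l // divr_ge0 // ltW.
  exists ((w ++ v) ++ v') => _; split.
  - by split => //; rewrite pos_word_cat pwv.
  - by exists (v ++ v'); rewrite ?catA // pos_word_cat pv.
  - by rewrite !size_cat -addnA -[ltnLHS]addn0 ltn_add2l addn_gt0 sv' orbT.
  exists n; split => // y y01; have [k [y' [kN hy' y'01 ->]]] := hv' y y01.
  exists (w ++ v), ((k%:R + y')^-1); split => //.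
    by rewrite /word sv eqxx.
  exact: tg.
have [f0 hf0] := choice (fun p : seq nat * nat => step p.1 p.2).
pose W := fix W j := if j is j'.+1 then f0 (W j', j') else [::].
have gW j : good (W j).
  elim: j => [|j IH]; last by have [] := hf0 (W j, j) IH.
  split => // n; rewrite /load /Qw /cf_denom /= powR1 mulr1.
  apply: le_trans (cost n); rewrite big_mkcond; apply: ler_sum => i _.
  by case: ifP => // _; exact: powR_ge0.
have hW j := hf0 (W j, j) (gW j).
have pW j : pos_word (W j) by have [] := gW j.
have [x hx] : exists x : R, forall j, cyl (W j) x.
  by apply: nested_cyl => // j; have [_ h _ _] := hW j.
have hit_x j : exists n, [/\ (j <= n)%N, (1 <= n)%N & word_hit n (e n) (z n) x].
  have [_ _ _ [n [jn n1 hn]]] := hW j; exists n; split => //.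
  by have [y y01 <-] := hx j.+1; exact: hn.
have [i _ Ux] : (\bigcup_i U i) x.
  apply: cover; split.
    by have [n [_ _ /(word_hit_E2 B1)[]]] := hit_x 0%N.
  move=> fin; have [m hm] : exists m, forall n, (1 <= n)%N /\
      `|iter n (@gauss_map R) x - z n| *
      `|iter n.+1 (@gauss_map R) x - gauss_map (z n)| < B ^- n -> (n < m)%N.
    have [X hX] := (finite_seqP _).1 fin.
    exists (\max_(n <- X) n.+1) => n hn.
    have nX : [set` X] n by rewrite -hX.
    exact: (@leq_bigmax_seq _ X xpredT S n nX).
  have [n [mn n1 hn]] := hit_x m; have [_ h] := word_hit_E2 B1 hn.
  by have := hm n (conj n1 h); rewrite ltnNge mn.
have sW j : (j <= size (W j))%N.
  by elim: j => // j IH; have [_ _ h _] := hW j; exact: leq_ltn_trans IH h.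
have Wi j : r i `^ t <= kappa * Qw (W j).
  have [_ L] := gW j; apply: load_le_mem L _.
  by apply/meets_setP; exists x.
have ri : 0 < r i `^ t by rewrite powR_gt0.
pose X := (1 + kappa / r i `^ t) `^ (2 * t)^-1.
have y1 : 0 < 1 + kappa / r i `^ t by rewrite addr_gt0 ?divr_gt0.
have X0 : 0 < X by exact: powR_gt0.
pose m := (Num.truncn X).+1.
have Xm : X < m%:R by have /andP[] := truncn_itv (ltW X0).
have qm : X <= q (W m).
  apply: (le_trans (ltW Xm)); rewrite ler_nat.
  exact: leq_trans (sW m) (size_le_cf_denom (pW m)).
have t20 : 0 < 2 * t by rewrite mulr_gt0.
have := Wi m; rewrite leNgt => /negP; apply.
apply: (@le_lt_trans _ _ (kappa * X `^ (- (2 * t)))).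
  by rewrite ler_wpM2l ?(ltW k0) // powRN_le_base // ltW.
rewrite powRN -powRrM mulVf ?gt_eqF // powRr1 ?(ltW y1) //.
rewrite ltr_pdivrMr // mulrDr mulr1 mulrCA mulfV ?gt_eqF // mulr1.
by rewrite ltrDr.
Qed.
End Cantor.
End Lower.

(** * Upper limits of extended reals *)

Section UpperLimit.
Variable R : realType.
Implicit Types (u : nat -> \bar R) (x : \bar R) (n N : nat).

Lemma limn_esupE u : limn_esup u = ereal_inf (range (esups u)).
Proof. by rewrite limn_esup_lim; apply/cvg_lim => //; exact: cvg_esups_inf. Qed.

Lemma limn_esup_lt u x : (limn_esup u < x)%E ->
  exists N, forall n, (N <= n)%N -> (u n < x)%E.
Proof.
rewrite limn_esupE => /ereal_inf_lt[_ [N _ <-] h]; exists N => n Nn.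
by apply: le_lt_trans h; apply: ereal_sup_ubound; exists n.
Qed.

Lemma lt_limn_esup u x N : (x < limn_esup u)%E ->
  exists2 n, (N <= n)%N & (x < u n)%E.
Proof.
rewrite limn_esupE => h.
have : (x < esups u N)%E.
  by apply: lt_le_trans h _; apply: ereal_inf_lbound; exists N.
by move=> /ereal_sup_gt[_ [n Nn <-] xn]; exists n.
Qed.
End UpperLimit.

Unset Implicit Arguments.

Theorem theorem1p3 (R : realType) (B : R) (z : nat -> R)
    (hB : 1 < B) (hz : forall n : nat, (1 <= n)%N -> 0 <= z n <= 1) :
  hausdorff_dim (E2 z B) = limn_esup (fun n : nat => predim B n (z n)).
Proof.
set u := fun n : nat => predim B n (z n).
have L_ge : ((1 / 2)%:E <= limn_esup u)%E.
  rewrite leNgt; apply/negP => /limn_esup_lt[N hN].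
  have := hN (maxn 1 N) (leq_maxr _ _); apply/negP; rewrite -leNgt.
  by apply: predim_ge_half; rewrite ?hz // leq_maxl.
have L_le : (limn_esup u <= 1)%E.
  rewrite leNgt; apply/negP => hL.
  have half : 0 < 1 / 2 :> R by lra.
  have [N hN] := powR_unbounded 2 hB half.
  have [n nN] := lt_limn_esup (maxn 1 N) hL.
  apply/negP; rewrite -leNgt; apply: predim_le_one => //.
    by apply: hz; exact: leq_trans (leq_maxl _ _) nN.
  by rewrite -div1r; apply: hN; exact: leq_trans (leq_maxr _ _) nN.
have [l lE] : exists l : R, limn_esup u = l%:E.
  by case: (limn_esup u) L_ge L_le => [l| |] // _ _; exists l.
rewrite lE !lee_fin in L_ge L_le *.
apply/eqP; rewrite eq_le; apply/andP; split.
- apply/lee_addgt0Pr => eps eps0; rewrite -EFinD.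
  have [l1|l1] := ltP l 1.
    pose s := Num.min (l + eps) ((l + 1) / 2).
    have ls : l < s by rewrite lt_min; apply/andP; split; lra.
    have s1 : s < 1 by rewrite gt_min; apply/orP; right; lra.
    pose r := (l + s) / 2.
    have [N hN] : exists N, forall n, (N <= n)%N -> (u n < r%:E)%E.
      by apply: limn_esup_lt; rewrite lE lte_fin /r; lra.
    apply: (@le_trans _ _ s%:E); last by rewrite lee_fin ge_min lexx.
    apply: ereal_inf_lbound; exists s => //; split; first by rewrite /=; lra.
    apply: (@E2_null _ B s r z N) => //; first lra.
    by rewrite /r; lra.
  apply: ereal_inf_lbound; exists (l + eps) => //; split; first by rewrite /=; lra.
  by apply: unit_null => [|x []] //; lra.
- apply: le_ereal_inf_tmp => _ [s0 [s00 ms0] <-]; rewrite lee_fin leNgt.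
  apply/negP => s0l.
  pose t := (2 * s0 + l) / 3; pose s := (s0 + 2 * l) / 3.
  have t0 : 0 < t by rewrite /t; lra.
  have s0t : s0 <= t by rewrite /t; lra.
  have ts : t < s by rewrite /t /s; lra.
  have s1 : s < 1 by rewrite /s; lra.
  have inf N : exists2 n, (N <= n)%N & (s%:E < u n)%E.
    by apply: lt_limn_esup; rewrite lE lte_fin /s; lra.
  have [kappa k0 hk] := cover_cost_ge hB hz t0 ts s1 inf.
  have [U [r [EU r0 Ur cost]]] := null_cover s00 s0t t0 k0 ms0.
  exact: (hk U r r0 Ur cost EU).
Qed.
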